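(* Let $F$ be a number field, let $a,b,c,d$ be positive integers, and let $Q\in F[x,y,z]$ be a quasihomogeneous polynomial of degree $d$, where $\deg x=a$, $\deg y=b$, $\deg z=c$. Let $X\subset\mathbb A^3$ be the surface $Q=0$ and assume that $0$ is an isolated singular point of $X$. Let $A=\mathcal O_X=F[x,y,z]/(Q)$, a graded Poisson algebra with bracket determined by $\{x,y\}=Q_z$, $\{y,z\}=Q_x$, $\{z,x\}=Q_y$ (subscripts denote partial derivatives). Put $$g(z):=z^{a+b+c-d}\,\frac{1-z^d}{(1-z^a)(1-z^b)(1-z^c)}.$$ Then for all sufficiently large primes $p$ and every $\mathfrak p\in \mathrm{Spec}(R)_p$, the Hilbert series $H_{A,\mathfrak p}(t)$ of $A_{\mathfrak p}/\{A_{\mathfrak p},A_{\mathfrak p}\}$ is $$H_{A,\mathfrak p}(t)=\frac{(1-t^{d-a})(1-t^{d-b})(1-t^{d-c})}{(1-t^a)(1-t^b)(1-t^c)}+t^{d-a-b-c}f(t^p),$$ where $$f(z)=g(z)-g_-(z)+g_-(z^{-1})-g_0 .$$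
   Context: Reduction modulo primes: fix a finitely generated subring $R\subset F$ which generates $F$ as a field, and a finitely generated graded $R$-subalgebra $A_R\subset A$, closed under the Poisson bracket, which spans $A$ over $F$ (for example, if $R$ contains the coefficients of $Q$, the $R$-subalgebra of $A$ generated by $x,y,z$). For a rational prime $p$, $\mathrm{Spec}(R)_p$ is the set of prime ideals $\mathfrak p\subset R$ such that $R/\mathfrak p$ is a finite field of characteristic $p$. For $\mathfrak p\in \mathrm{Spec}(R)_p$ put $A_{\mathfrak p}=A_R/\mathfrak pA_R$, a graded Poisson algebra over $R/\mathfrak p$. For any two choices of $(R,A_R)$ almost all reductions $A_{\mathfrak p}$ are canonically the same; ''sufficiently large $p$'' means all $p\ge p_0$ for some $p_0$ which may depend on all the choices. $\{A_{\mathfrak p},A_{\mathfrak p}\}$ denotes the linear span of all brackets. The Hilbert series of a $\mathbb Z_{\ge 0}$-graded vector space $Y=\bigoplus_m Y[m]$ with finite dimensional components is $h_Y(t)=\sum_{m\ge 0}\dim Y[m]\,t^m$; $H_{A,\mathfrak p}(t)=h_{A_{\mathfrak p}/\{A_{\mathfrak p},A_{\mathfrak p}\}}(t)$. For a rational function $\phi(z)$, $\phi_-(z)$ denotes the sum of all terms of negative degree of the Laurent expansion of $\phi$ at $z=0$, and $\phi_0$ denotes the constant term of this expansion. $g_-(z^{-1})$ denotes the result of substituting $z^{-1}$ for $z$ in $g_-(z)$. *)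

(* Defs.v *)
From HB Require Import structures.
From mathcomp Require Import all_boot all_order all_algebra all_field.
From mathcomp Require Import generic_quotient ring_quotient fraction.
From mathcomp Require Import mpoly boolp.
From mathcomp Require Import ring.

Set Implicit Arguments.
Unset Strict Implicit.
Unset Printing Implicit Defensive.

Import Order.TTheory GRing.Theory Num.Theory.
Local Open Scope ring_scope.
Local Open Scope quotient_scope.

(* Subsets are boolean predicates; classically (boolp) every subset is one.  *)

Section Span.
Variables (R : nzRingType) (M : lmodType R).

Definition lspan (S : M -> Prop) : pred M := fun u =>
  `[< exists s : seq (R * M), (forall x, x \in s -> S x.2) /\
        u = \sum_(x <- s) x.1 *: x.2 >].

Variable S : M -> Prop.

Lemma lspan_zmod_closed : zmod_closed (lspan S).
Proof.
split; first by apply/asboolP; exists [::]; rewrite big_nil.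
move=> _ _ /asboolP[s [sS ->]] /asboolP[t [tS ->]]; apply/asboolP.
exists (s ++ [seq (- x.1, x.2) | x <- t]); split=> [x|].
  by rewrite mem_cat => /orP[/sS//|/mapP[y /tS yS ->]].
rewrite big_cat big_map /= -sumrN; congr (_ + _).
by apply: eq_bigr => x _; rewrite scaleNr.
Qed.
HB.instance Definition _ := GRing.isZmodClosed.Build M (lspan S)
  lspan_zmod_closed.

Lemma lspan_scaler_closed : GRing.scaler_closed (lspan S).
Proof.
move=> a _ /asboolP[s [sS ->]]; apply/asboolP.
exists [seq (a * x.1, x.2) | x <- s]; split=> [x|].
  by move=> /mapP[y /sS yS ->].
by rewrite big_map scaler_sumr; apply: eq_bigr => x _; rewrite scalerA.
Qed.
HB.instance Definition _ := GRing.isScaleClosed.Build R M (lspan S)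
  lspan_scaler_closed.

End Span.

Section QuotientModule.
Variables (R : nzRingType) (M : lmodType R) (S : M -> Prop).

(* M / <S>, where <S> is the submodule spanned by S *)
Definition modquot : Type := Quotient.quot (GRing.ZmodClosed.clone M (lspan S) _).
HB.instance Definition _ := GRing.Zmodule.on modquot.
HB.instance Definition _ := Quotient.on modquot.

Lemma modquot_eq (u v : M) :
  (\pi_modquot u = \pi_modquot v) <-> (u - v \in lspan S).
Proof. by rewrite Quotient.idealrBE; split=> [/eqP|/eqP]. Qed.

Lemma modquot_piD (u v : M) : \pi_modquot (u + v) = \pi u + \pi v.
Proof. exact: Quotient.pi_add. Qed.

Definition modquot_scale (a : R) (u : modquot) : modquot :=
  \pi_modquot (a *: repr u).

Lemma modquot_piZ a (u : M) : modquot_scale a (\pi u) = \pi_modquot (a *: u).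
Proof.
apply/modquot_eq; rewrite -scalerBr; apply/rpredZ/modquot_eq; exact: reprK.
Qed.

Fact modquot_scaleA a b u :
  modquot_scale a (modquot_scale b u) = modquot_scale (a * b) u.
Proof. by rewrite modquot_piZ scalerA. Qed.
Fact modquot_scale1 : left_id 1 modquot_scale.
Proof. by move=> u; rewrite /modquot_scale scale1r reprK. Qed.
Fact modquot_scaleDr : right_distributive modquot_scale +%R.
Proof.
move=> a u v; rewrite -[u]reprK -[v]reprK -modquot_piD !modquot_piZ.
by rewrite scalerDr modquot_piD.
Qed.
Fact modquot_scaleDl u : {morph modquot_scale^~ u : a b / a + b}.
Proof. by move=> a b; rewrite /modquot_scale scalerDl modquot_piD. Qed.
HB.instance Definition _ := GRing.Zmodule_isLmodule.Build R modquot
  modquot_scaleA modquot_scale1 modquot_scaleDr modquot_scaleDl.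

End QuotientModule.

Section Reduction.
Variables (R : comNzRingType) (I : idealr R) (M : lmodType R).
Local Notation k := {ideal_quot I}.

Definition ideal_mod : pred M := fun u =>
  `[< exists s : seq (R * M), (forall x, x \in s -> x.1 \in I) /\
        u = \sum_(x <- s) x.1 *: x.2 >].

Lemma ideal_mod_zmod_closed : zmod_closed ideal_mod.
Proof.
split; first by apply/asboolP; exists [::]; rewrite big_nil.
move=> _ _ /asboolP[s [sS ->]] /asboolP[t [tS ->]]; apply/asboolP.
exists (s ++ [seq (- x.1, x.2) | x <- t]); split=> [x|].
  rewrite mem_cat => /orP[/sS//|/mapP[y /tS yS ->]].
  by rewrite /= rpredN.
rewrite big_cat big_map /= -sumrN; congr (_ + _).
by apply: eq_bigr => x _; rewrite scaleNr.
Qed.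
HB.instance Definition _ := GRing.isZmodClosed.Build M ideal_mod
  ideal_mod_zmod_closed.

Lemma ideal_modZ a u : a \in I -> a *: u \in ideal_mod.
Proof.
move=> aI; apply/asboolP; exists [:: (a, u)]; split=> [x|].
  by rewrite inE => /eqP->.
by rewrite big_seq1.
Qed.

Lemma ideal_mod_scaler_closed : GRing.scaler_closed ideal_mod.
Proof.
move=> a _ /asboolP[s [sS ->]]; apply/asboolP.
exists [seq (a * x.1, x.2) | x <- s]; split=> [x|].
  by move=> /mapP[y /sS yS ->]; rewrite idealMr.
by rewrite big_map scaler_sumr; apply: eq_bigr => x _; rewrite scalerA.
Qed.

(* M / I M, as a module over R / I *)
Definition reduction : Type := Quotient.quot (GRing.ZmodClosed.clone M ideal_mod _).
HB.instance Definition _ := GRing.Zmodule.on reduction.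
HB.instance Definition _ := Quotient.on reduction.

Lemma reduction_eq (u v : M) :
  (\pi_reduction u = \pi_reduction v) <-> (u - v \in ideal_mod).
Proof. by rewrite Quotient.idealrBE; split=> [/eqP|/eqP]. Qed.

Lemma reduction_piD (u v : M) : \pi_reduction (u + v) = \pi u + \pi v.
Proof. exact: Quotient.pi_add. Qed.

Definition reduction_scale (a : k) (u : reduction) : reduction :=
  \pi_reduction (repr a *: repr u).

Lemma reduction_piZ (a : R) (u : M) :
  reduction_scale (\pi a) (\pi u) = \pi_reduction (a *: u).
Proof.
apply/reduction_eq; set a' := repr _; set u' := repr _.
have -> : a' *: u' - a *: u = (a' - a) *: u' + a *: (u' - u).
  by rewrite scalerBl scalerBr addrA subrK.
rewrite rpredD //.
  by apply: ideal_modZ; rewrite Quotient.idealrBE reprK.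
by apply/ideal_mod_scaler_closed/reduction_eq; exact: reprK.
Qed.

Fact reduction_scaleA a b u :
  reduction_scale a (reduction_scale b u) = reduction_scale (a * b) u.
Proof.
elim/quotW: a => a; elim/quotW: b => b; elim/quotW: u => u.
have piM (x y : R) : \pi_k x * \pi_k y = \pi_k (x * y) by rewrite pi_mulr.
by rewrite (reduction_piZ b) piM !reduction_piZ scalerA.
Qed.
Fact reduction_scale1 : left_id 1 reduction_scale.
Proof.
elim/quotW=> u; have -> : 1 = \pi_k 1 by rewrite pi_oner.
by rewrite reduction_piZ scale1r.
Qed.
Fact reduction_scaleDr : right_distributive reduction_scale +%R.
Proof.
elim/quotW=> a; elim/quotW=> u; elim/quotW=> v; rewrite -reduction_piD.
by rewrite !reduction_piZ scalerDr reduction_piD.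
Qed.
Fact reduction_scaleDl u : {morph reduction_scale^~ u : a b / a + b}.
Proof.
elim/quotW=> a; elim/quotW=> b; elim/quotW: u => u.
have piD (x y : R) : \pi_k x + \pi_k y = \pi_k (x + y) by rewrite pi_addr.
by rewrite piD !reduction_piZ scalerDl reduction_piD.
Qed.
HB.instance Definition _ :=
  GRing.Zmodule_isLmodule.Build k reduction
    reduction_scaleA reduction_scale1 reduction_scaleDr reduction_scaleDl.

End Reduction.

Definition has_dim (k : nzRingType) (V : lmodType k) (S : V -> Prop) (n : nat) :=
  exists v : 'I_n -> V, (forall i, S (v i)) /\
    forall u, S u -> exists! c : {ffun 'I_n -> k}, u = \sum_i c i *: v i.

Definition ix : 'I_3 := @Ordinal 3 0 isT.
Definition iy : 'I_3 := @Ordinal 3 1 isT.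
Definition iz : 'I_3 := @Ordinal 3 2 isT.

Definition wt (a b c : nat) (i : 'I_3) : nat := tnth [tuple a; b; c] i.

Definition wdeg (w : 'I_3 -> nat) (m : 'X_{1..3}) : nat :=
  (\sum_(i < 3) w i * m i)%N.

Definition quasihomogeneous (K : nzRingType) (w : 'I_3 -> nat) (d : nat)
    (f : {mpoly K[3]}) :=
  {in msupp f, forall m, wdeg w m = d}.

Section CoordinateRing.
Variables (F : fieldType) (Q : {mpoly F[3]}).
Local Notation P := {mpoly F[3]}.
Implicit Types f g h : P.

Definition principal : pred P := fun f => `[< exists h, f = h * Q >].

Lemma principal_zmod_closed : zmod_closed principal.
Proof.
split; first by apply/asboolP; exists 0; rewrite mul0r.
move=> _ _ /asboolP[f ->] /asboolP[g ->]; apply/asboolP.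
by exists (f - g); rewrite mulrBl.
Qed.
HB.instance Definition _ := GRing.isZmodClosed.Build P principal
  principal_zmod_closed.

Lemma principalMl h f : f \in principal -> h * f \in principal.
Proof. by move=> /asboolP[g ->]; apply/asboolP; exists (h * g); rewrite mulrA. Qed.

Definition coordring : Type :=
  Quotient.quot (GRing.ZmodClosed.clone P principal _).
HB.instance Definition _ := GRing.Zmodule.on coordring.
HB.instance Definition _ := Quotient.on coordring.

Lemma coordring_eq f g :
  (\pi_coordring f = \pi_coordring g) <-> (f - g \in principal).
Proof. by rewrite Quotient.idealrBE; split=> [/eqP|/eqP]. Qed.

Lemma repr_principal f : repr (\pi_coordring f) - f \in principal.
Proof. by apply/coordring_eq; exact: reprK. Qed.

Lemma coordring_piD f g : \pi_coordring (f + g) = \pi f + \pi g.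
Proof. exact: Quotient.pi_add. Qed.

Lemma coordring_piN f : \pi_coordring (- f) = - \pi f.
Proof. exact: Quotient.pi_opp. Qed.

Definition coordring_mul (u v : coordring) : coordring :=
  \pi_coordring (repr u * repr v).

Lemma coordring_piM f g : coordring_mul (\pi f) (\pi g) = \pi_coordring (f * g).
Proof.
apply/coordring_eq; set f' := repr _; set g' := repr _.
have -> : f' * g' - f * g = g' * (f' - f) + f * (g' - g).
  by rewrite !mulrBr [g' * f']mulrC [g' * f]mulrC addrA subrK.
by rewrite rpredD // principalMl // repr_principal.
Qed.

Fact coordring_mulA : associative coordring_mul.
Proof.
elim/quotW=> f; elim/quotW=> g; elim/quotW=> h.
by rewrite (coordring_piM f g) (coordring_piM g h) !coordring_piM mulrA.
Qed.
Fact coordring_mulC : commutative coordring_mul.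
Proof. by elim/quotW=> f; elim/quotW=> g; rewrite !coordring_piM mulrC. Qed.
Fact coordring_mul1 : left_id (\pi_coordring 1) coordring_mul.
Proof. by elim/quotW=> f; rewrite coordring_piM mul1r. Qed.
Fact coordring_mulDl : left_distributive coordring_mul +%R.
Proof.
elim/quotW=> f; elim/quotW=> g; elim/quotW=> h.
by rewrite -coordring_piD (coordring_piM f h) (coordring_piM g h) coordring_piM
  mulrDl coordring_piD.
Qed.
HB.instance Definition _ := GRing.Zmodule_isComPzRing.Build coordring
  coordring_mulA coordring_mulC coordring_mul1 coordring_mulDl.

Definition coordring_scale (a : F) (u : coordring) : coordring :=
  \pi_coordring (a *: repr u).

Lemma coordring_piZ a f : coordring_scale a (\pi f) = \pi_coordring (a *: f).
Proof.
apply/coordring_eq; rewrite -scalerBr -mul_mpolyC principalMl //.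
exact: repr_principal.
Qed.

Fact coordring_scaleA a b u :
  coordring_scale a (coordring_scale b u) = coordring_scale (a * b) u.
Proof.
by elim/quotW: u => f; rewrite (coordring_piZ b f) !coordring_piZ scalerA.
Qed.
Fact coordring_scale1 : left_id 1 coordring_scale.
Proof. by elim/quotW=> f; rewrite coordring_piZ scale1r. Qed.
Fact coordring_scaleDr : right_distributive coordring_scale +%R.
Proof.
move=> a; elim/quotW=> f; elim/quotW=> g.
by rewrite -coordring_piD !coordring_piZ scalerDr coordring_piD.
Qed.
Fact coordring_scaleDl u : {morph coordring_scale^~ u : a b / a + b}.
Proof.
by elim/quotW: u => f a b; rewrite !coordring_piZ scalerDl coordring_piD.
Qed.
HB.instance Definition _ := GRing.Zmodule_isLmodule.Build F coordring
  coordring_scaleA coordring_scale1 coordring_scaleDr coordring_scaleDl.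

(* The biderivation of F[x,y,z] with {x,y} = Q_z, {y,z} = Q_x, {z,x} = Q_y. *)
Definition pbracket f g : P :=
  Q^`M(iz) * (f^`M(ix) * g^`M(iy) - f^`M(iy) * g^`M(ix)) +
  Q^`M(ix) * (f^`M(iy) * g^`M(iz) - f^`M(iz) * g^`M(iy)) +
  Q^`M(iy) * (f^`M(iz) * g^`M(ix) - f^`M(ix) * g^`M(iz)).

Definition bracket (u v : coordring) : coordring :=
  \pi_coordring (pbracket (repr u) (repr v)).

Lemma pbracket_gen :
  [/\ pbracket 'X_ix 'X_iy = Q^`M(iz), pbracket 'X_iy 'X_iz = Q^`M(ix)
    & pbracket 'X_iz 'X_ix = Q^`M(iy)].
Proof.
have dX i j : ('X_i : P)^`M(j) = (i == j)%:R.
  rewrite mderivX mnm1E; case: eqP => [<-|_]; last by rewrite scale0r.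
  rewrite scale1r (_ : (U_(i) - U_(i))%MM = 0%MM) ?mpolyX0 //.
  by apply/mnmP => l; rewrite mnmBE subnn mnm0E.
by split; rewrite /pbracket !dX /=; ring.
Qed.

Lemma pbracket_pi f g : bracket (\pi f) (\pi g) = \pi_coordring (pbracket f g).
Proof.
have Bl f1 f2 h : pbracket (f1 - f2) h = pbracket f1 h - pbracket f2 h.
  by rewrite /pbracket !mderivB; ring.
have Cl h1 h2 : pbracket h1 h2 = - pbracket h2 h1 by rewrite /pbracket; ring.
have Ql h1 h2 : pbracket (h1 * Q) h2 = pbracket h1 h2 * Q.
  by rewrite /pbracket !mderivM; ring.
have Il h1 h2 : h1 \in principal -> pbracket h1 h2 \in principal.
  by move=> /asboolP[h ->]; apply/asboolP; exists (pbracket h h2).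
apply/coordring_eq; set f' := repr _; set g' := repr _.
have -> : pbracket f' g' - pbracket f g
        = pbracket (f' - f) g' - pbracket (g' - g) f.
  by rewrite !Bl (Cl g' f) (Cl g f); ring.
by rewrite rpredB // Il // repr_principal.
Qed.

Lemma bracketN u v : bracket u v = - bracket v u.
Proof.
elim/quotW: u => f; elim/quotW: v => g; rewrite (pbracket_pi f g) (pbracket_pi g f).
rewrite -coordring_piN; congr (\pi_coordring _).
by rewrite /pbracket; ring.
Qed.

Lemma bracketDl u v t : bracket (u + v) t = bracket u t + bracket v t.
Proof.
elim/quotW: u => f; elim/quotW: v => g; elim/quotW: t => h.
rewrite -coordring_piD (pbracket_pi (f + g) h) (pbracket_pi f h) (pbracket_pi g h).
by rewrite -coordring_piD; congr (\pi_coordring _); rewrite /pbracket !mderivD; ring.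
Qed.

Lemma bracketZl a u v : bracket (a *: u) v = a *: bracket u v.
Proof.
elim/quotW: u => f; elim/quotW: v => g.
rewrite [a *: _](coordring_piZ a f) (pbracket_pi (a *: f) g) (pbracket_pi f g).
rewrite [RHS](coordring_piZ a (pbracket f g)); congr (\pi_coordring _).
by rewrite /pbracket !mderivZ -!mul_mpolyC; ring.
Qed.

(* A[m]; this is a grading of A only if Q is quasihomogeneous. *)
Definition coordring_homog (w : 'I_3 -> nat) (m : nat) : pred coordring :=
  fun u => `[< exists f, quasihomogeneous w m f /\ u = \pi_coordring f >].

End CoordinateRing.

Definition singular_at (K : fieldType) (Q : {mpoly K[3]}) (v : 'I_3 -> K) :=
  Q.@[v] = 0 /\ forall i, Q^`M(i).@[v] = 0.

(* 0 is a singular point of the surface Q = 0, and it has a Zariski open     *)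
(* neighbourhood h <> 0 without any other (geometric) singular point.        *)
Definition isolated_singularity (F : fieldType) (Q : {mpoly F[3]}) :=
  singular_at Q (fun=> 0) /\
  exists2 h : {mpoly F[3]}, h.@[fun=> 0] != 0 &
    forall (K : fieldType) (iota : {rmorphism F -> K}) (v : 'I_3 -> K),
      singular_at (map_mpoly iota Q) v -> (map_mpoly iota h).@[v] != 0 ->
      forall i, v i = 0.

Section Subring.
Variables (F : fieldType) (R : subringClosed F).

Definition subring : Type := {x : F | x \in R}.
HB.instance Definition _ := SubChoice.on subring.
HB.instance Definition _ := [SubChoice_isSubComNzRing of subring by <:].

Definition fg_subring := exists s : seq F, {subset s <= R} /\
  forall S : subringClosed F, {subset s <= S} -> {subset R <= S}.

(* I is in Spec(R)_p *)
Definition in_Spec (p : nat) (I : prime_idealr subring) :=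
  [/\ exists e : seq {ideal_quot I}, forall x, x \in e,
      forall x : {ideal_quot I}, x != 0 -> exists y, y * x = 1
    & p \in [pchar {ideal_quot I}]].

End Subring.

Definition generates_field (F : fieldExtType rat) (R : subringClosed F) :=
  forall K : {subfield F}, {subset R <= K} -> forall x : F, x \in K.

Section PoissonSubalgebra.
Variables (F : fieldType) (Q : {mpoly F[3]}) (R : subringClosed F).
Local Notation A := (coordring Q).

Record poissonSubalg := PoissonSubalg {
  psa_pred :> pred A;
  psa_subring_closed : GRing.subring_closed psa_pred;
  psa_scale_closed :
    forall a u, a \in R -> u \in psa_pred -> a *: u \in psa_pred;
  psa_bracket_closed :
    forall u v, u \in psa_pred -> v \in psa_pred -> bracket u v \in psa_pred }.

Variable AR : poissonSubalg.

HB.instance Definition _ := GRing.isZmodClosed.Build A (psa_pred AR)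
  (GRing.subring_closedB (psa_subring_closed AR)).

Definition psa : Type := {u : A | u \in psa_pred AR}.
HB.instance Definition _ := SubChoice.on psa.
HB.instance Definition _ := [SubChoice_isSubZmodule of psa by <:].

Definition psa_scale (a : subring R) (u : psa) : psa :=
  Sub (val a *: val u) (psa_scale_closed (valP a) (valP u)).

Fact psa_scaleA a b u : psa_scale a (psa_scale b u) = psa_scale (a * b) u.
Proof. by apply/val_inj; rewrite /= scalerA. Qed.
Fact psa_scale1 : left_id 1 psa_scale.
Proof. by move=> u; apply/val_inj; rewrite /= scale1r. Qed.
Fact psa_scaleDr : right_distributive psa_scale +%R.
Proof. by move=> a u v; apply/val_inj; rewrite /= scalerDr. Qed.
Fact psa_scaleDl u : {morph psa_scale^~ u : a b / a + b}.
Proof. by move=> a b; apply/val_inj; rewrite /= scalerDl. Qed.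
HB.instance Definition _ := GRing.Zmodule_isLmodule.Build (subring R) psa
  psa_scaleA psa_scale1 psa_scaleDr psa_scaleDl.

Definition psa_bracket (u v : psa) : psa :=
  Sub (bracket (val u) (val v)) (psa_bracket_closed (valP u) (valP v)).

Definition fg_subalg := exists s : seq A, {subset s <= psa_pred AR} /\
  forall S : pred A, GRing.subring_closed S ->
    (forall a u, a \in R -> u \in S -> a *: u \in S) ->
    {subset s <= S} -> {subset psa_pred AR <= S}.

(* AR is the sum of its intersections with the A[m]. *)
Definition graded_subalg (w : 'I_3 -> nat) := forall u, u \in psa_pred AR ->
  exists n (v : 'I_n -> A), u = \sum_i v i /\
    forall i, v i \in psa_pred AR /\ v i \in coordring_homog w i.

Definition spanning_subalg :=
  forall u : A, u \in lspan (fun v => v \in psa_pred AR).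

(* Only the linear structure, the bracket and the grading of                 *)
(* A_p = A_R / p A_R are needed, not its product. As A_R[0] may be larger    *)
(* than R, A_p may be zero, so that p A_R need not be a proper ideal.        *)

Variable I : idealr (subring R).

Definition redalg : Type := reduction I psa.
HB.instance Definition _ := GRing.Lmodule.on redalg.
HB.instance Definition _ := Quotient.on redalg.

Definition redalg_bracket (u v : redalg) : redalg :=
  \pi_redalg (psa_bracket (repr u) (repr v)).

Lemma redalg_bracket_pi (u v : psa) :
  redalg_bracket (\pi u) (\pi v) = \pi_redalg (psa_bracket u v).
Proof.
have Dl u1 u2 t : psa_bracket (u1 + u2) t = psa_bracket u1 t + psa_bracket u2 t.
  by apply/val_inj; rewrite /= bracketDl.
have Zl a u1 t : psa_bracket (a *: u1) t = a *: psa_bracket u1 t.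
  by apply/val_inj; rewrite /= bracketZl.
have Bl u1 u2 t : psa_bracket (u1 - u2) t = psa_bracket u1 t - psa_bracket u2 t.
  by rewrite Dl -scaleN1r Zl scaleN1r.
have Cl u1 u2 : psa_bracket u1 u2 = - psa_bracket u2 u1.
  by apply/val_inj; rewrite /= bracketN.
have Il (u1 t : psa) : u1 \in @ideal_mod _ I psa -> psa_bracket u1 t \in @ideal_mod _ I psa.
  move=> /asboolP[s [sI ->]]; apply/asboolP.
  exists [seq (x.1, psa_bracket x.2 t) | x <- s]; split=> [x|].
    by move=> /mapP[y /sI yI ->].
  rewrite big_map (big_morph (psa_bracket^~ t) (id1 := 0) (op1 := +%R)) //.
    by apply: eq_bigr => x _; rewrite Zl.
  by rewrite -[0 in LHS](scale0r (0 : psa)) Zl scale0r.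
apply/reduction_eq; set u' := repr _; set v' := repr _.
have -> : psa_bracket u' v' - psa_bracket u v
        = psa_bracket (u' - u) v' - psa_bracket (v' - v) u.
  by rewrite !Bl (Cl v' u) (Cl v u) opprK opprD opprK addrA subrK.
by rewrite rpredB // Il //; apply/reduction_eq; exact: reprK.
Qed.

Definition redalg_homog (w : 'I_3 -> nat) (m : nat) (u : redalg) :=
  exists v : psa, val v \in coordring_homog w m /\ u = \pi_redalg v.

(* A_p / {A_p, A_p} *)
Definition HP0 : Type :=
  modquot (fun u : redalg => exists v1 v2, u = redalg_bracket v1 v2).
HB.instance Definition _ := GRing.Lmodule.on HP0.
HB.instance Definition _ := Quotient.on HP0.

Definition HP0_homog (w : 'I_3 -> nat) (m : nat) (u : HP0) :=
  exists v : redalg, redalg_homog w m v /\ u = \pi_HP0 v.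

End PoissonSubalgebra.

Definition ratfun := {fraction {poly rat}}.
Local Notation "x %:F" := (FracField.tofrac x).

Definition rf_const (c : rat) : ratfun := (c%:P)%:F.
Definition rf_var : ratfun := ('X : {poly rat})%:F.

(* substitution phi(psi), for non-constant psi *)
Definition rf_comp (phi psi : ratfun) : ratfun :=
  (map_poly rf_const \n_(repr phi)).[psi] /
  (map_poly rf_const \d_(repr phi)).[psi].

(* the first n coefficients of the power series N / D, where D`_0 != 0 *)
Fixpoint series_div_seq (N D : {poly rat}) (n : nat) : seq rat :=
  if n is m.+1 then
    let s := series_div_seq N D m in
    rcons s ((N`_m - \sum_(i < m) s`_i * D`_(m - i)%N) / D`_0)
  else [::].

Definition series_div (N D : {poly rat}) (n : nat) : rat :=
  (series_div_seq N D n.+1)`_n.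

(* order of vanishing at 0 of the denominator; the order of the pole of phi *)
(* at 0 is at most this (the representative need not be reduced)            *)
Definition den_ord (phi : ratfun) : nat := find (predC1 0) \d_(repr phi).

(* coefficient of z^n in the Laurent expansion at 0: if phi = N / (z^v D)   *)
(* with D`_0 != 0, it is the coefficient of z^(n + v) in N / D              *)
Definition laurent (phi : ratfun) (n : int) : rat :=
  if n + (den_ord phi)%:Z is Posz m then
    series_div \n_(repr phi) (drop_poly (den_ord phi) \d_(repr phi)) m
  else 0.

(* phi_-, the sum of the terms of negative degree *)
Definition principal_part (phi : ratfun) : ratfun :=
  \sum_(k < den_ord phi)
    rf_const (laurent phi (- (k.+1)%:Z)) * rf_var ^- k.+1.

(* The Hilbert series of V = (+)_m V[m] is the expansion of phi at 0. *)
Definition hilbert_series_is (k : nzRingType) (V : lmodType k)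
    (Vgr : nat -> V -> Prop) (phi : ratfun) :=
  exists h : nat -> nat, (forall m, has_dim (Vgr m) (h m)) /\
    forall n : int, laurent phi n = if n is Posz m then (h m)%:R else 0.

Lemma size_series_div_seq (N D : {poly rat}) n : size (series_div_seq N D n) = n.
Proof. by elim: n => //= n IHn; rewrite size_rcons IHn. Qed.

Lemma nth_series_div_seq (N D : {poly rat}) n i : (i < n)%N ->
  (series_div_seq N D n)`_i = series_div N D i.
Proof.
elim: n => // n IHn; rewrite ltnS leq_eqVlt => /orP[/eqP->//|lt_in].
by rewrite /= nth_rcons size_series_div_seq lt_in IHn.
Qed.

Lemma series_divP (N D : {poly rat}) n : D`_0 != 0 ->
  \sum_(i < n.+1) series_div N D i * D`_(n - i)%N = N`_n.
Proof.
move=> D0; rewrite big_ord_recr /= subnn {2}/series_div /= nth_rcons.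
rewrite size_series_div_seq ltnn eqxx divfK //.
under [in X in _ + (_ - X)]eq_bigr => i _ do rewrite nth_series_div_seq //.
by rewrite addrC subrK.
Qed.

Lemma den_ord_neq0 (phi : ratfun) : (\d_(repr phi) : {poly rat})`_(den_ord phi) != 0.
Proof.
apply/(@nth_find _ 0 (predC1 0)); have := denom_ratioP (repr phi).
apply: contraNT => /hasPn D0; apply/eqP/polyP => i; rewrite coef0.
have [lt_i|/(nth_default 0)->//] := ltnP i (size \d_(repr phi)).
by apply/eqP; have := D0 _ (mem_nth 0 lt_i); rewrite /= negbK.
Qed.

Lemma den_ord_lt (phi : ratfun) i :
  (i < den_ord phi)%N -> (\d_(repr phi) : {poly rat})`_i = 0.
Proof. by move=> /(before_find 0)/negbFE/eqP. Qed.

(* If phi = N / D and L is the expansion of phi, then D L = N. *)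
Lemma laurentP (phi : ratfun) (n : int) :
  \sum_(i < size \d_(repr phi)) (\d_(repr phi))`_i * laurent phi (n - i%:Z)
  = if n is Posz m then (\n_(repr phi))`_m else 0.
Proof.
set D := \d__; set N := \n__; set v := den_ord phi.
have L0 (i : nat) : n + v%:Z < i%:Z -> laurent phi (n - i%:Z) = 0.
  rewrite /laurent -/v => lt_i; case E: (n - i%:Z + v%:Z) => [m|//].
  by move: lt_i; rewrite -subr_lt0 -addrA [v%:Z - _]addrC addrA E.
case: n L0 => [m|m] L0; last first.
  rewrite big1 // => i _; have [lt_i|le_i] := ltnP i v.
    by rewrite den_ord_lt // mul0r.
  rewrite L0 ?mulr0 // NegzE; apply: (@lt_le_trans _ _ v%:Z); last by rewrite lez_nat.
  by rewrite -subr_gt0 opprD addrA addrAC opprK subrr add0r.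
pose G (i : nat) := D`_i * laurent phi (m%:Z - i%:Z).
have widen (a K : nat) : (a <= K)%N -> (forall i, (a <= i)%N -> G i = 0) ->
    \sum_(i < K) G i = \sum_(i < a) G i.
  move=> le_aK G0; rewrite -(subnKC le_aK) big_split_ord /= [X in _ + X]big1 ?addr0 //.
  by move=> i _; rewrite G0 // leq_addr.
pose K := (size D + (v + m.+1))%N.
rewrite -[LHS](widen (size D) K) ?leq_addr //; last first.
  by move=> i le_i; rewrite /G nth_default ?mul0r.
rewrite (widen (v + m.+1)%N K) ?leq_addl //; last first.
  by move=> i le_i; rewrite /G L0 ?mulr0 // -PoszD ltz_nat addnC -addnS.
rewrite big_split_ord /= big1 ?add0r; last first.
  by move=> i _; rewrite /G den_ord_lt ?mul0r.
rewrite -(@series_divP N (drop_poly v D)); last first.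
  by rewrite coef_drop_poly add0n den_ord_neq0.
rewrite (reindex_inj rev_ord_inj) /=; apply: eq_bigr => i _.
have le_im : (i <= m)%N by rewrite -ltnS.
rewrite /G subSS mulrC coef_drop_poly [(v + _)%N]addnC; congr (_ * _).
rewrite /laurent -/v -/N -/D.
by rewrite (_ : m%:Z - _ + _ = i%:Z) // PoszD -subzn //; ring.
Qed.

(* Main.v *)
(** By the Nullstellensatz, the isolated singularity hypothesis and
quasihomogeneity put a power of every variable into the ideal generated by the
partial derivatives of [Q], and this persists modulo almost all primes. After
lifting and reducing representatives, [A_p/{A_p,A_p}] becomes the quotient of
[K[x,y,z]] by [(Q)] and all [grad Q . curl eta], with [K] the residue field.

Put [l = n + a + b + c - d]. The degree [n] part of the subspace divided out is
the image under [grad Q . _] of the 2-forms [W] of weight [l] of the form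
[h E + curl eta + grad Q x phi], where [E] is the Euler field, and the kernel is
known from the exactness of the Koszul complex of [grad Q]. If [p] does not
divide [l], Cartan's formula shows that [W] consists of all 2-forms, which gives
the Milnor (Jacobian ring) term. If [l = p j > 0], crossing with [E] turns [W]
into the sum of the gradients and the forms [d Q phi - (phi . E) grad Q], and one
needs the [f] of weight [l] whose gradient lies in [(Q, grad Q)]: these are the
sums of a [p]-th power and a multiple of [Q]. The resulting dimension is expressed
through the number of monomials of weight [l], and it is compared with the value at
[j] through the periodicity of a quasi-polynomial whose Fourier transform is, up to a
power of [zeta], invariant under [zeta -> zeta^p]. *)
Require Import Defs.
From HB Require Import structures.
From mathcomp Require Import all_boot all_order all_algebra all_field.
From mathcomp Require Import generic_quotient ring_quotient fraction.
From mathcomp Require Import mpoly boolp.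
From mathcomp Require classical_sets.
From mathcomp Require Import ring zify.

Set Implicit Arguments.
Unset Strict Implicit.
Unset Printing Implicit Defensive.

Import Order.TTheory GRing.Theory Num.Theory.
Local Open Scope ring_scope.

(** * Koszul exactness and weighted homogeneous polynomials *)

(** All dimensions are alternating sums of numbers of monomials, because the Koszul complex of the
    gradient of [Q] is exact below its top degree. The obstacle is that in characteristic [p] the
    [p]-th powers have zero gradient; those of weight [p j] correspond to the polynomials of weight
    [j], so monomial counts at [p j] and at [j] enter the same formula and have to be related.

    A single count [P] has no such relation. The terms at [l = p j] combine into a sequence with
    generating function [N / (1 - X ^ M)], periodic from some point on. That [N] is a polynomial,
    and that its value at a root of unity [z] is [z ^ d] times a number depending only on the order
    of [z], both follow from divisibilities between [a], [b], [c], [d] and the order; these are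
    forced by the fact that the Milnor series is a polynomial.

    Periodicity holds down to small arguments only after adding the reflected count [P (- n - sg)],
    which comes from expanding at infinity. These reflected terms are the source of [g_-(z^{-1})] in
    [f]. For large [p], every weight [l = p j > 0] lies beyond the Jacobian ring, so the two
    summands of the answer never overlap. *)

Section Koszul.
Variable P : comNzRingType.
Variables q1 q2 q3 r1 r2 r3 : P.
Variables c11 c12 c13 c21 c22 c23 c31 c32 c33 : P.
Hypothesis r1E : r1 = c11 * q1 + c12 * q2 + c13 * q3.
Hypothesis r2E : r2 = c21 * q1 + c22 * q2 + c23 * q3.
Hypothesis r3E : r3 = c31 * q1 + c32 * q2 + c33 * q3.
Hypothesis reg1 : forall f, r1 * f = 0 -> f = 0.
Hypothesis reg2 : forall f g, r2 * f = r1 * g -> exists h, f = r1 * h.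
Hypothesis reg3 : forall f g h, r3 * f = r1 * g + r2 * h ->
  exists g' h', f = r1 * g' + r2 * h'.

(** Multiplication by [r_i] on the Koszul complex of [q] is null-homotopic, the homotopy being
    contraction with row [i] of the coefficients [c]; each [r_i] therefore gains one degree of
    exactness. [A0] is the vanishing of H^0 modulo [(r1, r2)], [B0] and [B1] are those of H^0 and
    H^1 modulo [r1]. *)
Let A0 f g1 g2 g3 h1 h2 h3 : q1 * f = r1 * g1 + r2 * h1 ->
  q2 * f = r1 * g2 + r2 * h2 -> q3 * f = r1 * g3 + r2 * h3 ->
  exists g h, f = r1 * g + r2 * h.
Proof.
move=> e1 e2 e3.
apply: (@reg3 _ (c31 * g1 + c32 * g2 + c33 * g3) (c31 * h1 + c32 * h2 + c33 * h3)).
by rewrite r3E !mulrDl -!mulrA e1 e2 e3; ring.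
Qed.

Let B0 f g1 g2 g3 : q1 * f = r1 * g1 -> q2 * f = r1 * g2 -> q3 * f = r1 * g3 ->
  exists g, f = r1 * g.
Proof.
move=> e1 e2 e3; apply: (@reg2 _ (c21 * g1 + c22 * g2 + c23 * g3)).
by rewrite r2E !mulrDl -!mulrA e1 e2 e3; ring.
Qed.

Let B1 f1 f2 f3 g1 g2 g3 : q2 * f3 - q3 * f2 = r1 * g1 ->
  q3 * f1 - q1 * f3 = r1 * g2 -> q1 * f2 - q2 * f1 = r1 * g3 ->
  exists u h1 h2 h3,
   [/\ f1 = u * q1 + r1 * h1, f2 = u * q2 + r1 * h2 & f3 = u * q3 + r1 * h3].
Proof.
move=> e1 e2 e3.
pose w := c21 * f1 + c22 * f2 + c23 * f3.
have E1 : r2 * f1 = w * q1 + r1 * (c23 * g2 - c22 * g3).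
  by rewrite mulrBr !(mulrCA r1) -e2 -e3 r2E /w; ring.
have E2 : r2 * f2 = w * q2 + r1 * (c21 * g3 - c23 * g1).
  by rewrite mulrBr !(mulrCA r1) -e1 -e3 r2E /w; ring.
have E3 : r2 * f3 = w * q3 + r1 * (c22 * g1 - c21 * g2).
  by rewrite mulrBr !(mulrCA r1) -e1 -e2 r2E /w; ring.
have [|||g [u wE]] := @A0 w (- (c23 * g2 - c22 * g3)) (- (c21 * g3 - c23 * g1))
  (- (c22 * g1 - c21 * g2)) f1 f2 f3; first by rewrite E1; ring.
- by rewrite E2; ring.
- by rewrite E3; ring.
have [|h1 H1] := @reg2 (f1 - u * q1) (g * q1 + (c23 * g2 - c22 * g3)).
  by rewrite mulrBr E1 wE; ring.
have [|h2 H2] := @reg2 (f2 - u * q2) (g * q2 + (c21 * g3 - c23 * g1)).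
  by rewrite mulrBr E2 wE; ring.
have [|h3 H3] := @reg2 (f3 - u * q3) (g * q3 + (c22 * g1 - c21 * g2)).
  by rewrite mulrBr E3 wE; ring.
by exists u, h1, h2, h3; rewrite -H1 -H2 -H3; split; ring.
Qed.

Lemma koszul_exact1 f1 f2 f3 : q2 * f3 = q3 * f2 -> q3 * f1 = q1 * f3 ->
  q1 * f2 = q2 * f1 -> exists u, [/\ f1 = u * q1, f2 = u * q2 & f3 = u * q3].
Proof.
move=> e1 e2 e3.
pose w := c11 * f1 + c12 * f2 + c13 * f3.
have E1 : r1 * f1 = w * q1.
  transitivity (w * q1 + c13 * (q3 * f1 - q1 * f3) - c12 * (q1 * f2 - q2 * f1)).
    by rewrite r1E /w; ring.
  by rewrite e2 e3; ring.
have E2 : r1 * f2 = w * q2.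
  transitivity (w * q2 + c11 * (q1 * f2 - q2 * f1) - c13 * (q2 * f3 - q3 * f2)).
    by rewrite r1E /w; ring.
  by rewrite e1 e3; ring.
have E3 : r1 * f3 = w * q3.
  transitivity (w * q3 + c12 * (q2 * f3 - q3 * f2) - c11 * (q3 * f1 - q1 * f3)).
    by rewrite r1E /w; ring.
  by rewrite e1 e2; ring.
have [|||u wE] := @B0 w f1 f2 f3; rewrite ?E1 ?E2 ?E3 1?mulrC //.
by exists u; split; apply/subr0_eq/reg1; rewrite mulrBr ?E1 ?E2 ?E3 wE; ring.
Qed.

Lemma koszul_exact2 f1 f2 f3 : q1 * f1 + q2 * f2 + q3 * f3 = 0 ->
  exists v1 v2 v3, [/\ f1 = q2 * v3 - q3 * v2, f2 = q3 * v1 - q1 * v3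
    & f3 = q1 * v2 - q2 * v1].
Proof.
move=> e.
(* [w] is [f] crossed with the first row [c1]. As [q . f = 0] and [c1 . q = r1], the triple product
   formula gives [q x w = r1 f], so [B1] applies to [w]. *)
pose w1 := f2 * c13 - f3 * c12; pose w2 := f3 * c11 - f1 * c13.
pose w3 := f1 * c12 - f2 * c11.
have E1 : q2 * w3 - q3 * w2 = r1 * f1.
  transitivity (r1 * f1 - c11 * (q1 * f1 + q2 * f2 + q3 * f3)); last by rewrite e; ring.
  by rewrite r1E /w1 /w2 /w3; ring.
have E2 : q3 * w1 - q1 * w3 = r1 * f2.
  transitivity (r1 * f2 - c12 * (q1 * f1 + q2 * f2 + q3 * f3)); last by rewrite e; ring.
  by rewrite r1E /w1 /w2 /w3; ring.
have E3 : q1 * w2 - q2 * w1 = r1 * f3.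
  transitivity (r1 * f3 - c13 * (q1 * f1 + q2 * f2 + q3 * f3)); last by rewrite e; ring.
  by rewrite r1E /w1 /w2 /w3; ring.
have [u [v1 [v2 [v3 [H1 H2 H3]]]]] := @B1 w1 w2 w3 _ _ _ E1 E2 E3.
exists v1, v2, v3; split; apply/subr0_eq/reg1; rewrite mulrBr -?E1 -?E2 -?E3 ?H1 ?H2 ?H3; ring.
Qed.

End Koszul.

(** * Powers of the variables as a regular sequence *)

Section MonomialRegular.
Variables (K : idomainType) (n : nat).
Implicit Types f g h : {mpoly K[n]}.

Lemma mcoeffMXn f i N (k : 'X_{1..n}) : ((f * 'X_i ^+ N)@_k != 0) -> (N <= k i)%N.
Proof.
rewrite mpolyXn -mcoeff_msupp (perm_mem (msuppMX _ _)) => /mapP[m _ ->].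
by rewrite mnmDE mulmnE mnm1E eqxx mul1n leq_addr.
Qed.

Lemma mcoeffMXn_shift f i N (k : 'X_{1..n}) :
  (f * 'X_i ^+ N)@_(k + U_(i) *+ N) = f@_k.
Proof. by rewrite mpolyXn addmC mcoeffMX. Qed.

Lemma dvd_Xn f i N : (forall k, f@_k != 0 -> (N <= k i)%N) ->
  exists g, f = 'X_i ^+ N * g.
Proof.
move=> Hf; exists (\sum_(k <- msupp f) f@_k *: 'X_[k - U_(i) *+ N]).
rewrite {1}[f]mpolyE mulr_sumr; apply: eq_big_seq => k; rewrite mcoeff_msupp => /Hf ki.
rewrite mpolyXn -scalerAr -mpolyXD addmC submK //.
by apply/mnm_lepP => j; rewrite mulmnE mnm1E; case: eqP => [<-|_]; rewrite ?mul1n ?mul0n.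
Qed.

Lemma dvd_Xn2 f i j N : (forall k, f@_k != 0 -> (N <= k i)%N || (N <= k j)%N) ->
  exists g h, f = 'X_i ^+ N * g + 'X_j ^+ N * h.
Proof.
move=> Hf.
pose f1 : {mpoly K[n]} := \sum_(k <- msupp f | (N <= k i)%N) f@_k *: 'X_[k].
have f1E k : f1@_k = if (N <= k i)%N then f@_k else 0.
  rewrite /f1 raddf_sum /= big_mkcond /=; have [kf|kf] := boolP (k \in msupp f); last first.
    rewrite (memN_msupp_eq0 kf) if_same big_seq big1 // => m mf; case: ifP => // _.
    by rewrite mcoeffZ mcoeffX; case: eqP => [E|]; rewrite ?mulr0 //; rewrite -E mf in kf.
  rewrite (bigD1_seq k) //= mcoeffZ mcoeffX eqxx mulr1 big1 ?addr0 // => m /negPf mk.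
  by case: ifP => // _; rewrite mcoeffZ mcoeffX mk mulr0.
have [g gE] : exists g, f1 = 'X_i ^+ N * g.
  by apply: dvd_Xn => k; rewrite f1E; case: ifP => //; rewrite eqxx.
have [h hE] : exists h, f - f1 = 'X_j ^+ N * h.
  apply: dvd_Xn => k; rewrite mcoeffB f1E; case: ifP => [|ki]; first by rewrite subrr eqxx.
  by rewrite subr0 => /Hf; rewrite ki.
by exists g, h; rewrite -gE -hE addrC subrK.
Qed.

Lemma Xn_regular1 i N f : 'X_i ^+ N * f = 0 -> f = 0.
Proof.
move=> /eqP; rewrite mulf_eq0 mpolyXn => /orP[/eqP/(congr1 (mcoeff (U_(i) *+ N)))|/eqP//].
by rewrite mcoeffX eqxx mcoeff0 => /eqP; rewrite oner_eq0.
Qed.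

Lemma Xn_regular2 i j N f g : i != j -> 'X_j ^+ N * f = 'X_i ^+ N * g ->
  exists h, f = 'X_i ^+ N * h.
Proof.
move=> ij E; apply: dvd_Xn => k; rewrite -(mcoeffMXn_shift f j N) mulrC E mulrC.
by move=> /mcoeffMXn; rewrite mnmDE mulmnE mnm1E eq_sym (negPf ij) mul0n addn0.
Qed.

Lemma Xn_regular3 i j l N f g h : i != l -> j != l ->
  'X_l ^+ N * f = 'X_i ^+ N * g + 'X_j ^+ N * h ->
  exists g' h', f = 'X_i ^+ N * g' + 'X_j ^+ N * h'.
Proof.
move=> il jl E; apply: dvd_Xn2 => k; rewrite -(mcoeffMXn_shift f l N) mulrC E mcoeffD.
have [|] := boolP (('X_i ^+ N * g)@_(k + U_(l) *+ N) == 0).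
  move=> /eqP->; rewrite add0r mulrC => /mcoeffMXn.
  by rewrite mnmDE mulmnE mnm1E eq_sym (negPf jl) mul0n addn0 => ->; rewrite orbT.
rewrite mulrC => /mcoeffMXn.
by rewrite mnmDE mulmnE mnm1E eq_sym (negPf il) mul0n addn0 => ->.
Qed.

Lemma dvd_Xn3 f (i j l : 'I_n) N :
  (forall k, f@_k != 0 -> [|| (N <= k i)%N, (N <= k j)%N | (N <= k l)%N]) ->
  exists g1 g2 g3, f = 'X_i ^+ N * g1 + 'X_j ^+ N * g2 + 'X_l ^+ N * g3.
Proof.
move=> Hf; pose T : pred 'X_{1..n} := fun k => (N <= k l)%N.
pose f1 : {mpoly K[n]} := \sum_(k <- msupp f | T k) f@_k *: 'X_[k].
have f1E k : f1@_k = if T k then f@_k else 0.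
  rewrite /f1 raddf_sum /= big_mkcond /=; have [kf|kf] := boolP (k \in msupp f); last first.
    rewrite (memN_msupp_eq0 kf) if_same big_seq big1 // => m mf; case: ifP => // _.
    by rewrite mcoeffZ mcoeffX; case: eqP => [E|]; rewrite ?mulr0 //; rewrite -E mf in kf.
  rewrite (bigD1_seq k) //= mcoeffZ mcoeffX eqxx mulr1 big1 ?addr0 // => m /negPf mk.
  by case: ifP => // _; rewrite mcoeffZ mcoeffX mk mulr0.
have [g3 g3E] : exists g, f1 = 'X_l ^+ N * g.
  by apply: dvd_Xn => k; rewrite f1E; case: ifP => //; rewrite eqxx.
have [g1 [g2 gE]] : exists g h, f - f1 = 'X_i ^+ N * g + 'X_j ^+ N * h.
  apply: dvd_Xn2 => k; rewrite mcoeffB f1E; case: ifP => [|ki]; first by rewrite subrr eqxx.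
  by rewrite subr0 => /Hf; rewrite /T in ki; rewrite ki orbF.
by exists g1, g2, g3; rewrite -gE -g3E subrK.
Qed.

Lemma mcoeff_XderivM f i k : ('X_i * f^`M(i))@_k = f@_k *+ k i.
Proof.
rewrite mulrC; have [k0|k0] := eqVneq (k i) 0%N.
  rewrite k0 mulr0n; apply/eqP/negPn/negP => H.
  by have := @mcoeffMXn f^`M(i) i 1 k; rewrite expr1 k0 => /(_ H).
rewrite -{1}(@submK _ U_(i) k) ?lep1mP // addmC.
have := @mcoeffMXn_shift f^`M(i) i 1 (k - U_(i)); rewrite expr1 mulm1n addmC => ->.
by rewrite mcoeff_deriv submK ?lep1mP // mnmBE mnm1E eqxx subn1 prednK ?lt0n.
Qed.

End MonomialRegular.

Lemma mulrzr_mcoeff (R : nzRingType) n (f : {mpoly R[n]}) m k :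
  (f *~ m)@_k = f@_k *~ m.
Proof. exact: (raddfMz (mcoeff k)). Qed.

(** * Weighted homogeneous components *)

Section Homogeneous.
Variables (K : idomainType) (w : 'I_3 -> nat).
Local Notation P := {mpoly K[3]}.
Implicit Types (f g : P) (m d : int).

(** The weight is an integer, so that the shifts by [w i], [d] and [sgw w] need no side condition;
    in negative weight only zero is left. *)
Definition whom m f := forall k, f@_k != 0 -> (wdeg w k)%:Z = m.

(* the component of [f] of weight [m] *)
Definition hc m f : P :=
  \sum_(k <- msupp f | (wdeg w k)%:Z == m) f@_k *: 'X_[k].

Lemma mcoeff_hc m f k : (hc m f)@_k = if (wdeg w k)%:Z == m then f@_k else 0.
Proof.
rewrite /hc raddf_sum /= big_mkcond /=; have [kf|kf] := boolP (k \in msupp f); last first.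
  rewrite (memN_msupp_eq0 kf) if_same big_seq big1 // => k' mf; case: ifP => // _.
  by rewrite mcoeffZ mcoeffX; case: eqP => [E|]; rewrite ?mulr0 //; rewrite -E mf in kf.
rewrite (bigD1_seq k) //= mcoeffZ mcoeffX eqxx mulr1 big1 ?addr0 // => k' /negPf mk.
by case: ifP => // _; rewrite mcoeffZ mcoeffX mk mulr0.
Qed.

Lemma hc_hom m f : whom m (hc m f).
Proof. by move=> k; rewrite mcoeff_hc; case: ifP => [/eqP|_]; rewrite ?eqxx. Qed.

Lemma hc_id m f : whom m f -> hc m f = f.
Proof.
move=> fm; apply/mpolyP => k; rewrite mcoeff_hc; case: eqP => // ne.
by have [->//|/fm] := eqVneq f@_k 0.
Qed.

Lemma hc_is_linear m : linear (hc m).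
Proof.
move=> c f g; apply/mpolyP => k; rewrite !(mcoeff_hc, mcoeffD, mcoeffZ).
by case: ifP; rewrite ?mulr0 ?addr0.
Qed.
HB.instance Definition _ m :=
  GRing.isLinear.Build K P P _ (hc m) (hc_is_linear m).

Lemma wdegD k1 k2 : wdeg w (k1 + k2) = (wdeg w k1 + wdeg w k2)%N.
Proof.
by rewrite /wdeg -big_split /=; apply: eq_bigr => i _; rewrite mnmDE mulnDr.
Qed.

Lemma wdegU i : wdeg w U_(i) = w i.
Proof.
rewrite /wdeg (bigD1 i) //= big1 ?addn0 => [|j ji]; first by rewrite mnm1E eqxx muln1.
by rewrite mnm1E eq_sym (negPf ji) muln0.
Qed.

Lemma whom0 m : whom m 0. Proof. by move=> k; rewrite mcoeff0 eqxx. Qed.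

Lemma whomD m f g : whom m f -> whom m g -> whom m (f + g).
Proof.
move=> fm gm k; rewrite mcoeffD; have [->|/fm//] := eqVneq f@_k 0.
by rewrite add0r => /gm.
Qed.

Lemma whomZ m c f : whom m f -> whom m (c *: f).
Proof. by move=> fm k; rewrite mcoeffZ mulf_eq0 negb_or => /andP[_ /fm]. Qed.

Lemma whomN m f : whom m f -> whom m (- f).
Proof. by move=> fm k; rewrite mcoeffN oppr_eq0 => /fm. Qed.

Lemma whomB m f g : whom m f -> whom m g -> whom m (f - g).
Proof. by move=> fm gm; apply/whomD/whomN. Qed.

Lemma whomX k : whom (wdeg w k)%:Z 'X_[k].
Proof. by move=> l; rewrite mcoeffX; case: (k =P l) => [->|]; rewrite ?eqxx. Qed.

Let suppM (d m : int) f g : whom d f ->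
  (forall k, g@_k != 0 -> (wdeg w k)%:Z != m) ->
  forall k, (f * g)@_k != 0 -> (wdeg w k)%:Z != d + m.
Proof.
move=> fd gm k; rewrite -mcoeff_msupp => /msuppM_le/allpairsP[[k1 k2] /= []].
rewrite !mcoeff_msupp => /fd k1d /gm k2m ->; rewrite wdegD PoszD k1d.
by rewrite (inj_eq (addrI d)).
Qed.

Lemma whomM d m f g : whom d f -> whom m g -> whom (d + m) (f * g).
Proof.
move=> fd gm k; rewrite -mcoeff_msupp => /msuppM_le/allpairsP[[k1 k2] /= []].
by rewrite !mcoeff_msupp => /fd k1d /gm k2m ->; rewrite wdegD PoszD k1d k2m.
Qed.

Lemma hcM d m f g : whom d f -> hc (d + m) (f * g) = f * hc m g.
Proof.
move=> fd; rewrite -{1}[g](subrK (hc m g)) mulrDr raddfD /=.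
rewrite (hc_id (whomM fd (@hc_hom m g))).
suff -> : hc (d + m) (f * (g - hc m g)) = 0 by rewrite add0r.
apply/mpolyP => k; rewrite mcoeff_hc mcoeff0; case: eqP => // kE; apply/eqP.
have := @suppM d m f (g - hc m g) fd _ k; rewrite kE eqxx /= => H.
apply/negPn/negP => /H; case/(_ _)/negP => // k'; rewrite mcoeffB mcoeff_hc.
by case: ((wdeg w k')%:Z =P m) => //; rewrite subrr eqxx.
Qed.

Lemma hc_deriv m i f : hc (m - (w i)%:Z) f^`M(i) = (hc m f)^`M(i).
Proof.
apply/mpolyP => k; rewrite mcoeff_hc !mcoeff_deriv mcoeff_hc wdegD wdegU PoszD.
by rewrite -subr_eq opprK; case: eqP => // _; rewrite mul0rn.
Qed.

Lemma whom_deriv m i f : whom m f -> whom (m - (w i)%:Z) f^`M(i).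
Proof. by move=> fm; rewrite -(hc_id fm) -hc_deriv; apply: hc_hom. Qed.

Lemma whom_neg m f : m < 0 -> whom m f -> f = 0.
Proof.
move=> m0 fm; apply/mpolyP => k; rewrite mcoeff0; apply/eqP/negPn/negP => /fm km.
by rewrite -km in m0.
Qed.

Lemma hcX m k : hc m 'X_[k] = if (wdeg w k)%:Z == m then 'X_[k] else 0.
Proof.
apply/mpolyP => l; rewrite mcoeff_hc mcoeffX; case: (k =P l) => [->|].
  by case: ifP; rewrite ?mcoeffX ?eqxx ?mcoeff0.
by move=> /eqP/negPf kl; rewrite if_same; case: ifP; rewrite ?mcoeffX ?kl ?mcoeff0.
Qed.

Lemma euler m f : whom m f ->
  \sum_i (w i)%:R * ('X_i * f^`M(i)) = m%:~R * f.
Proof.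
move=> fm; apply/mpolyP => k; rewrite raddf_sum /=.
under eq_bigr => i _ do rewrite mulr_natl mcoeffMn mcoeff_XderivM -mulrnA mulnC.
rewrite mulrzl mulrzr_mcoeff; have [->|/fm <-] := eqVneq f@_k 0.
  by rewrite mul0rz big1 // => i _; rewrite mul0rn.
by rewrite -pmulrn /wdeg sumrMnr.
Qed.

End Homogeneous.

(** * Polynomials with gradient divisible by Q, in characteristic p *)

Lemma ord3P (S : 'I_3 -> Prop) : S ix -> S iy -> S iz -> forall i, S i.
Proof.
move=> sx sy sz [[|[|[|//]]] lt_i].
- by rewrite (_ : Ordinal _ = ix) //; apply/val_inj.
- by rewrite (_ : Ordinal _ = iy) //; apply/val_inj.
- by rewrite (_ : Ordinal _ = iz) //; apply/val_inj.
Qed.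

Lemma big_ord3 (T : nmodType) (F : 'I_3 -> T) : \sum_i F i = F ix + F iy + F iz.
Proof.
rewrite !big_ord_recl big_ord0 addr0 addrA.
by congr (F _ + F _ + F _); apply/val_inj.
Qed.

Section Kernel.
Variables (K : fieldType) (p : nat).
Hypothesis charK : p \in [pchar K].
Hypothesis perfK : forall c : K, exists e, e ^+ p == c.
Local Notation P := {mpoly K[3]}.
Implicit Types (f g h u : P) (i j : 'I_3).

Let p_pr : prime p. Proof. by case/andP: charK. Qed.
Let p_gt0 : (0 < p)%N. Proof. exact: prime_gt0. Qed.

Lemma natK_eq0 n : (n%:R == 0 :> K) = (p %| n)%N.
Proof. by rewrite (dvdn_pcharf charK). Qed.

Lemma pchar_mpoly : p \in [pchar P].
Proof.
rewrite inE p_pr /= -mpolyC_nat mpolyC_eq0 natK_eq0; exact: dvdnn.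
Qed.

Lemma mpoly_exp_inj f g : f ^+ p = g ^+ p -> f = g.
Proof.
move=> E; apply/subr0_eq/eqP; rewrite -[_ == 0]andTb -p_gt0 -expf_eq0.
have := rmorphB (pFrobenius_aut pchar_mpoly) f g; rewrite /= !pFrobenius_autE => ->.
by rewrite E subrr.
Qed.

Lemma pth_powerP g : (forall k, g@_k != 0 -> forall i, (p %| k i)%N) ->
  exists w, g = w ^+ p.
Proof.
move=> Hg; pose root c := xchoose (perfK c).
have rootK c : root c ^+ p = c by apply/eqP/(xchooseP (perfK c)).
exists (\sum_(k <- msupp g) root g@_k *: 'X_[[multinom (k i %/ p)%N | i < 3]]).
have := rmorph_sum (pFrobenius_aut pchar_mpoly) (msupp g) xpredT
  (fun k => root g@_k *: 'X_[[multinom (k i %/ p)%N | i < 3]]).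
rewrite /= pFrobenius_autE => ->; rewrite {1}[g]mpolyE.
apply: eq_big_seq => k; rewrite mcoeff_msupp => /Hg kp.
rewrite pFrobenius_autE exprZn rootK mpolyXn; congr (_ *: 'X_[_]).
by apply/mnmP => i; rewrite mulmnE mnmE divnK.
Qed.

Lemma mderiv_pth_power i w f : (w ^+ p * f)^`M(i) = w ^+ p * f^`M(i).
Proof.
rewrite mderivM; suff -> : (w ^+ p)^`M(i) = 0 by rewrite mul0r add0r.
have E n : (w ^+ n)^`M(i) = n%:R * w ^+ n.-1 * w^`M(i).
  elim: n => [|n IHn]; first by rewrite expr0 mul0r mul0r -mpolyC1 mderivC.
  rewrite exprS mderivM IHn /=; case: n {IHn} => [|n]; first by rewrite /= !mul0r mulr0 addr0 !expr0 mul1r mulr1 mul1r.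
  by rewrite /= exprS -[n.+2%:R]natr1; ring.
by rewrite E (pcharf0 pchar_mpoly) !mul0r.
Qed.

Lemma mderiv_iter_p i f : iter p (mderiv i) f = 0.
Proof.
rewrite -mderivn_iter; apply/mpolyP => k; rewrite mcoeff0 mcoeff_mderivm.
rewrite (bigD1 i) //= mnmDE !mulmnE mnm1E eqxx mul1n -bin_ffact.
apply/eqP; rewrite -mulr_natr mulf_eq0 natK_eq0; apply/orP; right.
by rewrite dvdn_mulr // dvdn_mull // dvdn_fact // p_gt0 leqnn.
Qed.

Lemma fact_neq0 n : (n < p)%N -> (n`!%:R : K) != 0.
Proof.
elim: n => [_|n IHn ltnp]; first by rewrite oner_eq0.
by rewrite factS natrM mulf_neq0 ?IHn 1?ltnW // natK_eq0 gtnNdvd.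
Qed.

Lemma mderivXn i f n : (f ^+ n)^`M(i) = n%:R * f ^+ n.-1 * f^`M(i).
Proof.
elim: n => [|n IHn]; first by rewrite expr0 mul0r mul0r -mpolyC1 mderivC.
rewrite exprS mderivM IHn /=; case: n {IHn} => [|n]; first by rewrite /= !mul0r mulr0 addr0 !expr0 mul1r mulr1 mul1r.
by rewrite /= exprS -[n.+2%:R]natr1; ring.
Qed.

Variable Q : P.
Local Notation q := (fun i => Q^`M(i)).
Hypothesis exact1 : forall f : 'I_3 -> P, (forall i j, q i * f j = q j * f i) ->
  exists u, forall i, f i = u * q i.
Hypothesis exact2 : forall f : 'I_3 -> P, \sum_i q i * f i = 0 ->
  exists v : 'I_3 -> P, [/\ f ix = q iy * v iz - q iz * v iy,
    f iy = q iz * v ix - q ix * v iz & f iz = q ix * v iy - q iy * v ix].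
Hypothesis q_neq0 : exists i, q i != 0.

Let Q_neq0 : Q != 0.
Proof. by have [i] := q_neq0; apply: contraNneq => ->; rewrite mderiv0. Qed.

Let mulQI f g : Q * f = Q * g -> f = g.
Proof. by move/(mulfI Q_neq0). Qed.

(** From [h q = Q f] follows [Q (q x f) = 0], so [q x f = 0] and [f] is a multiple of [q]: the
    gradient has no annihilator modulo [Q]. *)
Lemma grad_regular h (f : 'I_3 -> P) : (forall i, h * q i = Q * f i) ->
  exists v, h = Q * v.
Proof.
move=> hE; have [i j|v fE] := exact1 (f := f).
  by apply: mulQI; rewrite [LHS]mulrCA -hE [RHS]mulrCA -hE; ring.
exists v; have [i qi] := q_neq0; apply: (mulIf qi).
by rewrite hE fE mulrA.
Qed.

(** Exactness passes to the quotient by [Q]: since [q . (q x f) = 0], also [q . z = 0], hence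
    [z = q x v], and [f - Q v] is proportional to [q]. *)
Lemma exact1_mod (f : 'I_3 -> P) (z : 'I_3 -> 'I_3 -> P) :
  (forall i j, q i * f j - q j * f i = Q * z i j) ->
  exists u (v : 'I_3 -> P), forall i, f i = u * q i + Q * v i.
Proof.
move=> fz; pose zz (i : 'I_3) := if i == ix then z iy iz else if i == iy then z iz ix
  else z ix iy.
have [|v [v1 v2 v3]] := exact2 (f := zz).
  apply: mulQI; rewrite mulr0 big_ord3 /zz /=.
  by rewrite !mulrDr ![Q * (_ * _)]mulrCA -!fz; ring.
rewrite /zz /= in v1 v2 v3.
have [|u uE] := exact1 (f := fun i => f i - Q * v i); last first.
  by exists u, v => i; rewrite -uE subrK.
pose S i j := q i * (f j - Q * v j) = q j * (f i - Q * v i).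
have SE i j : q i * f j - q j * f i = Q * (q i * v j - q j * v i) -> S i j.
  by move=> E; apply/subr0_eq; transitivity ((q i * f j - q j * f i) - Q * (q i * v j - q j * v i)); [ring | rewrite E subrr].
have SC i j : S i j -> S j i by move=> E; apply/esym.
have Sii i : S i i by [].
have Syz : S iy iz by apply: SE; rewrite fz v1.
have Szx : S iz ix by apply: SE; rewrite fz v2.
have Sxy : S ix iy by apply: SE; rewrite fz v3.
by apply: ord3P; apply: ord3P => //; apply: SC.
Qed.

(** Differentiating [w ^ p = Q ^ n g] gives [n g q_i = - Q g_i], where [g_i] is the derivative of
    [g]; so [Q] divides [g] as long as [0 < n < p]. The exponent climbs in this way to [p], where
    the cofactor has zero gradient and is itself a [p]-th power. *)
Lemma reduced_p w h : w ^+ p = Q * h -> exists v, w = Q * v.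
Proof.
move=> wE.
have Hn n : (0 < n <= p)%N -> exists h, w ^+ p = Q ^+ n * h.
  elim: n => [//|[|n] IHn]; first by move=> _; exists h; rewrite expr1.
  move=> /andP[_ le_np]; have [|g gE] := IHn; first by rewrite /= ltnW.
  have [v gv] : exists v, g = Q * v.
    have n0 : (n.+1%:R : K) != 0 by rewrite natK_eq0 gtnNdvd.
    have [i|v vE] := grad_regular (h := n.+1%:R *: g) (f := fun i => - g^`M(i)).
      have := mderiv_pth_power i w 1; rewrite mulr1 gE -mpolyC1 mderivC mulr0.
      rewrite mderivM mderivXn /= exprS => E.
      apply/subr0_eq/(mulfI (expf_neq0 n Q_neq0)); rewrite mulr0 -[RHS]E.
      by rewrite -mul_mpolyC mpolyC_nat; ring.
    by exists (n.+1%:R^-1 *: v); rewrite -scalerAr -vE scalerA mulVf ?scale1r.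
  by exists v; rewrite gE gv mulrA -exprSr.
have [|g gE] := Hn p; first by rewrite p_gt0 leqnn.
have [v vE] : exists v, g = v ^+ p.
  apply: pth_powerP => k gk i.
  have Dg : g^`M(i) = 0.
    have := mderiv_pth_power i w 1; rewrite mulr1 gE -mpolyC1 mderivC mulr0.
    by rewrite mderiv_pth_power => /eqP; rewrite mulf_eq0 (negPf (expf_neq0 _ Q_neq0)) => /eqP.
  have [->//|ki] := eqVneq (k i) 0%N.
  have := congr1 (mcoeff (k - U_(i))) Dg; rewrite mcoeff_deriv mcoeff0.
  rewrite submK ?lep1mP // mnmBE mnm1E eqxx subn1 prednK ?lt0n // => /eqP.
  by rewrite -mulr_natr mulf_eq0 (negPf gk) natK_eq0.
by exists v; apply: mpoly_exp_inj; rewrite exprMn -vE.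
Qed.

Lemma mderiv_iter_Qpow i n g : exists h,
  iter n (mderiv i) (Q ^+ n * g) = n`!%:R * q i ^+ n * g + Q * h.
Proof.
elim: n g => [|n IHn] g; first by exists 0; rewrite !expr0 mulr0 addr0 mulr1.
have [h hE] := IHn (n.+1%:R * q i * g + Q * g^`M(i)).
exists (h + n`!%:R * q i ^+ n * g^`M(i)); rewrite iterSr mderivM mderivXn /=.
rewrite exprS.
rewrite (_ : _ + _ = Q ^+ n * (n.+1%:R * q i * g + Q * g^`M(i))); last by ring.
by rewrite hE factS natrM exprS; ring.
Qed.

Let theta i f := 'X_i * f^`M(i).

Let mcoeff_theta i f k : (theta i f)@_k = f@_k * (k i)%:R.
Proof. by rewrite mcoeff_XderivM mulr_natr. Qed.

(** [T i] multiplies a monomial by [k_i ^ (p - 1)], which by Fermat is 0 or 1 according as [p]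
    divides [k_i] or not. Subtracting [T i] for the three variables in turn leaves only exponents
    divisible by [p]. What is subtracted is a multiple of [Q ^ p], because [theta i] commutes with
    multiplication by [p]-th powers. *)
Lemma kernel_last f (v : 'I_3 -> P) : (forall i, f^`M(i) = Q ^+ p * v i) ->
  exists w h, f = w ^+ p + Q * h.
Proof.
move=> fv; pose T i f := iter p.-1 (theta i) f.
have TE i g k : (T i g)@_k = g@_k * (k i)%:R ^+ p.-1.
  rewrite /T; elim: p.-1 => [|n IHn]; first by rewrite mulr1.
  by rewrite iterS mcoeff_theta IHn exprSr mulrA.
have step i g : (forall j, exists h, g^`M(j) = Q ^+ p * h) -> exists h, T i g = Q ^+ p * h.
  move=> /(_ i)[h hE]; have thQ h' : theta i (Q ^+ p * h') = Q ^+ p * theta i h'.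
    by rewrite /theta mderiv_pth_power mulrCA.
  have [n pn] : exists n, p.-1 = n.+1.
    by exists p.-2; rewrite prednK // -ltnS prednK // prime_gt1.
  rewrite /T pn iterSr; exists (iter n (theta i) ('X_i * h)).
  have -> : theta i g = Q ^+ p * ('X_i * h) by rewrite /theta hE mulrCA.
  by elim: n {pn} => //= n ->; exact: thQ.
have fred g : (forall j, exists h, g^`M(j) = Q ^+ p * h) ->
   forall i, (forall j, exists h, (g - T i g)^`M(j) = Q ^+ p * h) /\
     exists h, g = (g - T i g) + Q * h.
  move=> gE i; have [h hE] := step i g gE; split=> [j|].
    have [h1 h1E] := gE j; exists (h1 - h^`M(j)).
    by rewrite mderivB hE mderiv_pth_power h1E mulrBr.
  by exists (Q ^+ p.-1 * h); rewrite mulrA -exprS prednK // -hE subrK.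
have f0 j : exists h, f^`M(j) = Q ^+ p * h by exists (v j).
have [f1 [h0 h0E]] := fred f f0 ix; set g1 := f - T ix f in f1 h0E.
have [f2 [h1 h1E]] := fred g1 f1 iy; set g2 := g1 - T iy g1 in f2 h1E.
have [f3 [h2 h2E]] := fred g2 f2 iz; set g3 := g2 - T iz g2 in f3 h2E.
have Z i g k : (g - T i g)@_k != 0 -> g@_k != 0 /\ (p %| k i)%N.
  rewrite mcoeffB TE -[X in X - _]mulr1 -mulrBr mulf_eq0 negb_or => /andP[-> H]; split=> //.
  rewrite -natK_eq0; apply: contraNT H => k0; apply/eqP.
  apply: (mulIf k0); rewrite mulrBl mul1r -exprSr prednK //.
  by have := pFrobenius_aut_nat charK (k i); rewrite pFrobenius_autE => ->; rewrite subrr mul0r.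
have [w wE] : exists w, g3 = w ^+ p.
  apply: pth_powerP => k /Z[/Z[/Z[_ k1] k2] k3]; exact: ord3P.
by exists w, (h0 + h1 + h2); rewrite h0E h1E h2E wE; ring.
Qed.

(** Symmetry of second derivatives gives [q x v = 0] modulo [Q], so [v = u q + Q th]. If
    [n + 1 < p], the term [u Q ^ n q] is integrated: subtracting [u Q ^ (n + 1) / (n + 1)] removes
    it. *)
Lemma kernel_step f (v : 'I_3 -> P) n : (0 < n < p)%N ->
  (forall i, f^`M(i) = Q ^+ n * v i) ->
  exists h (v' : 'I_3 -> P), forall i, (f - Q * h)^`M(i) = Q ^+ n.+1 * v' i.
Proof.
case: n => [//|m] /andP[n_gt0 ltnp] fv; pose n := m.+1.
have n0 : (n%:R : K) != 0 by rewrite natK_eq0 gtnNdvd.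
have [i j|u [th vE]] := exact1_mod (f := v)
    (z := fun i j => n%:R^-1 *: ((v i)^`M(j) - (v j)^`M(i))).
  have E := mderiv_comm j i f; rewrite !fv !mderivM !mderivXn /= in E.
  apply/(mulfI (expf_neq0 m Q_neq0))/(scalerI n0).
  rewrite -!scalerAr scalerA divff // scale1r -mul_mpolyC mpolyC_nat.
  apply/subr0_eq; transitivity
    ((n%:R * Q ^+ m * Q^`M(i) * v j + Q ^+ n * (v j)^`M(i)) -
     (n%:R * Q ^+ m * Q^`M(j) * v i + Q ^+ n * (v i)^`M(j))).
    by rewrite /n exprS; ring.
  by rewrite -/n in E; rewrite E subrr.
rewrite -/n in fv *.
have [ltnp1|] := boolP (n.+1 < p)%N.
  have n10 : (n.+1%:R : K) != 0 by rewrite natK_eq0 gtnNdvd.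
  exists (n.+1%:R^-1 *: (u * Q ^+ n)), (fun i => th i - n.+1%:R^-1 *: u^`M(i)) => i.
  rewrite -scalerAr mulrCA -exprS mderivB mderivZ mderivM mderivXn /= fv vE.
  rewrite scalerDr [_ *: (u * _)](_ : _ = u * Q ^+ n * q i); last first.
    apply: (scalerI n10); rewrite scalerA divff // scale1r -mul_mpolyC mpolyC_nat.
    by ring.
  by rewrite mulrBr -scalerAr mulrC [_ * u^`M(i)]mulrC exprS; ring.
rewrite -leqNgt => lepn; have pE : p = n.+1 by apply/eqP; rewrite eqn_leq lepn.
(* Division by [n + 1 = p] is impossible. Instead, the [p]-th derivative of [f] in direction [i] is
   zero and equals [n! q_i ^ p u] modulo [Q]. Multiplied by [u ^ n], this puts [(u q_i) ^ p] into
   [(Q)], hence [u q_i], and then [u]. *)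
have [v' uE] : exists v', u = Q * v'.
  have H i : exists h, u * q i = Q * h.
    have [h hE] := mderiv_iter_Qpow i n (v i).
    have : iter p (mderiv i) f = 0 by apply: mderiv_iter_p.
    rewrite {1}pE iterSr fv hE vE => E.
    have nf : (n`!%:R : K) != 0 by rewrite fact_neq0.
    apply: (@reduced_p _ (- (n`!%:R^-1 *: (u ^+ n * (n`!%:R * q i ^+ n * th i + h))))).
    rewrite {1}pE exprMn !(exprSr _ n) mulrN -scalerAr; apply: (scalerI nf).
    rewrite scalerN scalerA divff // scale1r -mul_mpolyC mpolyC_nat.
    apply/subr0_eq; transitivity (u ^+ n * (n`!%:R * Q^`M(i) ^+ n * (u * Q^`M(i) + Q * th i) + Q * h)).
      by ring.
    by rewrite E mulr0.
  have [hx hxE] := H ix; have [hy hyE] := H iy; have [hz hzE] := H iz.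
  apply: (@grad_regular _ (fun i => if i == ix then hx else if i == iy then hy else hz)).
  exact: ord3P.
exists 0, (fun i => v' * q i + th i) => i.
by rewrite mulr0 subr0 fv vE uE (exprSr Q n); ring.
Qed.

(* Dividing by [Q] one power at a time, [f] is changed by multiples of [Q] until its
   gradient is divisible by [Q ^+ p], where it is corrected to a polynomial with zero
   gradient. *)
Lemma kernel_d f g (v : 'I_3 -> P) : (forall i, f^`M(i) = Q * v i + g * q i) ->
  exists w h, f = w ^+ p + Q * h.
Proof.
move=> fv.
have Hn n : (0 < n <= p)%N ->
    exists h (v' : 'I_3 -> P), forall i, (f - Q * h)^`M(i) = Q ^+ n * v' i.
  elim: n => [//|[|n] IHn].
    exists g, (fun i => v i - g^`M(i)) => i.
    by rewrite mderivB mderivM fv expr1; ring.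
  move=> /andP[_ lenp]; have [|h [v' hv']] := IHn; first by rewrite /= ltnW.
  have [|h' [v'' hv'']] := kernel_step _ hv'; first by [].
  by exists (h + h'), v'' => i; rewrite -hv'' mulrDr opprD addrA.
have [|h [v' /kernel_last[w [h' fE]]]] := Hn p; first by rewrite p_gt0 leqnn.
by exists w, (h' + h); rewrite mulrDr addrA -fE subrK.
Qed.

End Kernel.

(** * Dimensions of subspaces *)

Section PropSubspace.
Variables (K : fieldType) (n : nat) (T : 'rV[K]_n -> Prop).
Hypothesis T0 : T 0.
Hypothesis TD : forall c u v, T u -> T v -> T (c *: u + v).

Let Tmx m (A : 'M_(m, n)) r : (forall i, T (row i A)) -> (r <= A)%MS -> T r.
Proof.
move=> TA /submxP[u ->]; rewrite mulmx_sum_row.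
by elim/big_ind: _ => // [x y Tx Ty|i _]; [rewrite -[x]scale1r | rewrite -[_ *: _]addr0]; apply: TD.
Qed.

(** A matrix of maximal rank among those with rows in [T] spans [T]: a further row of [T] would
    increase its rank. *)
Lemma prop_subspaceP : exists A : 'M[K]_n, forall r, T r <-> (r <= A)%MS.
Proof.
pose good k := `[< exists A : 'M[K]_n, (forall i, T (row i A)) /\ \rank A = k >].
have ex : exists k, good k.
  by exists 0%N; apply/asboolP; exists 0; split=> [i|]; rewrite ?row0 ?mxrank0.
have ub k : good k -> (k <= n)%N by move=> /asboolP[A [_ <-]]; apply: rank_leq_row.
case: (ex_maxnP ex ub) => k /asboolP[A [TA rA]] kmax; exists A => r.
split=> [Tr|]; last exact: Tmx.
have H : good (\rank (A + r)%MS).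
  apply/asboolP; exists (A + r)%MS; split=> // i.
  have /sub_addsmxP[[u v] /= ->] := row_sub i (A + r)%MS.
  rewrite -[u *m A]scale1r; apply: TD; first by apply: (Tmx TA); apply: submxMl.
  by apply: (@Tmx _ r) => [j|]; rewrite ?submxMl // (ord1 j) row_id.
have := kmax _ H; rewrite -rA => le.
have s : (A + r <= A)%MS by rewrite -(geq_leqif (mxrank_leqif_sup (addsmxSl A r))).
by apply: submx_trans s; apply: addsmxSr.
Qed.

End PropSubspace.

Section FiniteDim.
Variable K : fieldType.

(** The ambient space of polynomials is infinite-dimensional, so a finite-dimensional subspace is
    given by a linear parametrization by row vectors; this reduces rank arguments to matrices. *)
Definition fdim (V : lmodType K) (S : V -> Prop) (n : nat) :=
  exists f : 'rV[K]_n -> V, [/\ linear f, injective f & forall v, S v <-> exists r, v = f r].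

Lemma fdim_ext (V : lmodType K) (S S' : V -> Prop) n :
  (forall v, S v <-> S' v) -> fdim S n -> fdim S' n.
Proof.
by move=> SS' [f [lf injf Sf]]; exists f; split=> // v; rewrite -SS'.
Qed.

Section LinearFun.
Variables (V W : lmodType K) (g : V -> W).
Hypothesis lin_g : linear g.

Lemma linfun0 : g 0 = 0.
Proof. by have := lin_g (-1) 0 0; rewrite scaler0 addr0 scaleN1r addNr. Qed.
Lemma linfunD : {morph g : u v / u + v}.
Proof. by move=> u v; have := lin_g 1 u v; rewrite !scale1r. Qed.
Lemma linfunZ c : {morph g : u / c *: u}.
Proof. by move=> u; have := lin_g c u 0; rewrite linfun0 !addr0. Qed.
Lemma linfunN : {morph g : u / - u}.
Proof. by move=> u; rewrite -scaleN1r linfunZ scaleN1r. Qed.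
Lemma linfunB : {morph g : u v / u - v}.
Proof. by move=> u v; rewrite linfunD linfunN. Qed.
Lemma linfun_sum I (r : seq I) (F : I -> V) : g (\sum_(i <- r) F i) = \sum_(i <- r) g (F i).
Proof. exact: (big_morph g linfunD linfun0). Qed.
End LinearFun.

Definition subspace (V : lmodType K) (S : V -> Prop) :=
  S 0 /\ forall c u v, S u -> S v -> S (c *: u + v).

Lemma fdim_subspace (V : lmodType K) (S : V -> Prop) n : fdim S n -> subspace S.
Proof.
move=> [f [lf injf Sf]]; split; first by apply/Sf; exists 0; rewrite linfun0.
by move=> c u v /Sf[r ->] /Sf[s ->]; apply/Sf; exists (c *: r + s); rewrite lf.
Qed.

Lemma injective_lin (V W : lmodType K) (g : V -> W) : linear g ->
  (forall v, g v = 0 -> v = 0) -> injective g.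
Proof. by move=> lg g0 u v E; apply/subr0_eq/g0; rewrite linfunB // E subrr. Qed.

Lemma comp_lin (U V W : lmodType K) (f : U -> V) (g : V -> W) : linear f -> linear g ->
  linear (fun x => g (f x)).
Proof. by move=> lf lg c u v; rewrite lf lg. Qed.

Lemma mulmxr_lin m n (A : 'M[K]_(m, n)) : linear (fun r : 'rV_m => r *m A).
Proof. by move=> c u v; rewrite mulmxDl scalemxAl. Qed.

Lemma preim_mx (V : lmodType K) (S : V -> Prop) n (f : 'rV[K]_n -> V) : linear f ->
  subspace S -> exists A : 'M[K]_n, forall r, S (f r) <-> (r <= A)%MS.
Proof.
move=> lf [S0 SD]; apply: (@prop_subspaceP K n (fun r => S (f r))); first by rewrite linfun0.
by move=> c u v Su Sv; rewrite lf; apply: SD.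
Qed.

Lemma fdim_row_base (V : lmodType K) n (f : 'rV[K]_n -> V) (A : 'M_n) (S : V -> Prop) :
  linear f -> (forall v, S v <-> exists2 r, (r <= A)%MS & v = f r) ->
  (forall r, (r <= A)%MS -> f r = 0 -> r = 0) -> fdim S (\rank A).
Proof.
move=> lf SA f0; exists (fun r => f (r *m row_base A)); split.
- exact: (comp_lin (mulmxr_lin _) lf).
- apply: injective_lin; first exact: (comp_lin (mulmxr_lin _) lf).
  move=> r /f0; rewrite -(eq_row_base A) submxMl => /(_ isT)/eqP.
  by rewrite mulmx_free_eq0 ?row_base_free // => /eqP.
- move=> v; split=> [/SA[r]|[r ->]].
    by rewrite -(eq_row_base A) => /submxP[u ->] ->; exists u.
  by apply/SA; exists (r *m row_base A); rewrite // -(eq_row_base A) submxMl.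
Qed.

Lemma fdim_uniq (V : lmodType K) (S : V -> Prop) m n : fdim S m -> fdim S n -> m = n.
Proof.
suff le m' n' : fdim S m' -> fdim S n' -> (m' <= n')%N.
  by move=> Sm Sn; apply/eqP; rewrite eqn_leq !le.
move=> [f [lf injf Sf]] [g [lg injg Sg]].
have [B BE] : exists B : 'M[K]_(m', n'), forall i, f (delta_mx 0 i) = g (row i B).
  have H i : exists r, f (delta_mx 0 i) = g r by apply/Sg/Sf; exists (delta_mx 0 i).
  have [b bE] := boolp.choice H.
  by exists (\matrix_i b i) => i; rewrite rowK.
have fB r : f r = g (r *m B).
  rewrite {1}[r]row_sum_delta mulmx_sum_row !linfun_sum //.
  by apply: eq_bigr => i _; rewrite !linfunZ // BE.
have : row_free B.
  rewrite -kermx_eq0; apply/eqP/row_matrixP => i; rewrite row0.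
  apply: injf; rewrite fB linfun0 // (sub_kermxP _) ?row_sub // linfun0 //.
by rewrite /row_free => /eqP <-; apply: rank_leq_col.
Qed.

Lemma fdim_sub (V : lmodType K) (S T : V -> Prop) n : fdim S n -> subspace T ->
  (forall v, T v -> S v) -> exists k, fdim T k.
Proof.
move=> [f [lf injf Sf]] subT TS; have [A AE] := preim_mx lf subT.
exists (\rank A); apply: (fdim_row_base lf) => [v|r _].
  split=> [Tv|[r /AE Tr ->//]]; have /Sf[r rE] := TS _ Tv.
  by exists r => //; apply/AE; rewrite -rE.
by move=> r0; apply: injf; rewrite r0 linfun0.
Qed.

Lemma fdim_kerim (V W : lmodType K) (g : V -> W) (S : V -> Prop) n : linear g ->
  fdim S n -> exists k r, [/\ n = (k + r)%N, fdim (fun v => S v /\ g v = 0) k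
    & fdim (fun w => exists2 v, S v & w = g v) r].
Proof.
move=> lg [f [lf injf Sf]].
have [A AE] : exists A : 'M[K]_n, forall r, g (f r) = 0 <-> (r <= A)%MS.
  apply: (@prop_subspaceP _ _ (fun r => g (f r) = 0)); first by rewrite !linfun0.
  by move=> c u v Eu Ev; rewrite lf lg Eu Ev scaler0 addr0.
exists (\rank A), (\rank A^C%MS); split.
- by rewrite mxrank_compl subnKC // rank_leq_row.
- apply: (fdim_row_base lf) => [v|r _ r0]; last by apply: injf; rewrite r0 linfun0.
  split=> [[/Sf[r ->] /AE]|[r /AE Er ->]]; first by exists r.
  by split=> //; apply/Sf; exists r.
- apply: (fdim_row_base (comp_lin lf lg)) => [w|r rC /AE rA]; last first.
    apply/eqP; rewrite -submx0 -(capmx_compl A) sub_capmx rA.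
    by have := rC.
  split=> [[x Sx ->]|[r _ ->]]; last by exists (f r) => //; apply/Sf; exists r.
  have /Sf[r ->] := Sx.
  have /sub_addsmxP[[u v] /= rE] : (r <= A + A^C)%MS by rewrite submx_full // addsmx_compl_full.
  exists (v *m A^C%MS); first exact: submxMl.
  rewrite rE linfunD // linfunD //.
  by rewrite (_ : g (f (u *m A)) = 0) ?add0r //; apply/AE/submxMl.
Qed.

Lemma fdim0 (V : lmodType K) (S : V -> Prop) : S 0 -> (forall v, S v -> v = 0) -> fdim S 0.
Proof.
move=> S0 Sv; exists (fun=> 0); split.
- by move=> c u v; rewrite scaler0 addr0.
- by move=> u v _; rewrite [u]thinmx0 [v]thinmx0.
- by move=> v; split=> [/Sv->|[_ ->//]]; exists 0.
Qed.

Lemma fdim_inj (V W : lmodType K) (g : V -> W) (S : V -> Prop) n : linear g ->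
  fdim S n -> (forall v, S v -> g v = 0 -> v = 0) ->
  fdim (fun w => exists2 v, S v & w = g v) n.
Proof.
move=> lg Sn g0; have [k [r [nE kk rr]]] := fdim_kerim lg Sn.
have k0 : k = 0%N.
  apply: (fdim_uniq kk); apply: fdim0 => [|v [Sv /g0->//]].
  by have [S0 _] := fdim_subspace Sn; split=> //; rewrite linfun0.
by rewrite nE k0.
Qed.

Lemma fdim_im (V W : lmodType K) (g : V -> W) (S : V -> Prop) n k : linear g ->
  fdim S n -> fdim (fun v => S v /\ g v = 0) k ->
  exists2 r, n = (k + r)%N & fdim (fun w => exists2 v, S v & w = g v) r.
Proof.
move=> lg Sn Kk; have [k' [r [nE kk rr]]] := fdim_kerim lg Sn.
by exists r; rewrite // (fdim_uniq Kk kk).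
Qed.

Lemma fdim_pair (V W : lmodType K) (S : V -> Prop) (T : W -> Prop) m n :
  fdim S m -> fdim T n -> fdim (fun x : V * W => S x.1 /\ T x.2) (m + n).
Proof.
move=> [f [lf injf Sf]] [g [lg injg Tg]].
exists (fun r : 'rV_(m + n) => (f (lsubmx r), g (rsubmx r))); split.
- by move=> c u v; rewrite !linearP /= lf lg.
- by move=> u v [/injf e1 /injg e2]; rewrite -[u]hsubmxK e1 e2 hsubmxK.
- move=> [v w] /=; split=> [[/Sf[r ->] /Tg[s ->]]|[r [-> ->]]].
    by exists (row_mx r s); rewrite row_mxKl row_mxKr.
  by split; [apply/Sf | apply/Tg]; [exists (lsubmx r) | exists (rsubmx r)].
Qed.

(** The conclusion has the form in which [has_dim] describes a basis, with equality replaced by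
    membership in [N]; the basis comes from a complement of the matrix of [N]. *)
Lemma fdim_quotient (V : lmodType K) (S N : V -> Prop) n k : fdim S n -> fdim N k ->
  (forall v, N v -> S v) -> exists h, n = (h + k)%N /\ exists e : 'I_h -> V,
   (forall i, S (e i)) /\
   forall v, S v -> exists! c : {ffun 'I_h -> K}, N (v - \sum_i c i *: e i).
Proof.
move=> [f [lf injf Sf]] Nk NS.
have [A AE] := preim_mx lf (fdim_subspace Nk).
have kA : k = \rank A.
  apply: (fdim_uniq Nk); apply: (fdim_row_base lf) => [v|r _ r0].
    split=> [Nv|[r /AE Nr ->//]]; have /Sf[r rE] := NS _ Nv.
    by exists r => //; apply/AE; rewrite -rE.
  by apply: injf; rewrite r0 linfun0.
exists (\rank A^C%MS); split; first by rewrite kA mxrank_compl subnK // rank_leq_row.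
pose B := row_base A^C%MS; exists (fun i => f (row i B)); split=> [i|v /Sf[r ->]].
  by apply/Sf; exists (row i B).
have sumE (c : 'rV_(\rank A^C%MS)) : \sum_i c 0 i *: f (row i B) = f (c *m B).
  by rewrite mulmx_sum_row linfun_sum //; apply: eq_bigr => i _; rewrite linfunZ.
have /sub_addsmxP[[u v'] /= rE] : (r <= A + A^C)%MS by rewrite submx_full // addsmx_compl_full.
have /submxP[w wE] : (v' *m A^C <= B)%MS by rewrite eq_row_base submxMl.
exists [ffun i => w 0 i]; split=> [|c].
  under eq_bigr => i _ do rewrite ffunE.
  by rewrite sumE -linfunB //; apply/AE; rewrite rE wE addrK submxMl.
pose cv : 'rV_(\rank A^C%MS) := \row_i c i.
have -> : \sum_i c i *: f (row i B) = f (cv *m B).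
  by rewrite -sumE; apply: eq_bigr => i _; rewrite mxE.
rewrite -linfunB // => /AE; rewrite rE wE -addrA -mulmxBl => H.
have wc : (w - cv) *m B = 0.
  apply/eqP; rewrite -submx0 -(capmx_compl A) sub_capmx; apply/andP; split.
    by rewrite -[_ *m B](addKr (u *m A)) addmx_sub // eqmx_opp submxMl.
  by apply: submx_trans (submxMl _ _) _; rewrite eq_row_base.
have /subr0_eq-> : w - cv = 0.
  by apply/eqP; rewrite -(mulmx_free_eq0 _ (row_base_free A^C%MS)) wc.
by apply/ffunP => i; rewrite ffunE mxE.
Qed.

End FiniteDim.

(** * Differential forms on affine 3-space *)

(** Positive weights bound the degree by the weight, so the finite type of monomials of degree at
    most [n] contains all those of weight [n]. *)
Definition wmon (w : 'I_3 -> nat) (n : nat) : {set 'X_{1..3 < n.+1}} :=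
  [set k : 'X_{1..3 < n.+1} | wdeg w k == n].

(** The coefficient of [t ^ m] in [1 / ((1 - t ^ a) (1 - t ^ b) (1 - t ^ c))], as [act_wpoly]
    shows. *)
Definition pcount (w : 'I_3 -> nat) (m : int) : nat :=
  if m is Posz n then #|wmon w n| else 0%N.

Section Forms.
Variables (K : fieldType) (w : 'I_3 -> nat).
Hypothesis w_gt0 : forall i, (0 < w i)%N.
Local Notation P := {mpoly K[3]}.
Local Notation V3 := (P * P * P)%type.
Implicit Types (f g h : P) (u v phi psi : V3) (l m n d : int).

Lemma mdeg_le_wdeg k : (mdeg k <= wdeg w k)%N.
Proof. by rewrite mdegE /wdeg leq_sum // => i _; rewrite leq_pmull. Qed.

Lemma wdeg0 (k : 'X_{1..3}) : wdeg w k = 0%N -> k = 0%MM.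
Proof. by move=> k0; apply/eqP; rewrite -mdeg_eq0 -leqn0 (leq_trans (mdeg_le_wdeg k)) ?k0. Qed.

Lemma pcount_neg m : m < 0 -> pcount w m = 0%N.
Proof. by case: m. Qed.

Lemma pcount0 : pcount w 0 = 1%N.
Proof.
rewrite -[LHS]/#|wmon w 0| (_ : wmon w 0 = [set (@bm0 3 0 : 'X_{1..3 < 1})]) ?cards1 //; apply/setP => k.
rewrite !inE bmeqP /=; apply/eqP/eqP => [/wdeg0 //|->].
by rewrite /wdeg big1 // => i _; rewrite mnm0E muln0.
Qed.

Lemma fdim_whom m : @fdim K P (whom w m) (pcount w m).
Proof.
case: m => n; last first.
  by apply: fdim0 => [|v /whom_neg->//]; apply: whom0.
pose e (i : 'I_#|wmon w n|) : 'X_{1..3} := enum_val i.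
have eP i : wdeg w (e i) = n by have := enum_valP i; rewrite inE => /eqP.
have e_inj : injective e by move=> i j /val_inj/enum_val_inj.
exists (fun r : 'rV[K]_#|wmon w n| => \sum_i r 0 i *: 'X_[e i]); split.
- move=> c u v; rewrite scaler_sumr -big_split; apply: eq_bigr => i _.
  by rewrite !mxE scalerDl scalerA.
- move=> u v /mpolyP E; apply/rowP => i; have := E (e i); rewrite !raddf_sum /=.
  have S (r : 'rV[K]_#|wmon w n|) : \sum_j (r 0 j *: 'X_[e j])@_(e i) = r 0 i.
    rewrite (bigD1 i) //= mcoeffZ mcoeffX eqxx mulr1 big1 ?addr0 // => j ji.
    by rewrite mcoeffZ mcoeffX (inj_eq e_inj) (negPf ji) mulr0.
  by rewrite !S.
- move=> f; split=> [fm|[r ->]]; last first.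
    elim/big_ind: _ => [|x y|i _]; [exact: whom0|exact: whomD|apply: whomZ].
    by rewrite -(eP i); apply: whomX.
  exists (\row_i f@_(e i)); apply/mpolyP => k; rewrite raddf_sum /=.
  have [k0|kn] := eqVneq (wdeg w k) n; last first.
    have -> : f@_k = 0 by apply/eqP; apply: contraNT kn => /fm[->].
    rewrite big1 // => i _; rewrite mcoeffZ mcoeffX.
    by case: (e i =P k) => [E|_]; rewrite /= ?mulr0 //; rewrite -E eP eqxx in kn.
  have lt_k : (mdeg k < n.+1)%N by rewrite ltnS -k0 mdeg_le_wdeg.
  have kin : BMultinom lt_k \in wmon w n by rewrite inE /= k0.
  have eE : e (enum_rank_in kin (BMultinom lt_k)) = k by rewrite /e enum_rankK_in.
  rewrite (bigD1 (enum_rank_in kin (BMultinom lt_k))) //= mxE mcoeffZ mcoeffX eE eqxx mulr1.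
  rewrite big1 ?addr0 // => i ik; rewrite mcoeffZ mcoeffX -{1}eE (inj_eq e_inj).
  by rewrite (negPf ik) mulr0.
Qed.

Definition cross u v : V3 :=
  (u.1.2 * v.2 - u.2 * v.1.2, u.2 * v.1.1 - u.1.1 * v.2, u.1.1 * v.1.2 - u.1.2 * v.1.1).
Definition dot u v : P := u.1.1 * v.1.1 + u.1.2 * v.1.2 + u.2 * v.2.
Definition smul f v : V3 := (f * v.1.1, f * v.1.2, f * v.2).
Definition grad f : V3 := (f^`M(ix), f^`M(iy), f^`M(iz)).
Definition curl v : V3 := (v.2^`M(iy) - v.1.2^`M(iz), v.1.1^`M(iz) - v.2^`M(ix),
  v.1.2^`M(ix) - v.1.1^`M(iy)).
Definition dive v : P := v.1.1^`M(ix) + v.1.2^`M(iy) + v.2^`M(iz).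
Definition eulerv : V3 := ((w ix)%:R * 'X_ix, (w iy)%:R * 'X_iy, (w iz)%:R * 'X_iz).

Lemma pair3_eq (a b c a' b' c' : P) : a = a' -> b = b' -> c = c' ->
  (a, b, c) = (a', b', c') :> V3.
Proof. by move=> -> -> ->. Qed.

Lemma cross_lin u : linear (cross u).
Proof.
move=> c [[v1 v2] v3] [[v1' v2'] v3']; apply: pair3_eq => /=;
  rewrite -!mul_mpolyC; ring.
Qed.
Lemma crossr_lin u : linear (fun v => cross v u).
Proof.
move=> c [[v1 v2] v3] [[v1' v2'] v3']; apply: pair3_eq => /=;
  rewrite -!mul_mpolyC; ring.
Qed.
Lemma dot_lin u : linear (dot u).
Proof.
by move=> c [[v1 v2] v3] [[v1' v2'] v3']; rewrite /dot /= -!mul_mpolyC; ring.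
Qed.
Lemma smul_lin f : linear (smul f).
Proof.
move=> c [[v1 v2] v3] [[v1' v2'] v3']; apply: pair3_eq => /=;
  rewrite -!mul_mpolyC; ring.
Qed.
Lemma smulr_lin u : linear (smul^~ u).
Proof. move=> c f g; apply: pair3_eq => /=; rewrite -!mul_mpolyC; ring. Qed.
Lemma grad_lin : linear grad.
Proof. by move=> c f g; apply: pair3_eq; rewrite /= mderivD mderivZ. Qed.
Lemma curl_lin : linear curl.
Proof.
move=> c [[v1 v2] v3] [[v1' v2'] v3']; apply: pair3_eq => /=;
  rewrite !mderivD !mderivZ -!mul_mpolyC; ring.
Qed.

Definition sgw : int := (w ix)%:Z + (w iy)%:Z + (w iz)%:Z.

(* A vector of polynomials stands for a 1-form or for a 2-form, [dx_i] having weight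
   [w i]: [O1 l] and [O2 l] are the 1-forms and the 2-forms of weight [l], [e1 l] and
   [e2 l] are the dimensions, [hc1 l] and [hc2 l] the projections. *)
Definition O1 l v := [/\ whom w (l - (w ix)%:Z) v.1.1, whom w (l - (w iy)%:Z) v.1.2
  & whom w (l - (w iz)%:Z) v.2].
Definition O2 l v := [/\ whom w (l - sgw + (w ix)%:Z) v.1.1,
  whom w (l - sgw + (w iy)%:Z) v.1.2 & whom w (l - sgw + (w iz)%:Z) v.2].

Definition e1 l := (pcount w (l - (w ix)%:Z) + pcount w (l - (w iy)%:Z)
  + pcount w (l - (w iz)%:Z))%N.
Definition e2 l := (pcount w (l - sgw + (w ix)%:Z) + pcount w (l - sgw + (w iy)%:Z)
  + pcount w (l - sgw + (w iz)%:Z))%N.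

Lemma fdim_O1 l : @fdim K V3 (O1 l) (e1 l).
Proof.
apply: fdim_ext (fdim_pair (fdim_pair (fdim_whom _) (fdim_whom _)) (fdim_whom _)).
by move=> v; split=> [[[? ?] ?]|[? ? ?]].
Qed.

Lemma fdim_O2 l : @fdim K V3 (O2 l) (e2 l).
Proof.
apply: fdim_ext (fdim_pair (fdim_pair (fdim_whom _) (fdim_whom _)) (fdim_whom _)).
by move=> v; split=> [[[? ?] ?]|[? ? ?]].
Qed.

Definition hc1 l v : V3 := (hc w (l - (w ix)%:Z) v.1.1, hc w (l - (w iy)%:Z) v.1.2,
  hc w (l - (w iz)%:Z) v.2).
Definition hc2 l v : V3 := (hc w (l - sgw + (w ix)%:Z) v.1.1,
  hc w (l - sgw + (w iy)%:Z) v.1.2, hc w (l - sgw + (w iz)%:Z) v.2).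

Lemma O1_hc1 l v : O1 l (hc1 l v). Proof. by split; apply: hc_hom. Qed.
Lemma O2_hc2 l v : O2 l (hc2 l v). Proof. by split; apply: hc_hom. Qed.
Lemma hc1_id l v : O1 l v -> hc1 l v = v.
Proof. by case: v => [[a b] c] [] /= ? ? ?; rewrite /hc1 /= !hc_id. Qed.
Lemma hc2_id l v : O2 l v -> hc2 l v = v.
Proof. by case: v => [[a b] c] [] /= ? ? ?; rewrite /hc2 /= !hc_id. Qed.

Lemma hcM_eq d m m' f g : whom w d f -> m' = d + m -> hc w m' (f * g) = f * hc w m g.
Proof. by move=> fd ->; apply: hcM. Qed.

Lemma hc_deriv_eq m m' i f : m' = m - (w i)%:Z -> hc w m' f^`M(i) = (hc w m f)^`M(i).
Proof. by move=> ->; apply: hc_deriv. Qed.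

Lemma hc2_cross l d u v : O1 d u -> hc2 (d + l) (cross u v) = cross u (hc1 l v).
Proof.
case: u => [[a b] c] [] /= ua ub uc; apply: pair3_eq => /=; rewrite raddfB /=; congr (_ - _);
  first [apply: (hcM_eq _ ua) | apply: (hcM_eq _ ub) | apply: (hcM_eq _ uc)]; rewrite /sgw; ring.
Qed.

Lemma hc_dot2 l d u v : O1 d u -> hc w (l - sgw + d) (dot u v) = dot u (hc2 l v).
Proof.
case: u => [[a b] c] [] /= ua ub uc; rewrite /dot /= !raddfD /=; congr (_ + _ + _);
  first [apply: (hcM_eq _ ua) | apply: (hcM_eq _ ub) | apply: (hcM_eq _ uc)]; rewrite /sgw; ring.
Qed.

Lemma hc_dot1 l d u v : O2 d u -> hc w (d - sgw + l) (dot u v) = dot u (hc1 l v).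
Proof.
case: u => [[a b] c] [] /= ua ub uc; rewrite /dot /= !raddfD /=; congr (_ + _ + _);
  first [apply: (hcM_eq _ ua) | apply: (hcM_eq _ ub) | apply: (hcM_eq _ uc)]; rewrite /sgw; ring.
Qed.

Lemma hc1_grad l f : hc1 l (grad f) = grad (hc w l f).
Proof. by apply: pair3_eq; apply: hc_deriv_eq. Qed.

Lemma hc2_curl l v : hc2 l (curl v) = curl (hc1 l v).
Proof.
apply: pair3_eq; rewrite /= raddfB /=; congr (_ - _); apply: hc_deriv_eq; rewrite /sgw; ring.
Qed.

Lemma hc1_smul d l f v : whom w d f -> hc1 (d + l) (smul f v) = smul f (hc1 l v).
Proof. by move=> fd; apply: pair3_eq; apply: (hcM_eq _ fd); ring. Qed.

Lemma smulr_hc1 d l f v : O1 d v -> hc1 (l + d) (smul f v) = smul (hc w l f) v.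
Proof.
case: v => [[v1 v2] v3] [] /= ua ub uc; apply: pair3_eq; rewrite /= mulrC [RHS]mulrC;
  first [apply: (hcM_eq _ ua) | apply: (hcM_eq _ ub) | apply: (hcM_eq _ uc)]; ring.
Qed.

(* [w_i X_i] has weight [w_i], as if the Euler field were a 2-form of weight [sgw]. *)
Lemma O2_eulerv : O2 sgw eulerv.
Proof.
have H i : whom w (sgw - sgw + (w i)%:Z) ((w i)%:R * 'X_i : P).
  rewrite subrr add0r -mpolyC_nat mul_mpolyC; apply: whomZ.
  by have := @whomX K w U_(i); rewrite wdegU.
by split; apply: H.
Qed.

Lemma mderivXX (i j : 'I_3) : ('X_i : P)^`M(j) = (i == j)%:R.
Proof.
rewrite mderivX mnm1E; case: eqP => [<-|_]; last by rewrite scale0r.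
rewrite scale1r (_ : (U_(i) - U_(i))%MM = 0%MM) ?mpolyX0 //.
by apply/mnmP => l; rewrite mnmBE subnn mnm0E.
Qed.

Lemma mderiv_nat_mul (n : nat) f i : ((n%:R : P) * f)^`M(i) = n%:R * f^`M(i).
Proof. by rewrite -mpolyC_nat mderiv_mulC. Qed.

Lemma euler_grad m f : whom w m f -> dot eulerv (grad f) = m%:~R * f.
Proof. by move=> fm; rewrite -(euler fm) big_ord3 /dot /= !mulrA. Qed.

(** Cartan's formula [d i_E + i_E d = L_E] on 2-forms: crossing with [E] is the contraction, [dive]
    is the exterior derivative to 3-forms, and [L_E] acts by [l] in weight [l]. *)
Lemma cartan2 l psi : O2 l psi ->
  curl (cross psi eulerv) + smul (dive psi) eulerv = smul l%:~R psi.
Proof.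
case: psi => [[p1 p2] p3] [] /= /euler_grad H1 /euler_grad H2 /euler_grad H3.
have El i : (l - sgw + (w i)%:Z)%:~R = l%:~R - (w ix)%:R - (w iy)%:R - (w iz)%:R + (w i)%:R :> P.
  by rewrite /sgw !(rmorphD, rmorphN) /= !pmulrn; ring.
move: H1 H2 H3; rewrite !El /dot /= => H1 H2 H3.
apply: pair3_eq => /=; rewrite !mderivB !(mderiv_nat_mul, mderivM) !mderivXX /= /dive /=.
- transitivity (((l%:~R - (w ix)%:R - (w iy)%:R - (w iz)%:R + (w ix)%:R) * p1) +
    ((w iy)%:R + (w iz)%:R) * p1); [rewrite -H1|]; ring.
- transitivity (((l%:~R - (w ix)%:R - (w iy)%:R - (w iz)%:R + (w iy)%:R) * p2) +
    ((w ix)%:R + (w iz)%:R) * p2); [rewrite -H2|]; ring.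
- transitivity (((l%:~R - (w ix)%:R - (w iy)%:R - (w iz)%:R + (w iz)%:R) * p3) +
    ((w ix)%:R + (w iy)%:R) * p3); [rewrite -H3|]; ring.
Qed.

(** Cartan's formula on 1-forms, solved for the contraction of [curl eta]. *)
Lemma cartan1 l eta : O1 l eta ->
  cross (curl eta) eulerv = smul l%:~R eta - grad (dot eulerv eta).
Proof.
case: eta => [[p1 p2] p3] [] /= /euler_grad H1 /euler_grad H2 /euler_grad H3.
have El i : (l - (w i)%:Z)%:~R = l%:~R - (w i)%:R :> P.
  by rewrite !(rmorphD, rmorphN) /= !pmulrn.
move: H1 H2 H3; rewrite !El /dot /= => H1 H2 H3.
apply: pair3_eq => /=; rewrite !mderivD !(mderiv_nat_mul, mderivM) !mderivXX /=.
- transitivity (((l%:~R - (w ix)%:R) * p1) + (w ix)%:R * p1 -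
    ((w ix)%:R * 'X_ix * p1^`M(ix) + (w ix)%:R * p1 + (w iy)%:R * 'X_iy * p2^`M(ix)
     + (w iz)%:R * 'X_iz * p3^`M(ix))); [rewrite -H1|]; ring.
- transitivity (((l%:~R - (w iy)%:R) * p2) + (w iy)%:R * p2 -
    ((w iy)%:R * 'X_iy * p2^`M(iy) + (w iy)%:R * p2 + (w ix)%:R * 'X_ix * p1^`M(iy)
     + (w iz)%:R * 'X_iz * p3^`M(iy))); [rewrite -H2|]; ring.
- transitivity (((l%:~R - (w iz)%:R) * p3) + (w iz)%:R * p3 -
    ((w iz)%:R * 'X_iz * p3^`M(iz) + (w iz)%:R * p3 + (w ix)%:R * 'X_ix * p1^`M(iz)
     + (w iy)%:R * 'X_iy * p2^`M(iz))); [rewrite -H3|]; ring.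
Qed.

Lemma cross_cross u v t : cross (cross u v) t = smul (dot u t) v - smul (dot v t) u.
Proof.
case: u v t => [[u1 u2] u3] [[v1 v2] v3] [[t1 t2] t3].
by apply: pair3_eq; rewrite /dot /=; ring.
Qed.

Lemma dot_cross u v : dot u (cross u v) = 0.
Proof. by rewrite /dot /=; ring. Qed.

Lemma dotC u v : dot u v = dot v u.
Proof. by rewrite /dot; ring. Qed.

End Forms.

(** * Dimension of the bracket quotient over a perfect field *)

Section KoszulForms.
Variables (K : fieldType) (w : 'I_3 -> nat).
Local Notation P := {mpoly K[3]}.
Local Notation V3 := (P * P * P)%type.
Variables (u : V3) (N : nat).
Hypothesis XN : forall i, exists v, 'X_i ^+ N = dot u v.

Lemma pair3_inj (v v' : V3) : v = v' -> [/\ v.1.1 = v'.1.1, v.1.2 = v'.1.2 & v.2 = v'.2].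
Proof. by move=> ->. Qed.

(** The powers of the variables are a regular sequence inside the ideal of the components of [u].
    The hypothesis [XN] is met by the gradient of [Q] and also, with [N = 1], by the Euler field. *)
Lemma exact1_forms phi : cross u phi = 0 -> exists f, phi = smul f u.
Proof.
have [a aE] := XN ix; have [b bE] := XN iy.
move=> /pair3_inj[/= /subr0_eq E1 /subr0_eq E2 /subr0_eq E3].
have [|||f g|f [fE1 fE2 fE3]] := @koszul_exact1 P u.1.1 u.1.2 u.2 ('X_ix ^+ N) ('X_iy ^+ N)
  a.1.1 a.1.2 a.2 b.1.1 b.1.2 b.2 _ _ _ _ _ _ _ E1 E2 E3.
- by rewrite aE /dot; ring.
- by rewrite bE /dot; ring.
- exact: Xn_regular1.
- by apply: Xn_regular2.
by exists f; case: (phi) fE1 fE2 fE3 => [[p1 p2] p3] /= -> -> ->.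
Qed.

Lemma exact2_forms psi : dot u psi = 0 -> exists v, psi = cross u v.
Proof.
have [a aE] := XN ix; have [b bE] := XN iy; have [c cE] := XN iz => E.
have [||||f g|f g h|v1 [v2 [v3 [E1 E2 E3]]]] := @koszul_exact2 P u.1.1 u.1.2 u.2 ('X_ix ^+ N) ('X_iy ^+ N)
  ('X_iz ^+ N) a.1.1 a.1.2 a.2 b.1.1 b.1.2 b.2 c.1.1 c.1.2 c.2 _ _ _ _ _ _ _ _ _ E.
- by rewrite aE /dot; ring.
- by rewrite bE /dot; ring.
- by rewrite cE /dot; ring.
- exact: Xn_regular1.
- exact: (@Xn_regular2 K 3 ix iy N f g isT).
- exact: (@Xn_regular3 K 3 ix iy iz).
by exists (v1, v2, v3); case: (psi) E1 E2 E3 => [[p1 p2] p3] /= -> -> ->.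
Qed.

Lemma forms_neq0 : u != 0.
Proof.
have [a aE] := XN ix; apply/eqP => u0; have := @Xn_regular1 K 3 ix N 1.
rewrite mulr1 aE u0 /dot /= !mul0r !addr0 => /(_ erefl)/eqP.
by rewrite oner_eq0.
Qed.

Lemma smul_neq0 f : smul f u = 0 -> f = 0.
Proof.
move=> /pair3_inj[/= /eqP E1 /eqP E2 /eqP E3]; apply/eqP; apply: contraNT forms_neq0 => f0.
move: E1 E2 E3; rewrite !mulf_eq0 (negPf f0) /=.
by case: (u) => [[u1 u2] u3] /= /eqP-> /eqP-> /eqP->.
Qed.

Lemma exact1_hom d l phi : O1 w d u -> O1 w (l + d) phi -> cross u phi = 0 ->
  exists2 f, whom w l f & phi = smul f u.
Proof.
move=> ud phil /exact1_forms[f fE]; exists (hc w l f); first exact: hc_hom.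
by rewrite -(hc1_id phil) fE smulr_hc1.
Qed.

Lemma exact2_hom d l psi : O1 w d u -> O2 w (d + l) psi -> dot u psi = 0 ->
  exists2 v, O1 w l v & psi = cross u v.
Proof.
move=> ud psil /exact2_forms[v vE]; exists (hc1 w l v); first exact: O1_hc1.
by rewrite -(hc2_id psil) vE hc2_cross.
Qed.

End KoszulForms.

(** * The Koszul complex of the Euler field *)

Section Subspaces.
Variables (K : fieldType) (w : 'I_3 -> nat).
Hypothesis w_gt0 : forall i, (0 < w i)%N.
Hypothesis w_neq0 : forall i, (w i)%:R != 0 :> K.
Local Notation P := {mpoly K[3]}.
Local Notation V3 := (P * P * P)%type.
Local Notation E := (eulerv K w).
Local Notation pcount := (pcount w).

Lemma XE i : exists v, 'X_i ^+ 1 = dot E v.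
Proof.
have H j : (w j)%:R * 'X_j * ((w j)%:R^-1)%:MP = 'X_j :> P.
  by rewrite mulrAC -mpolyC_nat -mpolyCM divff // mpolyC1 mul1r.
move: i; apply: ord3P; rewrite expr1; [exists ((w ix)%:R^-1%:MP, 0, 0)|
  exists (0, (w iy)%:R^-1%:MP, 0)|exists (0, 0, (w iz)%:R^-1%:MP)];
  by rewrite /dot /= H !mulr0 ?addr0 ?add0r.
Qed.

Lemma smulr_hc2 m l (f : P) : l = m + sgw w -> hc2 w l (smul f E) = smul (hc w m f) E.
Proof.
have H i : whom w (w i)%:Z ((w i)%:R * 'X_i : P).
  rewrite -mpolyC_nat mul_mpolyC; apply: whomZ.
  by have := @whomX K w U_(i); rewrite wdegU.
move=> ->; apply: pair3_eq; rewrite /= mulrC [RHS]mulrC; apply: (hcM_eq _ (H _)); ring.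
Qed.

(** If all three exponents of a monomial were below [N], its weight would be less than the bound. *)
Lemma dvd_power_sum (f : P) N : (forall k, f@_k != 0 -> (N * (w ix + w iy + w iz) <= wdeg w k)%N) ->
  exists g1 g2 g3, f = 'X_ix ^+ N * g1 + 'X_iy ^+ N * g2 + 'X_iz ^+ N * g3.
Proof.
move=> Hf; apply: dvd_Xn3 => k /Hf; apply: contraLR; rewrite !negb_or -!ltnNge.
move=> /and3P[k1 k2 k3]; rewrite /wdeg big_ord3.
have := w_gt0 ix; have := w_gt0 iy; have := w_gt0 iz.
by nia.
Qed.

Lemma euler_onto l (f : P) : 0 < l -> whom w l f -> exists2 v, O1 w l v & f = dot E v.
Proof.
move=> l0 fl; have [k fk|g1 [g2 [g3 fE]]] := @dvd_Xn3 K 3 f ix iy iz 1.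
  have := fl _ fk; rewrite /wdeg big_ord3 => kl.
  have : (0 < w ix * k ix + w iy * k iy + w iz * k iz)%N by rewrite -ltz_nat kl.
  case: (k ix) => [|?] //; case: (k iy) => [|?] //; case: (k iz) => [|?] //.
  by rewrite !muln0.
pose v : V3 := ((w ix)%:R^-1%:MP * g1, (w iy)%:R^-1%:MP * g2, (w iz)%:R^-1%:MP * g3).
have H j g : (w j)%:R * 'X_j * ((w j)%:R^-1%:MP * g) = 'X_j * g :> P.
  by rewrite mulrA [_ * 'X_j * _]mulrAC -mpolyC_nat -mpolyCM divff // mpolyC1 mul1r.
have vE : f = dot E v by rewrite fE /dot /= !H !expr1.
exists (hc1 w l v); first exact: O1_hc1.
rewrite -(hc_dot1 l v (O2_eulerv K w)) -vE hc_id //.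
by rewrite subrr add0r.
Qed.

Lemma crossC (u v : V3) : cross u v = - cross v u.
Proof. by apply: pair3_eq; rewrite /=; ring. Qed.

Lemma smul_cross (f : P) (u : V3) : cross (smul f u) u = 0.
Proof. by apply: pair3_eq; rewrite /=; ring. Qed.

Lemma O2_smul_euler l (h : P) : whom w (l - sgw w) h -> O2 w l (smul h E).
Proof.
by move=> hl; rewrite -(hc_id hl) -(@smulr_hc2 _ l) ?subrK //; apply: O2_hc2.
Qed.

Lemma O1_cross_euler l v : O2 w l v -> O1 w l (cross v E).
Proof.
have H i : whom w (w i)%:Z ((w i)%:R * 'X_i : P).
  rewrite -mpolyC_nat mul_mpolyC; apply: whomZ.
  by have := @whomX K w U_(i); rewrite wdegU.
move=> [v1 v2 v3]; split; apply: whomB => /=.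
- by rewrite (_ : l - _ = (l - sgw w + w iy) + w iz); [apply: whomM|rewrite /sgw; ring].
- by rewrite (_ : l - _ = (l - sgw w + w iz) + w iy); [apply: whomM|rewrite /sgw; ring].
- by rewrite (_ : l - _ = (l - sgw w + w iz) + w ix); [apply: whomM|rewrite /sgw; ring].
- by rewrite (_ : l - _ = (l - sgw w + w ix) + w iz); [apply: whomM|rewrite /sgw; ring].
- by rewrite (_ : l - _ = (l - sgw w + w ix) + w iy); [apply: whomM|rewrite /sgw; ring].
- by rewrite (_ : l - _ = (l - sgw w + w iy) + w ix); [apply: whomM|rewrite /sgw; ring].
Qed.

Lemma cross_euler_ker l v : O2 w l v -> cross v E = 0 ->
  exists2 h, whom w (l - sgw w) h & v = smul h E.
Proof.
move=> vl; rewrite crossC => /eqP; rewrite oppr_eq0 => /eqP/(exact1_forms XE)[h hE].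
exists (hc w (l - sgw w) h); first exact: hc_hom.
by rewrite -(hc2_id vl) hE (@smulr_hc2 (l - sgw w)) ?subrK.
Qed.

Lemma whom_dot_euler l v : O1 w l v -> whom w l (dot E v).
Proof.
move=> vl; rewrite -[v](hc1_id vl) -(hc_dot1 l v (O2_eulerv K w)).
by rewrite (_ : sgw w - sgw w + l = l) ?subrr ?add0r //; apply: hc_hom.
Qed.

Lemma hc1_cross_euler l v : hc1 w l (cross v E) = cross (hc2 w l v) E.
Proof.
have H i : whom w (w i)%:Z ((w i)%:R * 'X_i : P).
  rewrite -mpolyC_nat mul_mpolyC; apply: whomZ.
  by have := @whomX K w U_(i); rewrite wdegU.
apply: pair3_eq; rewrite /= raddfB /=; congr (_ - _); rewrite mulrC [RHS]mulrC;
  apply: (hcM_eq _ (H _)); rewrite /sgw; ring.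
Qed.

Lemma dot_euler_ker l v : O1 w l v -> dot E v = 0 -> exists2 u, O2 w l u & v = cross u E.
Proof.
move=> vl /(exact2_forms XE)[u uE]; exists (hc2 w l (- u)); first exact: O2_hc2.
rewrite -hc1_cross_euler -{1}(hc1_id vl) uE crossC; congr (hc1 _ _ _).
by apply: pair3_eq; rewrite /=; ring.
Qed.

Lemma fdim_smul_euler l : @fdim K V3 (fun v => exists2 h, whom w (l - sgw w) h & v = smul h E)
  (pcount (l - sgw w)).
Proof.
apply: fdim_inj (fdim_whom K w_gt0 _) _; first exact: smulr_lin.
by move=> h _ /(smul_neq0 XE).
Qed.

(** Euler characteristic, in weight [l], of the Koszul complex of [E], whose terms have dimensions
    [pcount (l - sg)], [e2 l], [e1 l] and [pcount l]. In weight 0 the constants are not in the image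
    of [dot E], whence the exclusion. *)
Lemma pcount_euler l : l != 0 ->
  (pcount l + e2 w l = e1 w l + pcount (l - sgw w))%N.
Proof.
move=> l_neq0.
have [r1 e2E r1dim] : exists2 r, e2 w l = (pcount (l - sgw w) + r)%N &
    @fdim K V3 (fun v => exists2 u, O2 w l u & v = cross u E) r.
  apply: fdim_im (fdim_O2 K w_gt0 l) _; first exact: crossr_lin.
  apply: fdim_ext (fdim_smul_euler l) => v; split=> [[h hl ->]|[vl H]]; last exact: cross_euler_ker vl H.
  by split; [apply: O2_smul_euler | rewrite smul_cross].
have [r2 e1E r2dim] : exists2 r, e1 w l = (r1 + r)%N &
    @fdim K P (fun f => exists2 v, O1 w l v & f = dot E v) r.
  apply: fdim_im (fdim_O1 K w_gt0 l) _; first exact: dot_lin.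
  apply: fdim_ext r1dim => v; split=> [[u ul ->]|[vl H]]; last exact: dot_euler_ker vl H.
  by split; [apply: O1_cross_euler | rewrite dotC /dot /=; ring].
have r2E : r2 = pcount l.
  apply: fdim_uniq r2dim _; apply: fdim_ext (fdim_whom K w_gt0 l) => f.
  split=> [fl|[v vl ->]]; last exact: whom_dot_euler.
  case: (ltrgtP l 0) l_neq0 => // [l0|l0] _; last exact: euler_onto.
  rewrite (whom_neg l0 fl); exists 0; last by rewrite /dot /= !mulr0 !addr0.
  by split; apply: whom0.
by rewrite e2E e1E r2E; lia.
Qed.

End Subspaces.

(** * The Koszul complex of the gradient of Q, and the space W *)

Section Reduction.
Variables (K : fieldType) (p : nat) (w : 'I_3 -> nat) (d N : nat) (Q : {mpoly K[3]}).
Hypothesis charK : p \in [pchar K].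
Hypothesis perfK : forall c : K, exists e, e ^+ p == c.
Hypothesis w_gt0 : forall i, (0 < w i)%N.
Hypothesis w_neq0 : forall i, (w i)%:R != 0 :> K.
Hypothesis d_neq0 : d%:R != 0 :> K.
Hypothesis Qd : whom w d%:Z Q.
Local Notation P := {mpoly K[3]}.
Local Notation V3 := (P * P * P)%type.
Local Notation E := (eulerv K w).
Local Notation q := (grad Q).
Local Notation pcount := (pcount w).
Local Notation sg := (sgw w).
Hypothesis Xq : forall i, exists v, 'X_i ^+ N = dot q v.

Let p_pr : prime p. Proof. by case/andP: charK. Qed.

Lemma O1_grad : O1 w d q.
Proof. by split; apply: whom_deriv. Qed.

Lemma dotE_grad : dot E q = d%:R * Q.
Proof. by rewrite (euler_grad Qd) pmulrn. Qed.

Lemma fdim_smul_grad l : @fdim K V3 (fun v => exists2 h, whom w l h & v = smul h q)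
  (pcount l).
Proof.
apply: fdim_inj (fdim_whom K w_gt0 _) _; first exact: smulr_lin.
by move=> h _ /(smul_neq0 Xq).
Qed.

Lemma O1_smul l (f : P) (v : V3) m : whom w m f -> O1 w l v -> O1 w (m + l) (smul f v).
Proof. by move=> fm vl; rewrite -(hc1_id vl) -(hc1_smul _ _ fm); apply: O1_hc1. Qed.

Lemma O2_cross l (u v : V3) m : O1 w m u -> O1 w l v -> O2 w (m + l) (cross u v).
Proof. by move=> um vl; rewrite -(hc1_id vl) -(hc2_cross _ _ um); apply: O2_hc2. Qed.

Lemma cross_smul (f : P) (u : V3) : cross u (smul f u) = 0.
Proof. by apply: pair3_eq; rewrite /=; ring. Qed.

Definition crossq l (v : V3) := exists2 phi, O1 w l phi & v = cross q phi.

Lemma fdim_crossq l : exists2 r, e1 w l = (pcount (l - d%:Z) + r)%N & @fdim K V3 (crossq l) r.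
Proof.
apply: fdim_im (fdim_O1 K w_gt0 l) _; first exact: cross_lin.
apply: fdim_ext (fdim_smul_grad (l - d%:Z)) => v; split=> [[h hl ->]|[vl H]].
  split; last exact: cross_smul.
  by have := O1_smul hl O1_grad; rewrite subrK.
have [|h hl hE] := exact1_hom Xq O1_grad (l := l - d%:Z) _ H; first by rewrite subrK.
by exists h.
Qed.

Lemma dot_grad_ker l psi : O2 w l psi -> dot q psi = 0 -> crossq (l - d%:Z) psi.
Proof.
move=> pl H; have [|v vl vE] := exact2_hom Xq O1_grad (l := l - d%:Z) _ H.
  by rewrite addrC subrK.
by exists v.
Qed.

(** Euler characteristic of the Koszul complex of [q] in a weight so large that every monomial
    contains the [N]-th power of a variable, and so lies in the Jacobian ideal. *)
Lemma milnor_vanish n : (N * (w ix + w iy + w iz))%:Z <= n -> let l := n + sg - d%:Z in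
  (e2 w l + pcount (l - d%:Z - d%:Z) = pcount n + e1 w (l - d%:Z))%N.
Proof.
move=> n_ge l; have [r1 -> r1dim] := fdim_crossq (l - d%:Z).
have [r2 -> r2dim] : exists2 r, e2 w l = (r1 + r)%N &
    @fdim K P (fun f => exists2 v, O2 w l v & f = dot q v) r.
  apply: fdim_im (fdim_O2 K w_gt0 l) _; first exact: dot_lin.
  apply: fdim_ext r1dim => v; split=> [[u ul ->]|[vl H]]; last exact: dot_grad_ker vl H.
  by split; [have := O2_cross O1_grad ul; rewrite addrC subrK | apply: dot_cross].
suff -> : r2 = pcount n.
  by rewrite [(_ + r1)%N]addnC addnA [(pcount n + r1)%N]addnC.
apply: fdim_uniq r2dim _; apply: fdim_ext (fdim_whom K w_gt0 n) => f.
have El : l - sg + d = n by rewrite /l; ring.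
split=> [fn|[v vl ->]]; last by rewrite -(hc2_id vl) -(hc_dot2 l v O1_grad) El; apply: hc_hom.
have [k fk|g1 [g2 [g3 fE]]] := dvd_power_sum w_gt0 (f := f) (N := N).
  by rewrite -lez_nat (fn _ fk).
have [v1 v1E] := Xq ix; have [v2 v2E] := Xq iy; have [v3 v3E] := Xq iz.
have vE : f = dot q (smul g1 v1 + smul g2 v2 + smul g3 v3).
  by rewrite fE v1E v2E v3E /dot /=; ring.
exists (hc2 w l (smul g1 v1 + smul g2 v2 + smul g3 v3)); first exact: O2_hc2.
by rewrite -(hc_dot2 l _ O1_grad) El -vE hc_id.
Qed.

(* [grad Q . curl eta] is the sum of brackets [{eta_1, x} + {eta_2, y} + {eta_3, z}], and
   all brackets have this form. *)
Definition brack0 (f : P) := exists h eta, f = Q * h + dot q (curl eta).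

(* the [psi] of weight [l] such that [q . psi] satisfies [brack0 Q] *)
Definition Wsp l (psi : V3) := exists h eta phi, [/\ whom w (l - sg) h, O1 w l eta,
  O1 w (l - d%:Z) phi & psi = smul h E + curl eta + cross q phi].

Lemma O2D l (u v : V3) : O2 w l u -> O2 w l v -> O2 w l (u + v).
Proof. by move=> [? ? ?] [? ? ?]; split; apply: whomD. Qed.

Lemma O1Z l c (u : V3) : O1 w l u -> O1 w l (c *: u).
Proof. by move=> [? ? ?]; split; apply: whomZ. Qed.

Lemma O1D l (u v : V3) : O1 w l u -> O1 w l v -> O1 w l (u + v).
Proof. by move=> [? ? ?] [? ? ?]; split; apply: whomD. Qed.

Lemma O1_0 l : O1 w l (0 : V3).
Proof. by split; apply: whom0. Qed.

Lemma O2_curl l (v : V3) : O1 w l v -> O2 w l (curl v).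
Proof. by move=> vl; rewrite -(hc1_id vl) -hc2_curl; apply: O2_hc2. Qed.

Lemma Wsp_O2 l psi : Wsp l psi -> O2 w l psi.
Proof.
move=> [h [eta [phi [hl el pl ->]]]]; apply: O2D; first apply: O2D.
- exact: O2_smul_euler.
- exact: O2_curl.
- by have := O2_cross O1_grad pl; rewrite addrC subrK.
Qed.

Lemma Wsp_subspace l : subspace (Wsp l).
Proof.
split.
  exists 0, 0, 0; split; rewrite ?(linfun0 (smulr_lin _)) ?(linfun0 (@curl_lin K)).
  - exact: whom0.
  - exact: O1_0.
  - exact: O1_0.
  - by rewrite (linfun0 (cross_lin _)) !addr0.
move=> c u v [h [eta [phi [h1 h2 h3 ->]]]] [h' [eta' [phi' [h1' h2' h3' ->]]]].
exists (c *: h + h'), (c *: eta + eta'), (c *: phi + phi'); split.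
- by apply: whomD => //; apply: whomZ.
- by apply: O1D => //; apply: O1Z.
- by apply: O1D => //; apply: O1Z.
rewrite (smulr_lin _) (@curl_lin K) (cross_lin _) !scalerDr.
rewrite addrACA [X in X + _]addrACA. reflexivity.
Qed.

End Reduction.

(** * Polynomials with gradient in (Q, grad Q), in weights divisible by p *)

Section Kernel2.
Variables (K : fieldType) (p : nat) (w : 'I_3 -> nat) (d N : nat) (Q : {mpoly K[3]}).
Hypothesis charK : p \in [pchar K].
Hypothesis perfK : forall c : K, exists e, e ^+ p == c.
Hypothesis w_gt0 : forall i, (0 < w i)%N.
Hypothesis w_neq0 : forall i, (w i)%:R != 0 :> K.
Hypothesis d_neq0 : d%:R != 0 :> K.
Hypothesis Qd : whom w d%:Z Q.
Local Notation P := {mpoly K[3]}.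
Local Notation V3 := (P * P * P)%type.
Local Notation E := (eulerv K w).
Local Notation q := (grad Q).
Local Notation pcount := (pcount w).
Local Notation sg := (sgw w).
Hypothesis Xq : forall i, exists v, 'X_i ^+ N = dot q v.

Let p_pr : prime p. Proof. by case/andP: charK. Qed.

(** Taking [p]-th powers is only semilinear. [Fr] is linear and has the same image, since
    [Fr (sgm f) = f ^ p] and [sgm] is onto, so it makes the [p]-th powers accessible to dimension
    counts. *)
Definition Fr (f : P) : P := f \mPo [tuple 'X_i ^+ p | i < 3].
Definition sgm (f : P) : P := map_mpoly (pFrobenius_aut charK) f.

Lemma Fr_lin : linear Fr.
Proof. by move=> c f g; rewrite /Fr comp_mpolyD comp_mpolyZ. Qed.

Lemma FrM f g : Fr (f * g) = Fr f * Fr g.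
Proof. exact: rmorphM. Qed.

Lemma FrX k : Fr 'X_[k] = 'X_[k *+ p].
Proof.
rewrite /Fr comp_mpolyX mpolyXE_id; apply: eq_bigr => i _.
by rewrite tnth_mktuple mulmnE mulnC exprM.
Qed.

Lemma Fr_sgm f : Fr (sgm f) = f ^+ p.
Proof.
rewrite {2}[f]mpolyE.
have := rmorph_sum (pFrobenius_aut (pchar_mpoly charK)) (msupp f) xpredT
  (fun k => f@_k *: 'X_[k]); rewrite /= pFrobenius_autE => ->.
rewrite /sgm {1}[f]mpolyE raddf_sum linfun_sum //=; last exact: Fr_lin.
apply: eq_bigr => k _; rewrite map_mpolyZ map_mpolyX (linfunZ Fr_lin) FrX.
by rewrite /= !pFrobenius_autE exprZn mpolyXn.
Qed.

Lemma sgm_onto u : exists f, sgm f = u.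
Proof.
pose root c := xchoose (perfK c).
have rootK c : root c ^+ p = c by apply/eqP/(xchooseP (perfK c)).
exists (\sum_(k <- msupp u) root u@_k *: 'X_[k]).
rewrite /sgm raddf_sum [RHS]mpolyE; apply: eq_bigr => k _.
by rewrite /= map_mpolyZ map_mpolyX /= pFrobenius_autE rootK.
Qed.

Lemma wdegMn k n : wdeg w (k *+ n)%MM = (n * wdeg w k)%N.
Proof.
by rewrite /wdeg big_distrr; apply: eq_bigr => i _; rewrite mulmnE mulnA mulnC.
Qed.

Lemma hc_Fr j u : hc w (p%:Z * j) (Fr u) = Fr (hc w j u).
Proof.
rewrite [u]mpolyE (linfun_sum Fr_lin) !raddf_sum (linfun_sum Fr_lin).
apply: eq_bigr => k _; rewrite /= (linfunZ Fr_lin) !linearZ /= (linfunZ Fr_lin) FrX !hcX.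
rewrite wdegMn PoszM (inj_eq (mulfI _)) ?eqz_nat -?lt0n ?prime_gt0 //.
by case: ifP => _; rewrite ?FrX // (linfun0 Fr_lin).
Qed.

Lemma whom_Fr j u : whom w j u -> whom w (p%:Z * j) (Fr u).
Proof. by move=> uj; rewrite -(hc_id uj) -hc_Fr; apply: hc_hom. Qed.

Lemma whom_sgm j f : whom w j f -> whom w j (sgm f).
Proof.
by move=> fj k; rewrite mcoeff_map_mpoly /= pFrobenius_autE expf_eq0 prime_gt0 //= => /fj.
Qed.

Lemma whom_exp m (f : P) n : whom w m f -> whom w (n%:Z * m) (f ^+ n).
Proof.
move=> fm; elim: n => [|n IHn].
  by rewrite mul0r expr0 -mpolyX0; have := @whomX K w 0%MM; rewrite /wdeg big1 // => i _; rewrite mnm0E muln0.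
by rewrite exprS -addn1 PoszD mulrDl mul1r addrC; apply: whomM.
Qed.

Lemma Q_neq0 : Q != 0.
Proof.
apply: contraNneq (forms_neq0 Xq) => ->; apply/eqP.
by apply: pair3_eq; rewrite mderiv0.
Qed.

Lemma q_fun_exact1 (f : 'I_3 -> P) : (forall i j, Q^`M(i) * f j = Q^`M(j) * f i) ->
  exists u, forall i, f i = u * Q^`M(i).
Proof.
move=> fE; have [|u /pair3_inj[/= E1 E2 E3]] := @exact1_forms _ _ _ Xq (f ix, f iy, f iz).
  by apply: pair3_eq; rewrite /= fE subrr.
by exists u; apply: ord3P.
Qed.

Lemma q_fun_exact2 (f : 'I_3 -> P) : \sum_i Q^`M(i) * f i = 0 ->
  exists v : 'I_3 -> P, [/\ f ix = Q^`M(iy) * v iz - Q^`M(iz) * v iy,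
    f iy = Q^`M(iz) * v ix - Q^`M(ix) * v iz & f iz = Q^`M(ix) * v iy - Q^`M(iy) * v ix].
Proof.
rewrite big_ord3 => fE; have [|v /pair3_inj[/= E1 E2 E3]] := @exact2_forms _ _ _ Xq (f ix, f iy, f iz).
  exact: fE.
by exists (fun i => if i == ix then v.1.1 else if i == iy then v.1.2 else v.2).
Qed.

Lemma q_fun_neq0 : exists i, Q^`M(i) != 0.
Proof.
have [q0|] := eqVneq Q^`M(ix) 0; last by exists ix.
have [q1|] := eqVneq Q^`M(iy) 0; last by exists iy.
have [q2|] := eqVneq Q^`M(iz) 0; last by exists iz.
by case/eqP: (forms_neq0 Xq); apply: pair3_eq.
Qed.

(** This is [(q x phi) x E], expanded by the triple product formula with [E . q = d Q]. *)
Definition tau (phi : V3) : V3 := smul (d%:R * Q) phi - smul (dot E phi) q.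

Lemma tau_lin : linear tau.
Proof.
move=> c u v; rewrite /tau (smul_lin _) (dot_lin _) (smulr_lin _) scalerBr.
by rewrite opprD !addrA; congr (_ + _); rewrite -!addrA; congr (_ + _); rewrite addrC.
Qed.

Definition Zsp l (f : P) := whom w l f /\ exists2 phi, O1 w (l - d%:Z) phi & grad f + tau phi = 0.

Variables (l j : int).
Hypothesis lE : l = p%:Z * j.

Let l0 : l%:~R = 0 :> P.
Proof. by rewrite lE intrM -pmulrn (pcharf0 (pchar_mpoly charK)) mul0r. Qed.

Let dP : d%:R * (d%:R^-1)%:MP = 1 :> P.
Proof. by rewrite -mpolyC_nat -mpolyCM divff // mpolyC1. Qed.

(** [kernel_d], cut down to the right weight, gives one direction. Conversely [phi = - grad h / d]
    works: the weight [l - d] of [h] is [- d] in [K], so [E . phi = h] and [tau phi = - grad (Q h)],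
    while [Fr u] is a [p]-th power and has zero gradient. *)
Lemma ZspP f : Zsp l f <-> exists u h, [/\ whom w j u, whom w (l - d%:Z) h & f = Fr u + Q * h].
Proof.
split=> [[fl [phi _ H]]|[u [h [uj hl ->]]]].
  have [i|w0 [h fE]] := @kernel_d K p charK perfK Q q_fun_exact1 q_fun_exact2 q_fun_neq0
    f (dot E phi) (fun i => - (d%:R * (if i == ix then phi.1.1 else if i == iy then phi.1.2 else phi.2))).
    have [/= H1 H2 H3] := pair3_inj H.
    by move: i; apply: ord3P => /=; apply/subr0_eq; [rewrite -[RHS]H1|rewrite -[RHS]H2|rewrite -[RHS]H3]; ring.
  exists (hc w j (sgm w0)), (hc w (l - d%:Z) h); split; try exact: hc_hom.
  by rewrite -hc_Fr -lE Fr_sgm -(hcM _ _ Qd) [d%:Z + _]addrC subrK -raddfD -fE /= hc_id.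
split.
  apply: whomD; first by rewrite lE; apply: whom_Fr.
  by rewrite -[l](subrK d%:Z) addrC; apply: whomM.
exists (smul (- (d%:R^-1)%:MP) (grad h)).
  have -> : smul (- (d%:R^-1)%:MP) (grad h) = hc1 w (l - d%:Z) (smul (- (d%:R^-1)%:MP) (grad h)).
    have w0 : whom w 0 (- (d%:R^-1)%:MP : P).
      apply: whomN; rewrite -[X in X%:MP]mulr1 mpolyCM mpolyC1 mul_mpolyC -mpolyX0.
      apply: whomZ; have := @whomX K w 0%MM; rewrite /wdeg big1 // => i _.
      by rewrite mnm0E muln0.
    by rewrite -[l - _]add0r (hc1_smul _ _ w0) hc1_grad hc_id.
  exact: O1_hc1.
have [u' uE] := sgm_onto u; rewrite -uE Fr_sgm.
have D i : (u' ^+ p + Q * h)^`M(i) = Q^`M(i) * h + Q * h^`M(i).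
  rewrite mderivD mderivM; have := mderiv_pth_power charK i u' 1.
  by rewrite mulr1 => ->; rewrite -mpolyC1 mderivC mulr0 add0r.
have Eh : dot E (smul (- (d%:R^-1)%:MP) (grad h)) = h.
  rewrite (_ : dot _ _ = - (d%:R^-1)%:MP * dot E (grad h)); last by rewrite /dot /=; ring.
  rewrite (euler_grad hl) rmorphB /= l0 sub0r -pmulrn.
  by transitivity (d%:R * (d%:R^-1)%:MP * h); [ring | rewrite dP mul1r].
rewrite /tau Eh; apply: pair3_eq; rewrite /= D.
- by transitivity ((1 - d%:R * (d%:R^-1)%:MP) * (Q * h^`M(ix))); [ring | rewrite dP subrr mul0r].
- by transitivity ((1 - d%:R * (d%:R^-1)%:MP) * (Q * h^`M(iy))); [ring | rewrite dP subrr mul0r].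
- by transitivity ((1 - d%:R * (d%:R^-1)%:MP) * (Q * h^`M(iz))); [ring | rewrite dP subrr mul0r].
Qed.

Lemma fdim_Zsp : exists2 z, (pcount (j - d%:Z) + z = pcount j + pcount (l - d%:Z))%N
  & @fdim K P (Zsp l) z.
Proof.
pose g (x : P * P) := Fr x.1 + Q * x.2.
have lin_g : linear g.
  move=> c x y; rewrite /g /= Fr_lin mulrDr -scalerAr scalerDr !addrA; congr (_ + _).
  by rewrite -!addrA; congr (_ + _); rewrite addrC.
(* These are all the relations between the two summands: if [Q] divides [Fr u], then [u = sgm Q v]
   for some [v] by [reduced_p], and [Fr u = Q ^ p Fr v]. *)
pose k v := (sgm Q * v, - (Q ^+ p.-1 * Fr v)).
have lin_k : linear k.
  move=> c u v; rewrite /k Fr_lin; congr (_, _).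
    by rewrite /= mulrDr -scalerAr.
  by rewrite /= mulrDr -scalerAr opprD scalerN.
have p1 : p.-1.+1 = p by rewrite prednK // prime_gt0.
have gk v : g (k v) = 0.
  by rewrite /g /= FrM Fr_sgm mulrN mulrA -exprS p1 subrr.
have pz : p.-1%:Z = p%:Z - 1 by rewrite -{2}p1 -addn1 PoszD addrK.
have kdim : @fdim K (P * P)%type (fun x => (whom w j x.1 /\ whom w (l - d%:Z) x.2) /\ g x = 0)
    (pcount (j - d%:Z)).
  apply: fdim_ext (fdim_inj lin_k (fdim_whom K w_gt0 (j - d%:Z)) _) => [x|v _ /(congr1 fst) /= kv]; last first.
    apply/eqP; have /eqP := kv; rewrite mulf_eq0 => /orP[/eqP Q0|//].
    have := Fr_sgm Q; rewrite Q0 (linfun0 Fr_lin) => /esym/eqP.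
    by rewrite expf_eq0 (negPf Q_neq0) andbF.
  split=> [[v vj ->]|[[x1 x2] gx]].
    split; last exact: gk.
    split; rewrite /=; first by rewrite -[j](subrK d%:Z) addrC; apply/whomM/vj/whom_sgm.
    apply: whomN; rewrite (_ : l - d%:Z = p.-1%:Z * d%:Z + p%:Z * (j - d%:Z)).
      by apply: whomM; [apply: whom_exp | apply: whom_Fr].
    by rewrite lE pz; ring.
  have [f fE] := sgm_onto x.1.
  have [|v vE] := reduced_p charK perfK q_fun_exact1 q_fun_neq0 (w := f) (h := - x.2).
    by rewrite -Fr_sgm fE mulrN; apply/eqP; rewrite -subr_eq0 opprK; apply/eqP.
  exists (hc w (j - d%:Z) (sgm v)); first exact: hc_hom.
  have E1 : x.1 = sgm Q * hc w (j - d%:Z) (sgm v).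
    rewrite -(hcM _ _ (whom_sgm Qd)) addrC subrK -[x.1](hc_id x1) -fE vE.
    by rewrite /sgm rmorphM.
  rewrite [LHS]surjective_pairing /k -E1; congr (_, _).
  apply: (mulfI Q_neq0); rewrite mulrN mulrA -exprS p1 -Fr_sgm -FrM -E1.
  by apply/eqP; rewrite -addr_eq0 addrC; apply/eqP.
have [z zE zdim] := fdim_im lin_g (fdim_pair (fdim_whom K w_gt0 j) (fdim_whom K w_gt0 (l - d%:Z))) kdim.
exists z; first by rewrite zE.
apply: fdim_ext zdim => f; rewrite ZspP; split=> [[[u h] /= [uj hl] ->]|[u [h [uj hl ->]]]].
  by exists u, h.
by exists (u, h).
Qed.

End Kernel2.

(** * Dimension of the bracket quotient in a single weight *)

Section Basis.
Variables (K : fieldType) (p : nat) (w : 'I_3 -> nat) (d N : nat) (Q : {mpoly K[3]}).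
Hypothesis charK : p \in [pchar K].
Hypothesis perfK : forall c : K, exists e, e ^+ p == c.
Hypothesis w_gt0 : forall i, (0 < w i)%N.
Hypothesis w_neq0 : forall i, (w i)%:R != 0 :> K.
Hypothesis d_neq0 : d%:R != 0 :> K.
Hypothesis Qd : whom w d%:Z Q.
Local Notation P := {mpoly K[3]}.
Local Notation V3 := (P * P * P)%type.
Local Notation E := (eulerv K w).
Local Notation q := (grad Q).
Local Notation pcount := (pcount w).
Local Notation sg := (sgw w).
Hypothesis Xq : forall i, exists v, 'X_i ^+ N = dot q v.

Let p_pr : prime p. Proof. by case/andP: charK. Qed.

Local Notation Wsp := (Wsp w d Q).
Local Notation tau := (tau w d Q).
Local Notation brack0 := (brack0 Q).

Definition brackn n (f : P) := whom w n f /\ brack0 f.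

(** Since [q . E = d Q] with [d] invertible, multiples of [Q] come from multiples of [E]. The
    summand [q x phi] of [Wsp] adds nothing to the image; it makes [Wsp] contain the whole kernel of
    [dot q], so that dimensions can be subtracted in [fdim_brackn]. *)
Lemma brackn_Wsp n f : let l := n + sg - d%:Z in
  brackn n f <-> exists2 psi, Wsp l psi & f = dot q psi.
Proof.
move=> l; have El : l - sg + d = n by rewrite /l; ring.
have qE : dot q E = d%:R * Q by rewrite dotC (dotE_grad Qd).
have dP : d%:R * (d%:R^-1)%:MP = 1 :> P.
  by rewrite -mpolyC_nat -mpolyCM divff // mpolyC1.
split=> [[fn [h [eta fE]]]|[psi Wpsi ->]].
  pose h' := hc w (l - sg) h.
  exists (smul (d%:R^-1 *: h') E + curl (hc1 w l eta) + cross q 0).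
    exists (d%:R^-1 *: h'), (hc1 w l eta), 0; split=> //.
    - exact/whomZ/hc_hom.
    - exact: O1_hc1.
    - exact: O1_0.
  rewrite -(hc_id fn) fE raddfD /= (linfun0 (cross_lin _)) addr0 (linfunD (dot_lin _)).
  rewrite -hc2_curl -(hc_dot2 l _ (O1_grad Qd)) El; congr (_ + _).
  rewrite -{1}El addrC (hcM _ _ Qd) (linfunZ (smulr_lin _)) (linfunZ (dot_lin _)).
  rewrite (_ : dot q (smul h' E) = h' * dot q E); last by rewrite /dot /=; ring.
  rewrite qE -mul_mpolyC -/h'.
  by transitivity ((d%:R * (d%:R^-1)%:MP) * (Q * h')); [rewrite dP mul1r | ring].
split; first by rewrite -(hc2_id (Wsp_O2 Qd Wpsi)) -(hc_dot2 l _ (O1_grad Qd)) El; apply: hc_hom.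
have [h [eta [phi [_ _ _ ->]]]] := Wpsi; exists (d%:R * h), eta.
rewrite !(linfunD (dot_lin _)) dot_cross addr0; congr (_ + _).
rewrite (_ : dot q (smul h E) = h * dot q E); last by rewrite /dot /=; ring.
by rewrite qE; ring.
Qed.

Lemma fdim_brackn n k : let l := n + sg - d%:Z in @fdim K V3 (Wsp l) k ->
  exists r m, [/\ e1 w (l - d%:Z) = (pcount (l - d%:Z - d%:Z) + r)%N, k = (r + m)%N
    & @fdim K P (brackn n) m].
Proof.
move=> l Wk; have [r -> rdim] := fdim_crossq w_gt0 Qd Xq (l - d%:Z).
have [m kE mdim] : exists2 m, k = (r + m)%N &
    @fdim K P (fun f => exists2 v, Wsp l v & f = dot q v) m.
  apply: fdim_im (dot_lin _) Wk _; apply: fdim_ext rdim => v.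
  split=> [[phi pl ->]|[Wv H]]; last exact: (dot_grad_ker Qd Xq (Wsp_O2 Qd Wv) H).
  split; last exact: dot_cross.
  exists 0, 0, phi; split=> //; first exact: whom0.
  - exact: O1_0.
  - by rewrite (linfun0 (smulr_lin _)) (linfun0 (@curl_lin K)) !add0r.
by exists r, m; split=> //; apply: fdim_ext mdim => f; rewrite brackn_Wsp.
Qed.

(** Cartan's formula, divided by [l], writes any 2-form as a multiple of [E] plus a curl. For
    [l <= 0] the components have negative weight, so there are no nonzero 2-forms. *)
Lemma fdim_Wsp_generic l : (l%:~R != 0 :> K) || (l <= 0) -> @fdim K V3 (Wsp l) (e2 w l).
Proof.
move=> lP; apply: fdim_ext (fdim_O2 K w_gt0 l) => psi; split=> [pl|]; last exact: Wsp_O2.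
have [l_le0|l_gt0] := lerP l 0.
  have -> : psi = 0; last by case: (Wsp_subspace w d Q l).
  have := w_gt0 ix; have := w_gt0 iy; have := w_gt0 iz => h1 h2 h3.
  case: psi pl => [[p1 p2] p3] [] /= E1 E2 E3.
  by rewrite (whom_neg _ E1) 1?(whom_neg _ E2) 1?(whom_neg _ E3) // /sgw; lia.
have l0 : (l%:~R != 0 :> K) by case/orP: lP => //; rewrite leNgt l_gt0.
pose c : K := l%:~R^-1.
exists (c *: dive psi), (c *: cross psi E), 0; split.
- apply: whomZ; case: pl => E1 E2 E3; apply: whomD; first apply: whomD.
  + by rewrite -(addrK (w ix)%:Z (l - sg)); apply: whom_deriv.
  + by rewrite -(addrK (w iy)%:Z (l - sg)); apply: whom_deriv.
  + by rewrite -(addrK (w iz)%:Z (l - sg)); apply: whom_deriv.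
- by apply: O1Z; apply: O1_cross_euler.
- exact: O1_0.
rewrite (linfun0 (cross_lin _)) addr0 (linfunZ (smulr_lin _)) (linfunZ (@curl_lin K)).
rewrite -scalerDr addrC (cartan2 pl).
have -> : l%:~R = (l%:~R : K)%:MP :> P by rewrite rmorph_int.
rewrite (_ : smul _ psi = l%:~R *: psi); first by rewrite scalerA mulVf ?scale1r.
by case: (psi) => [[p1 p2] p3]; apply: pair3_eq; rewrite /= mul_mpolyC.
Qed.

(** Crossing with [E] kills [h E], sends [curl eta] to [- grad (E . eta)] by Cartan's formula with
    [l = 0] in [P], and sends [q x phi] to [tau phi]. Every [f] of positive weight is some
    [E . eta]. *)
Lemma Wsp_image l (v : V3) : l%:~R = 0 :> P -> 0 < l ->
  (exists2 psi, Wsp l psi & v = cross psi E) <->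
  (exists2 x : P * V3, whom w l x.1 /\ O1 w (l - d%:Z) x.2 & v = grad x.1 + tau x.2).
Proof.
move=> l0 l_gt0.
have key h eta phi : O1 w l eta ->
   cross (smul h E + curl eta + cross q phi) E = grad (- dot E eta) + tau phi.
  move=> el; rewrite !(linfunD (crossr_lin _)) smul_cross add0r (cartan1 el) l0.
  rewrite cross_cross [dot q E]dotC (dotE_grad Qd) [dot phi E]dotC.
  rewrite (linfunN (@grad_lin K)) (_ : smul 0 eta = 0) ?sub0r //.
  by apply: pair3_eq; rewrite mul0r.
split=> [[_ [h [eta [phi [hl el pl ->]]]] ->]|[[f phi] /= [fl pl] ->]].
  exists (- dot E eta, phi); last exact: key.
  by split=> //=; apply/whomN/whom_dot_euler.
have [eta el fE] := euler_onto w_neq0 l_gt0 fl.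
exists (smul 0 E + curl (- eta) + cross q phi).
  exists 0, (- eta), phi; split=> //; first exact: whom0.
  by rewrite -scaleN1r; apply: O1Z.
rewrite key; first by rewrite (linfunN (dot_lin _)) opprK -fE.
by rewrite -scaleN1r; apply: O1Z.
Qed.

Lemma tau_ker l phi : O1 w (l - d%:Z) phi -> tau phi = 0 ->
  exists2 h, whom w (l - d%:Z - d%:Z) h & phi = smul h q.
Proof.
move=> pl H; have cq : cross q phi = 0.
  have E0 : smul (d%:R * Q) (cross q phi) = 0.
    transitivity (cross q (tau phi)); last by rewrite H (linfun0 (cross_lin _)).
    by rewrite /tau; apply: pair3_eq; rewrite /=; ring.
  have dQ : d%:R * Q != 0 by rewrite -mpolyC_nat mul_mpolyC scaler_eq0 negb_or d_neq0 (Q_neq0 Xq).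
  move: (d%:R * Q) dQ E0 => D dQ /pair3_inj[/= /eqP E1 /eqP E2 /eqP E3].
  move: E1 E2 E3; rewrite !mulf_eq0 (negPf dQ) /= => /eqP E1 /eqP E2 /eqP E3.
  exact: pair3_eq.
have [|h] := exact1_hom Xq (O1_grad Qd) (l := l - d%:Z - d%:Z) _ cq; first by rewrite subrK.
by exists h.
Qed.

Lemma tau_smul h : tau (smul h q) = 0.
Proof.
rewrite /tau (_ : dot E (smul h q) = h * dot E q); last by rewrite /dot /=; ring.
by rewrite (dotE_grad Qd); apply: pair3_eq; rewrite /=; ring.
Qed.

(** [pcount (l - sg)] is the dimension of the multiples of [E], which are the kernel of crossing
    with [E]. [t] is the rank of [(f, phi) |-> grad f + tau phi], and [k] is the dimension of its
    kernel, which projects onto [Zsp] with fibre the [phi = h q] killed by [tau]. *)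
Lemma fdim_Wsp_special l j : l = p%:Z * j -> 0 < l -> exists t z k,
  [/\ @fdim K V3 (Wsp l) (pcount (l - sg) + t)%N,
   (pcount l + e1 w (l - d%:Z) = k + t)%N, (k = pcount (l - d%:Z - d%:Z) + z)%N &
   (pcount (j - d%:Z) + z = pcount j + pcount (l - d%:Z))%N].
Proof.
move=> lE l_gt0.
have l0 : l%:~R = 0 :> P by rewrite lE intrM -pmulrn (pcharf0 (pchar_mpoly charK)) mul0r.
have [m Wm] := fdim_sub (fdim_O2 K w_gt0 l) (Wsp_subspace w d Q l) (@Wsp_O2 _ _ _ _ Qd l).
have [t mE tdim] : exists2 t, m = (pcount (l - sg) + t)%N &
    @fdim K V3 (fun v => exists2 psi, Wsp l psi & v = cross psi E) t.
  apply: fdim_im (crossr_lin _) Wm _; apply: fdim_ext (fdim_smul_euler w_gt0 w_neq0 l) => v.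
  split=> [[h hl ->]|[/(Wsp_O2 Qd) vl H]]; last exact: cross_euler_ker vl H.
  split; last exact: smul_cross.
  exists h, 0, 0; split=> //; try exact: O1_0.
  by rewrite (linfun0 (cross_lin _)) (linfun0 (@curl_lin K)) !addr0.
pose G (x : P * V3) := grad x.1 + tau x.2.
have lin_G : linear G.
  by move=> c x y; rewrite /G /= (@grad_lin K) (@tau_lin K w d Q) addrACA -scalerDr.
have [k [t' [kE kdim t'dim]]] := fdim_kerim lin_G
  (fdim_pair (fdim_whom K w_gt0 l) (fdim_O1 K w_gt0 (l - d%:Z))).
have tE : t' = t.
  by apply: fdim_uniq t'dim _; apply: fdim_ext tdim => v; rewrite Wsp_image.
have lin1 : linear (fst : P * V3 -> P) by [].
have [z zE zdim] := fdim_Zsp charK perfK w_gt0 d_neq0 Qd Xq lE.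
have kE2 : k = (pcount (l - d%:Z - d%:Z) + z)%N.
  have [z' -> z'dim] : exists2 z', k = (pcount (l - d%:Z - d%:Z) + z')%N &
     @fdim K P (fun f => exists2 x : P * V3, (whom w l x.1 /\ O1 w (l - d%:Z) x.2) /\ G x = 0 & f = x.1) z'.
    apply: fdim_im lin1 kdim _.
    have lin_i : linear (fun h : P => (0, smul h q) : P * V3).
      by move=> c u v; rewrite (smulr_lin _); congr (_, _); rewrite /= scaler0 addr0.
    apply: fdim_ext (fdim_inj lin_i (fdim_whom K w_gt0 (l - d%:Z - d%:Z)) _) => [x|h _ /(congr1 snd) /=]; last exact: smul_neq0 Xq _.
    split=> [[h hl ->]|[[[x1 x2] Gx] x0]] /=.
      split=> //; split; last by rewrite /G /= tau_smul (linfun0 (@grad_lin K)) addr0.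
      split; first exact: whom0.
      by have := O1_smul hl (O1_grad Qd); rewrite subrK.
    have [|h hl hE] := tau_ker x2; first by move: Gx; rewrite /G x0 (linfun0 (@grad_lin K)) add0r.
    by exists h; rewrite // -hE -x0; apply: surjective_pairing.
  congr (_ + _)%N; apply: fdim_uniq z'dim _; apply: fdim_ext zdim => f.
  split=> [[fl [phi pl H]]|[[f' phi] /= [[fl pl] H] ->]]; last by split=> //; exists phi.
  by exists (f, phi).
by exists t, z, k; split=> //; rewrite -?mE // kE tE.
Qed.

Theorem brack0_basis n : exists h (e : 'I_h -> P), [/\ forall i, whom w n (e i),
  forall f, whom w n f -> exists! c : {ffun 'I_h -> K}, brack0 (f - \sum_i c i *: e i)
  & let l := n + sg - d%:Z in
   ((l%:~R != 0 :> K) || (l <= 0) -> (h + e2 w l + pcount (l - d%:Z - d%:Z) = pcount n + e1 w (l - d%:Z))%N) /\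
   (forall j, l = p%:Z * j -> 0 < l ->
     (h + pcount (l - sg) + pcount l + pcount (j - d%:Z) =
      pcount n + pcount j + pcount (l - d%:Z))%N)].
Proof.
set l := n + sg - d%:Z.
have [k Wk] := fdim_sub (fdim_O2 K w_gt0 l) (Wsp_subspace w d Q l) (@Wsp_O2 _ _ _ _ Qd l).
have [r [m [rE kE mdim]]] := fdim_brackn Wk.
have [h [hE [e [en eP]]]] := fdim_quotient (fdim_whom K w_gt0 n) mdim (fun v => @proj1 _ _).
exists h, e; split=> // [f fn|].
  have nE (c : {ffun 'I_h -> K}) : brackn n (f - \sum_i c i *: e i) <-> brack0 (f - \sum_i c i *: e i).
    split=> [[]//|]; split=> //; apply: whomB => //.
    by elim/big_ind: _ => [|x y|i _]; [exact: whom0|exact: whomD|apply: whomZ].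
  have [c [/nE c1 c2]] := eP f fn; exists c; split=> // c' /nE; exact: c2.
split=> [lP|j lE l_gt0].
  by have := fdim_uniq Wk (fdim_Wsp_generic lP); rewrite rE -/l; lia.
have [t [z [k' [W' E1 E2 E3]]]] := fdim_Wsp_special lE l_gt0.
rewrite -/l in rE; have kW := fdim_uniq Wk W'.
move: rE kE hE E1 E2 E3 kW; move: (pcount n) (pcount l) (pcount (l - sg)) (pcount j).
move: (pcount (j - d%:Z)) (pcount (l - d%:Z)) (pcount (l - d%:Z - d%:Z)) (e1 w (l - d%:Z)).
by clear; lia.
Qed.

End Basis.

(** * Power series identities for the weight counting function *)

Section PolyAction.
Variable R : idomainType.
Implicit Types (p q : {poly R}) (f g : int -> R) (n : int).

(* multiplication by [p] of the two-sided series with coefficients [f] *)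
Definition act p f n : R := \sum_(i < size p) p`_i * f (n - i%:Z).

Lemma act_widen p f n m : (size p <= m)%N -> act p f n = \sum_(i < m) p`_i * f (n - i%:Z).
Proof.
move=> le_pm; rewrite /act (big_ord_widen m (fun i => p`_i * f (n - i%:Z))) //.
rewrite [RHS](bigID (fun i : 'I_m => (i < size p)%N)) /= [X in _ + X]big1 ?addr0 // => i.
by rewrite -leqNgt => /(nth_default 0)->; rewrite mul0r.
Qed.

Lemma actD p q f n : act (p + q) f n = act p f n + act q f n.
Proof.
pose m := maxn (size p) (size q).
rewrite (@act_widen (p + q) _ _ m) ?size_polyD // (@act_widen p _ _ m) ?leq_maxl //.
rewrite (@act_widen q _ _ m) ?leq_maxr // -big_split; apply: eq_bigr => i _.
by rewrite coefD mulrDl.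
Qed.

Lemma actC c f n : act c%:P f n = c * f n.
Proof. by rewrite (@act_widen _ _ _ 1) ?size_polyC_leq1 // big_ord1 coefC subr0. Qed.

Lemma actMX p f n : act (p * 'X) f n = act p f (n - 1).
Proof.
have le : (size (p * 'X)%R <= (size p).+1)%N by rewrite (leq_trans (size_polyMleq _ _)) // size_polyX addn2.
rewrite (act_widen _ _ le) big_ord_recl coefMX mul0r add0r; apply: eq_bigr => i _.
by rewrite lift0 coefMX /= -addn1 PoszD opprD addrA addrAC.
Qed.

Lemma act_eq p f g : f =1 g -> act p f =1 act p g.
Proof. by move=> fg n; apply: eq_bigr => i _; rewrite fg. Qed.

Lemma actM p q f n : act (p * q) f n = act p (act q f) n.
Proof.
elim/poly_ind: p n => [|p c IHp] n; first by rewrite mul0r /act size_poly0 !big_ord0.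
rewrite mulrDl !actD mulrAC !actMX IHp actC; congr (_ + _).
elim/poly_ind: q {IHp} n => [|q e IHq] n; first by rewrite mulr0 /act size_poly0 !big_ord0 mulr0.
by rewrite mulrDr mulrA !actD !actMX IHq -polyCM !actC mulrDr mulrA.
Qed.

Lemma actN p f n : act (- p) f n = - act p f n.
Proof. by rewrite -[- p]mulN1r -polyCN actM actC mulN1r. Qed.

Lemma actB p q f n : act (p - q) f n = act p f n - act q f n.
Proof. by rewrite actD actN. Qed.

Lemma actXn k f n : act 'X^k f n = f (n - k%:Z).
Proof.
elim: k n => [|k IHk] n; first by rewrite expr0 actC mul1r subr0.
by rewrite exprSr actMX IHk -addn1 PoszD opprD addrA addrAC.
Qed.

Lemma act1BXn k f n : act (1 - 'X^k) f n = f n - f (n - k%:Z).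
Proof. by rewrite actB actXn actC mul1r. Qed.

Definition delta (n : int) : R := (n == 0)%:R.
Definition cseq p n : R := if n is Posz m then p`_m else 0.

Lemma act_delta p n : act p delta n = cseq p n.
Proof.
rewrite /act; case: n => n.
  have [lt_n|le_n] := ltnP n (size p).
    rewrite (bigD1 (Ordinal lt_n)) //= subrr mulr1 big1 ?addr0 // => i /negPf ni.
    by rewrite /delta subr_eq0 eqz_nat eq_sym [_ == _]ni mulr0.
  rewrite /cseq nth_default // big1 // => i _; rewrite /delta subr_eq0 eqz_nat gtn_eqF ?mulr0 //.
  exact: leq_trans le_n.
rewrite /cseq big1 // => i _; rewrite /delta subr_eq0; case: eqP; rewrite ?mulr0 //.
Qed.

Lemma act_cseq p q n : act p (cseq q) n = cseq (p * q) n.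
Proof.
by rewrite -act_delta actM; apply: act_eq => m; rewrite act_delta.
Qed.

Lemma cseq_inj p q : cseq p =1 cseq q -> p = q.
Proof. by move=> E; apply/polyP => i; exact: (E (Posz i)). Qed.

Lemma act_cancel0 p f : p`_0 != 0 -> (exists n0, forall n, n < n0 -> f n = 0) ->
  (forall n, act p f n = 0) -> forall n, f n = 0.
Proof.
move=> p0 [n0 f0] pf0 n.
suff H (k : nat) : forall n, n < n0 + k%:Z -> f n = 0.
  by apply: (H `|n - n0|.+1); have := lez_abs (n - n0); lia.
elim: k => [|k IHk] m lt_m; first by apply: f0; rewrite addr0 in lt_m.
have /eqP := pf0 m; rewrite (@act_widen _ _ _ (size p).+1) // big_ord_recl subr0 big1 ?addr0 => [|i _].
  by rewrite mulf_eq0 (negPf p0) => /eqP.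
by rewrite IHk ?mulr0 // lift0; lia.
Qed.

(** Sequences bounded below are Laurent series, on which a nonzero polynomial acts injectively.
    Without the bound this fails: [1 - X ^ M] kills all sequences of period [M]. *)
Lemma act_cancel p f : p != 0 -> (exists n0, forall n, n < n0 -> f n = 0) ->
  (forall n, act p f n = 0) -> forall n, f n = 0.
Proof.
elim/poly_ind: p => [|q c IHq] qc fb qf0; first by rewrite eqxx in qc.
have [c0|c0] := eqVneq c 0; last first.
  by apply: act_cancel0 fb qf0; rewrite coefD coefMX coefC eqxx add0r.
rewrite c0 addr0 in qc qf0; apply: IHq => // [|n].
  by apply: contraNneq qc => ->; rewrite mul0r.
by have := qf0 (n + 1); rewrite actMX addrK.
Qed.

End PolyAction.
Arguments delta {R} n.

Lemma act3 (R : idomainType) i j k (f : int -> R) n : act ((1 - 'X^i) * (1 - 'X^j) * (1 - 'X^k)) f n =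
  f n - f (n - i%:Z) - f (n - j%:Z) - f (n - k%:Z) + f (n - i%:Z - j%:Z) + f (n - i%:Z - k%:Z)
  + f (n - j%:Z - k%:Z) - f (n - i%:Z - j%:Z - k%:Z).
Proof.
rewrite !actM !act1BXn.
have -> : n - j%:Z - k%:Z = n - k%:Z - j%:Z by rewrite addrAC.
by ring.
Qed.

(** * Generating functions of the monomials and of the Jacobian ring *)

Section Numeric.
Variables (w : 'I_3 -> nat) (d : nat).
Hypothesis w_gt0 : forall i, (0 < w i)%N.
Hypothesis w_lt_d : forall i, (w i < d)%N.
Local Notation sg := (sgw w).
Hypothesis milnor0 : exists n0 : int, forall n, n0 <= n -> let l := n + sg - d%:Z in
  (e2 w l + pcount w (l - d%:Z - d%:Z) = pcount w n + e1 w (l - d%:Z))%N.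

Let P (n : int) : int := pcount w n.
Local Notation a := (w ix).
Local Notation b := (w iy).
Local Notation c := (w iz).

Let sgn := (a + b + c)%N.
Let sgE : sg = sgn%:Z. Proof. by rewrite /sgw !PoszD. Qed.

Definition wpoly : {poly int} := (1 - 'X^a) * (1 - 'X^b) * (1 - 'X^c).
Local Notation B := wpoly.
Definition jacpoly : {poly int} := (1 - 'X^(d - a)) * (1 - 'X^(d - b)) * (1 - 'X^(d - c)).

Lemma P_neg n : n < 0 -> P n = 0.
Proof. by move=> n0; rewrite /P pcount_neg. Qed.

(** Away from 0 the recurrence is [pcount_euler] over the rationals; the missing constants in weight
    0 give the delta. *)
Lemma act_wpoly n : act B P n = delta n.
Proof.
have wQ i : (w i)%:R != 0 :> rat by rewrite pnatr_eq0 -lt0n.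
have := w_gt0 ix; have := w_gt0 iy; have := w_gt0 iz => a0 b0 c0.
rewrite act3 /delta; have [->|n0] := eqVneq n 0.
  by rewrite {1}/P pcount0 // !P_neg ?subr0 ?addr0 //; lia.
have := pcount_euler w_gt0 wQ n0; rewrite /e1 /e2 => E.
have E1 : n - sg + a%:Z = n - b%:Z - c%:Z by rewrite /sgw; ring.
have E2 : n - sg + b%:Z = n - a%:Z - c%:Z by rewrite /sgw; ring.
have E3 : n - sg + c%:Z = n - a%:Z - b%:Z by rewrite /sgw; ring.
have E4 : n - sg = n - a%:Z - b%:Z - c%:Z by rewrite /sgw; ring.
rewrite E1 E2 E3 E4 in E; rewrite /P; move: E.
move: (pcount w n) (pcount w (n - a%:Z)) (pcount w (n - b%:Z)) (pcount w (n - c%:Z)).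
move: (pcount w (n - b%:Z - c%:Z)) (pcount w (n - a%:Z - c%:Z)) (pcount w (n - a%:Z - b%:Z)).
move: (pcount w (n - a%:Z - b%:Z - c%:Z)) => x1 x2 x3 x4 x5 x6 x7 x8; clear; lia.
Qed.

Lemma jac_neg n : n < 0 -> act jacpoly P n = 0.
Proof.
by move=> n_lt0; rewrite act3 !P_neg ?subr0 ?addr0 //; lia.
Qed.

(** The eight shifts in the product are those of the Koszul complex of [q], so the coefficient is
    the Euler characteristic that vanishes for large [n]. *)
Lemma act_jacpoly n : let l := n + sg - d%:Z in act jacpoly P n =
  P n - (e2 w l)%:Z + (e1 w (l - d%:Z))%:Z - P (l - d%:Z - d%:Z).
Proof.
move=> l; rewrite act3 /e2 /e1 /P !PoszD.
have dE i : (d - w i)%N%:Z = d%:Z - (w i)%:Z by rewrite subzn // ltnW.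
have -> : l - sg + a%:Z = n - (d - a)%N%:Z by rewrite /l dE; ring.
have -> : l - sg + b%:Z = n - (d - b)%N%:Z by rewrite /l dE; ring.
have -> : l - sg + c%:Z = n - (d - c)%N%:Z by rewrite /l dE; ring.
have -> : l - d%:Z - a%:Z = n - (d - b)%N%:Z - (d - c)%N%:Z by rewrite /l /sgw !dE; ring.
have -> : l - d%:Z - b%:Z = n - (d - a)%N%:Z - (d - c)%N%:Z by rewrite /l /sgw !dE; ring.
have -> : l - d%:Z - c%:Z = n - (d - a)%N%:Z - (d - b)%N%:Z by rewrite /l /sgw !dE; ring.
have -> : l - d%:Z - d%:Z = n - (d - a)%N%:Z - (d - b)%N%:Z - (d - c)%N%:Z by rewrite /l /sgw !dE; ring.
ring.
Qed.

(** The series [jacpoly / B] vanishes in negative and in large degrees, hence is a polynomial; the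
    truncation at [m] loses nothing. *)
Lemma jacpoly_dvd : exists J : {poly int}, jacpoly = B * J.
Proof.
have [n0 Hn0] := milnor0; pose m := `|n0|%N.
exists (\poly_(i < m) act jacpoly P i%:Z); apply: cseq_inj => n.
rewrite -act_delta -[LHS](act_eq jacpoly act_wpoly) -actM mulrC actM -act_cseq.
apply: act_eq => k; rewrite /cseq; case: k => k; last by rewrite jac_neg.
rewrite coef_poly; case: ltnP => // mk; rewrite act_jacpoly.
have := Hn0 k%:Z; rewrite /m in mk; have -> : n0 <= k%:Z by lia.
move=> /(_ isT) /(congr1 Posz); rewrite !PoszD /P => E.
by move: E; lia.
Qed.

End Numeric.

(** * Divisibilities and values of the numerator at roots of unity *)

Section RootsOfUnity.
Implicit Types (z : algC) (p q : {poly int}) (r m n a b c d : nat).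

Definition ev z p : algC := (map_poly intr p).[z].

Lemma evM z p q : ev z (p * q) = ev z p * ev z q.
Proof. by rewrite /ev rmorphM hornerM. Qed.
Lemma evB z p q : ev z (p - q) = ev z p - ev z q.
Proof. by rewrite /ev rmorphB hornerD hornerN. Qed.
Lemma ev1 z : ev z 1 = 1.
Proof. by rewrite /ev rmorph1 hornerC. Qed.
Lemma evXn z n : ev z 'X^n = z ^+ n.
Proof. by rewrite /ev map_polyXn hornerXn. Qed.

Definition geom r m : {poly int} := \sum_(i < m) 'X^r ^+ i.

Lemma geomE r m : 1 - 'X^(r * m) = (1 - 'X^r) * geom r m :> {poly int}.
Proof. by rewrite exprM -opprB subrX1 -mulNr opprB. Qed.

Lemma ev_geom z r m : z ^+ r = 1 -> ev z (geom r m) = m%:R.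
Proof.
move=> zr; rewrite /ev /geom rmorph_sum horner_sum /=.
rewrite (eq_bigr (fun=> 1)) ?sumr_const ?card_ord // => i _.
by have := evXn z (r * i); rewrite exprM /ev => ->; rewrite exprM zr expr1n.
Qed.

Lemma X1_neq0 r : (0 < r)%N -> 1 - 'X^r != 0 :> {poly int}.
Proof.
move=> r0; apply/eqP => /(congr1 (fun q : {poly int} => q`_0)).
by rewrite coefB coef1 coefXn coef0 eqxx eq_sym gtn_eqF.
Qed.

Lemma ev_1BX_eq0 z r n : r.-primitive_root z -> (ev z (1 - 'X^n) == 0) = (r %| n)%N.
Proof. by move=> zr; rewrite evB ev1 evXn subr_eq0 eq_sym (prim_order_dvd zr). Qed.

Section Jac.
Variables (a b c d : nat) (J : {poly int}).
Hypothesis c_lt_d : (c < d)%N.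
Hypothesis JE : (1 - 'X^(d - a)) * (1 - 'X^(d - b)) * (1 - 'X^(d - c))
  = (1 - 'X^a) * (1 - 'X^b) * (1 - 'X^c) * J.

(** The right side of [JE] vanishes at [z], so some factor on the left does. *)
Lemma jac_one r z : r.-primitive_root z -> (r %| a)%N ->
  [|| (r %| d - a)%N, (r %| d - b)%N | (r %| d - c)%N].
Proof.
move=> zr ra; have := congr1 (ev z) JE; rewrite !evM => E.
have : ev z (1 - 'X^(d - a)) * ev z (1 - 'X^(d - b)) * ev z (1 - 'X^(d - c)) == 0.
  have /eqP az : ev z (1 - 'X^a) == 0 by rewrite (ev_1BX_eq0 _ zr).
  by rewrite E az !mul0r.
by rewrite !mulf_eq0 !(ev_1BX_eq0 _ zr) orbA.
Qed.

(** If [r] did not divide [d], only the factor [1 - X ^ (d - c)] on the left could vanish at [z],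
    with a simple zero against a double one on the right. Cancelling [1 - X ^ r] once and evaluating
    gives the contradiction. *)
Lemma jac_two r z : r.-primitive_root z -> (r %| a)%N -> (r %| b)%N -> (a < d)%N ->
  (b < d)%N -> ~~ (r %| c)%N -> (r %| d)%N.
Proof.
move=> zr ra rb lt_ad lt_bd rc; apply: contraT => rd.
have r_gt0 := prim_order_gt0 zr.
have ra' : ~~ (r %| d - a)%N by rewrite dvdn_subl // ltnW.
have rb' : ~~ (r %| d - b)%N by rewrite dvdn_subl // ltnW.
have [m mE] : exists m, (d - c = r * m)%N.
  have := jac_one zr ra; rewrite (negPf ra') (negPf rb') /= => /dvdnP[m ->].
  by exists m; rewrite mulnC.
have [a' aE] : exists m, (a = r * m)%N by case/dvdnP: ra => k ->; exists k; rewrite mulnC.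
have [b' bE] : exists m, (b = r * m)%N by case/dvdnP: rb => k ->; exists k; rewrite mulnC.
have E : (1 - 'X^(d - a)) * (1 - 'X^(d - b)) * geom r m
  = (1 - 'X^r) * (geom r a' * geom r b' * (1 - 'X^c) * J).
  apply: (mulfI (X1_neq0 r_gt0)).
  transitivity ((1 - 'X^(d - a)) * (1 - 'X^(d - b)) * (1 - 'X^(d - c)) : {poly int}).
    by rewrite mE geomE; ring.
  by rewrite JE aE bE !geomE; ring.
have /eqP := congr1 (ev z) E; rewrite !evM ev_geom ?(prim_expr_order zr) //.
have /eqP -> : ev z (1 - 'X^r) == 0 by rewrite (ev_1BX_eq0 _ zr).
rewrite mul0r !mulf_eq0 !(ev_1BX_eq0 _ zr) (negPf ra') (negPf rb') /= pnatr_eq0.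
by move=> /eqP m0; move: mE; rewrite m0 muln0; lia.
Qed.

End Jac.

Section Kappa.
Variables (a b c d M : nat) (N : {poly int}).
Hypotheses (a_gt0 : (0 < a)%N) (M_gt0 : (0 < M)%N) (a_lt_d : (a < d)%N)
  (b_lt_d : (b < d)%N) (c_lt_d : (c < d)%N).
Hypothesis NE : N * ((1 - 'X^a) * (1 - 'X^b) * (1 - 'X^c))
  = (1 - 'X^M) * ('X^(a + b + c) - 'X^d) * (1 - 'X^d).
Variable r : nat.
Hypothesis r_M : (r %| M)%N.
Let cofac n : (r %| n)%N -> exists m, n = (r * m)%N.
Proof. by case/dvdnP=> m ->; exists m; rewrite mulnC. Qed.

(** [kappa0] to [kappa3] distinguish how many of [a], [b], [c] are divisible by [r]. Common zeros at
    [z] are cancelled and each [geom] evaluates to an integer, so apart from [z ^ d] only data of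
    [r] remain. Here nothing is cancelled, and [1 - z ^ M] makes the value 0. *)
Lemma kappa0 : ~~ (r %| a)%N -> ~~ (r %| b)%N -> ~~ (r %| c)%N ->
  forall z, r.-primitive_root z -> ev z N = z ^+ d * 0.
Proof.
move=> ra rb rc z zr; rewrite mulr0; apply/eqP.
have /eqP := congr1 (ev z) NE; rewrite !evM.
have /eqP -> : ev z (1 - 'X^M) == 0 by rewrite (ev_1BX_eq0 _ zr).
by rewrite !mul0r !mulf_eq0 !(ev_1BX_eq0 _ zr) (negPf ra) (negPf rb) (negPf rc) !orbF.
Qed.

(** If [z ^ d = z ^ b], then [z ^ (b + c) - z ^ d = - z ^ b (1 - z ^ c)], and both [1 - z ^ b] and
    [1 - z ^ c] cancel against the denominator; likewise with [b] and [c] exchanged. If [z ^ d = 1],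
    the value is 0. *)
Lemma kappa1 : (r %| a)%N -> ~~ (r %| b)%N -> ~~ (r %| c)%N ->
  [|| (r %| d)%N, (r %| d - b)%N | (r %| d - c)%N] ->
  exists k, forall z, r.-primitive_root z -> ev z N = z ^+ d * k.
Proof.
move=> ra rb rc rd.
have [a' aE] := cofac ra; have [M' ME] := cofac r_M.
have r_gt0 : (0 < r)%N by case: (r) aE a_gt0 => // ->.
have a'0 : (a'%:R : algC) != 0 by rewrite pnatr_eq0; case: (a') aE a_gt0 => // ->; rewrite muln0.
have E z : r.-primitive_root z -> ev z N * (a'%:R * (1 - z ^+ b) * (1 - z ^+ c))
    = M'%:R * (z ^+ (b + c) - z ^+ d) * (1 - z ^+ d).
  move=> zr; have za : z ^+ a = 1 by apply/eqP; rewrite -(prim_order_dvd zr).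
  have : N * (geom r a' * (1 - 'X^b) * (1 - 'X^c)) = geom r M' * ('X^(a + b + c) - 'X^d) * (1 - 'X^d).
    apply: (mulfI (X1_neq0 r_gt0)); transitivity (N * ((1 - 'X^a) * (1 - 'X^b) * (1 - 'X^c))).
      by rewrite {1}aE geomE; ring.
    by rewrite NE ME geomE; ring.
  move=> /(congr1 (ev z)); rewrite !evM !ev_geom ?(prim_expr_order zr) //.
  by rewrite !evB ev1 !evXn -addnA exprD za mul1r.
have nz z n : r.-primitive_root z -> ~~ (r %| n)%N -> 1 - z ^+ n != 0.
  by move=> zr rn; rewrite subr_eq0 eq_sym -(prim_order_dvd zr).
have [rd0|rd0] := boolP (r %| d)%N.
  exists 0 => z zr; have zd : z ^+ d = 1 by apply/eqP; rewrite -(prim_order_dvd zr).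
  have := E z zr; rewrite zd subrr !mulr0 => /eqP; rewrite mulf_eq0 => /orP[/eqP//|].
  by rewrite !mulf_eq0 (negPf a'0) (negPf (nz z b zr rb)) (negPf (nz z c zr rc)).
exists (- (M'%:R / a'%:R)) => z zr.
have D0 : a'%:R * (1 - z ^+ b) * (1 - z ^+ c) != 0 by rewrite !mulf_neq0 ?nz.
apply: (mulIf D0); rewrite (E z zr).
have zd n : (n < d)%N -> (r %| d - n)%N -> z ^+ d = z ^+ n.
  move=> nd rn; rewrite -(subnKC (ltnW nd)) exprD.
  have /eqP -> : z ^+ (d - n) == 1 by rewrite -(prim_order_dvd zr).
  by rewrite mulr1.
rewrite (negPf rd0) /= in rd.
rewrite exprD; have [r1|r1] := orP rd.
  by rewrite (zd b) //; field.
by rewrite (zd c) //; field.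
Qed.

Lemma kappa2 : (0 < b)%N -> (r %| a)%N -> (r %| b)%N -> ~~ (r %| c)%N -> (r %| d)%N ->
  exists k, forall z, r.-primitive_root z -> ev z N = z ^+ d * k.
Proof.
move=> b_gt0 ra rb rc rd.
have [a' aE] := cofac ra; have [b' bE] := cofac rb; have [M' ME] := cofac r_M.
have [d' dE] := cofac rd.
have r_gt0 : (0 < r)%N by case: (r) aE a_gt0 => // ->.
have a'0 : (a'%:R : algC) != 0 by rewrite pnatr_eq0; case: (a') aE a_gt0 => // ->; rewrite muln0.
have b'0 : (b'%:R : algC) != 0 by rewrite pnatr_eq0; case: (b') bE b_gt0 => // ->; rewrite muln0.
exists (- (M'%:R * d'%:R / (a'%:R * b'%:R))) => z zr.
have zo n : (r %| n)%N -> z ^+ n = 1 by move=> rn; apply/eqP; rewrite -(prim_order_dvd zr).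
have : N * (geom r a' * geom r b' * (1 - 'X^c)) = geom r M' * ('X^(a + b + c) - 'X^d) * geom r d'.
  apply: (mulfI (X1_neq0 r_gt0)); apply: (mulfI (X1_neq0 r_gt0)).
  transitivity (N * ((1 - 'X^a) * (1 - 'X^b) * (1 - 'X^c))).
    by rewrite {1}aE {1}bE !geomE; ring.
  by rewrite NE {1}ME {2}dE !geomE; ring.
move=> /(congr1 (ev z)); rewrite !evM !ev_geom ?(prim_expr_order zr) //.
rewrite !evB ev1 !evXn !exprD !(zo a, zo b, zo d) // !mul1r => E.
have nc : 1 - z ^+ c != 0 by rewrite subr_eq0 eq_sym -(prim_order_dvd zr).
have D0 : a'%:R * b'%:R * (1 - z ^+ c) != 0 by rewrite !mulf_neq0.
by apply: (mulIf D0); rewrite E; field; rewrite a'0 b'0.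
Qed.

Lemma kappa3 : (0 < b)%N -> (0 < c)%N -> (r %| a)%N -> (r %| b)%N -> (r %| c)%N -> (r %| d)%N ->
  exists k, forall z, r.-primitive_root z -> ev z N = z ^+ d * k.
Proof.
move=> b_gt0 c_gt0 ra rb rc rd.
have [a' aE] := cofac ra; have [b' bE] := cofac rb; have [M' ME] := cofac r_M.
have [d' dE] := cofac rd; have [c' cE] := cofac rc.
have r_gt0 : (0 < r)%N by case: (r) aE a_gt0 => // ->.
have a'0 : (a'%:R : algC) != 0 by rewrite pnatr_eq0; case: (a') aE a_gt0 => // ->; rewrite muln0.
have b'0 : (b'%:R : algC) != 0 by rewrite pnatr_eq0; case: (b') bE b_gt0 => // ->; rewrite muln0.
have c'0 : (c'%:R : algC) != 0 by rewrite pnatr_eq0; case: (c') cE c_gt0 => // ->; rewrite muln0.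
exists (M'%:R * (d'%:R - (a' + b' + c')%:R) * d'%:R / (a'%:R * b'%:R * c'%:R)) => z zr.
have zo n : (r %| n)%N -> z ^+ n = 1 by move=> rn; apply/eqP; rewrite -(prim_order_dvd zr).
have : N * (geom r a' * geom r b' * geom r c') =
   geom r M' * (geom r d' - geom r (a' + b' + c')) * geom r d'.
  apply: (mulfI (X1_neq0 r_gt0)); apply: (mulfI (X1_neq0 r_gt0)); apply: (mulfI (X1_neq0 r_gt0)).
  transitivity (N * ((1 - 'X^a) * (1 - 'X^b) * (1 - 'X^c))).
    by rewrite aE bE cE !geomE; ring.
  have sE : ('X^(a + b + c) - 'X^d : {poly int}) = (1 - 'X^r) * (geom r d' - geom r (a' + b' + c')).
    by rewrite mulrBr -!geomE !mulnDr -aE -bE -cE -dE; ring.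
  by rewrite NE sE ME dE !geomE; ring.
move=> /(congr1 (ev z)); rewrite !evM !evB !ev_geom ?(prim_expr_order zr) // => E.
have D0 : a'%:R * b'%:R * c'%:R != 0 :> algC by rewrite !mulf_neq0.
by apply: (mulIf D0); rewrite E (zo d) //; field; rewrite a'0 b'0 c'0.
Qed.

End Kappa.
End RootsOfUnity.

(** Binomials are all expanded over the divisors of one [M], so that divisibility becomes a
    comparison of exponents. *)
Lemma Xn_sub1_Cyclotomic (M n : nat) : (0 < M)%N -> (n %| M)%N ->
  'X^n - 1 = \prod_(r <- divisors M) 'Phi_r ^+ (r %| n)%N :> {poly int}.
Proof.
move=> M0 nM; have n0 : (0 < n)%N by apply: dvdn_gt0 nM.
rewrite -prod_Cyclotomic // [RHS](eq_bigr (fun r => if (r %| n)%N then 'Phi_r else 1)); last first.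
  by move=> r _; case: (r %| n)%N; rewrite ?expr1 ?expr0.
rewrite -big_mkcond -[RHS]big_filter; apply/perm_big/uniq_perm.
- exact: divisors_uniq.
- exact/filter_uniq/divisors_uniq.
move=> r; rewrite mem_filter -!dvdn_divisors //; case: (boolP (r %| n)%N) => // rn.
by rewrite (dvdn_trans rn).
Qed.

(** * The periodic numerator and its invariance under p-th powers *)

Section Invariance.
Variables (a b c d : nat) (J : {poly int}).
Hypotheses (a_gt0 : (0 < a)%N) (b_gt0 : (0 < b)%N) (c_gt0 : (0 < c)%N).
Hypotheses (a_lt_d : (a < d)%N) (b_lt_d : (b < d)%N) (c_lt_d : (c < d)%N).
Hypothesis JE : (1 - 'X^(d - a)) * (1 - 'X^(d - b)) * (1 - 'X^(d - c))
  = (1 - 'X^a) * (1 - 'X^b) * (1 - 'X^c) * J.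

Let sg := (a + b + c)%N.
(** This is [|sg - d|], written with truncated subtractions. When [sg = d] the numerator is zero,
    and the value 1 keeps the period positive. *)
Let s := if sg == d then 1%N else ((sg - d) + (d - sg))%N.
(** A common multiple of all exponents in the fraction: every cyclotomic factor that occurs has an
    index dividing it. *)
Definition period : nat := (a * b * c * d * s)%N.
Local Notation M := period.

Let s_gt0 : (0 < s)%N.
Proof. by rewrite /s; case: eqP => // ne; lia. Qed.

Lemma period_gt0 : (0 < M)%N.
Proof. by rewrite /M !muln_gt0 a_gt0 b_gt0 c_gt0 s_gt0 (leq_ltn_trans _ a_lt_d). Qed.

Let M_s : (s %| M)%N. Proof. by rewrite /M dvdn_mull. Qed.
Let M_d : (d %| M)%N. Proof. by rewrite /M dvdn_mulr // dvdn_mull. Qed.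
Let M_c : (c %| M)%N. Proof. by rewrite /M dvdn_mulr // dvdn_mulr // dvdn_mull. Qed.
Let M_b : (b %| M)%N. Proof. by rewrite /M -!mulnA dvdn_mull // dvdn_mulr. Qed.
Let M_a : (a %| M)%N. Proof. by rewrite /M -!mulnA dvdn_mulr. Qed.

Let JE2 : (1 - 'X^(d - b)) * (1 - 'X^(d - c)) * (1 - 'X^(d - a))
  = (1 - 'X^b) * (1 - 'X^c) * (1 - 'X^a) * J.
Proof. by rewrite mulrC mulrA JE; ring. Qed.
Let JE3 : (1 - 'X^(d - c)) * (1 - 'X^(d - a)) * (1 - 'X^(d - b))
  = (1 - 'X^c) * (1 - 'X^a) * (1 - 'X^b) * J.
Proof. by rewrite mulrC mulrA JE2; ring. Qed.

(* This bounds the multiplicity of a primitive r-th root of unity in the denominator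
   by its multiplicity in the numerator. *)
Lemma multiplicity_le r : (0 < r)%N -> sg != d ->
  ((r %| a) + (r %| b) + (r %| c) <= 1 + (r %| s) + (r %| d))%N.
Proof.
move=> r0 sgd; have [z zr] := C_prim_root_exists r0.
have H1 := jac_one JE zr; have H2 := jac_one JE2 zr; have H3 := jac_one JE3 zr.
have K1 := jac_two c_lt_d JE zr; have K2 := jac_two a_lt_d JE2 zr.
have K3 := jac_two b_lt_d JE3 zr.
have [ra|ra] := boolP (r %| a)%N; have [rb|rb] := boolP (r %| b)%N;
  have [rc|rc] := boolP (r %| c)%N; rewrite //= ?addn0 ?add0n ?leq_addr // -?addnA ?leq_addr //.
- have rd : (r %| d)%N.
    by have := H1 ra; rewrite !dvdn_subl ?orbb // ltnW.
  have rs : (r %| s)%N by rewrite /s (negPf sgd) dvdn_add // dvdn_sub // !dvdn_add.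
  by rewrite rd rs.
- by rewrite K1 //; case: (r %| s)%N.
- by rewrite K3 //; case: (r %| s)%N.
- by rewrite K2 //; case: (r %| s)%N.
Qed.

(** Up to sign and a power of [X], the right side is a product of [1 - X ^ M], [1 - X ^ s] and
    [1 - X ^ d]. By [multiplicity_le] each cyclotomic factor occurs there at least as often as in
    the denominator, so the truncated difference [m r] is a true one. *)
Lemma numerator_exists : exists N : {poly int},
  N * ((1 - 'X^a) * (1 - 'X^b) * (1 - 'X^c)) = (1 - 'X^M) * ('X^sg - 'X^d) * (1 - 'X^d).
Proof.
have [sgd|sgd] := eqVneq sg d; first by exists 0; rewrite sgd subrr mulr0 !mul0r.
pose m r := (1 + (r %| s) + (r %| d) - ((r %| a) + (r %| b) + (r %| c)))%N.
have E n : (n %| M)%N -> 1 - 'X^n = - \prod_(r <- divisors M) 'Phi_r ^+ (r %| n)%N :> {poly int}.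
  by move=> nM; rewrite -opprB (Xn_sub1_Cyclotomic period_gt0 nM).
have [e eE] : exists e : {poly int}, 'X^sg - 'X^d = e * (1 - 'X^s).
  rewrite /s (negPf sgd); have [le_sd|lt_ds] := leqP d sg.
    exists (- 'X^d); rewrite mulNr mulrBr mulr1 opprB -exprD; congr ('X^_ - _).
    by lia.
  exists 'X^sg; rewrite mulrBr mulr1 -exprD; congr (_ - 'X^_).
  by lia.
exists (e * \prod_(r <- divisors M) 'Phi_r ^+ m r).
transitivity (- (e * \prod_(r <- divisors M) 'Phi_r ^+ (1 + (r %| s) + (r %| d)))).
  rewrite (E a) // (E b) // (E c) // mulrNN mulrN mulrN -!mulrA; congr (- (e * _)).
  rewrite -!big_split /=; apply: eq_big_seq => r; rewrite -dvdn_divisors ?period_gt0 // => rM.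
  rewrite -!exprD; congr ('Phi_r ^+ _); rewrite /m.
  have : (0 < r)%N by apply: dvdn_gt0 rM; apply: period_gt0.
  move=> /multiplicity_le/(_ sgd) le.
  by rewrite [X in (_ + X)%N]addnA subnK.
rewrite eE (E M) ?dvdnn // (E s) // (E d) //.
set pM := \prod_(r <- _) 'Phi_r ^+ (r %| M)%N; set ps := \prod_(r <- _) 'Phi_r ^+ (r %| s)%N.
set pd := \prod_(r <- _) 'Phi_r ^+ (r %| d)%N.
have -> : - pM * (e * - ps) * - pd = - (e * (pM * ps * pd)) by ring.
congr (- (e * _)); rewrite /pM /ps /pd.
rewrite -!big_split /=; apply: eq_big_seq => r; rewrite -dvdn_divisors ?period_gt0 // => rM.
by rewrite -!exprD rM.
Qed.

Section Kappa.
Variable N : {poly int}.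
Hypothesis NE : N * ((1 - 'X^a) * (1 - 'X^b) * (1 - 'X^c)) =
  (1 - 'X^M) * ('X^sg - 'X^d) * (1 - 'X^d).

Lemma kappa_exists r : (r %| M)%N ->
  exists k, forall z, r.-primitive_root z -> ev z N = z ^+ d * k.
Proof.
move=> rM; have r0 : (0 < r)%N by apply: dvdn_gt0 rM; apply: period_gt0.
have [z zr] := C_prim_root_exists r0.
have H1 := jac_one JE zr; have H2 := jac_one JE2 zr; have H3 := jac_one JE3 zr.
have K1 := jac_two c_lt_d JE zr; have K2 := jac_two a_lt_d JE2 zr.
have K3 := jac_two b_lt_d JE3 zr.
have NE2 : N * ((1 - 'X^b) * (1 - 'X^c) * (1 - 'X^a)) =
    (1 - 'X^M) * ('X^(b + c + a) - 'X^d) * (1 - 'X^d).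
  by rewrite (_ : (b + c + a = sg)%N) -?NE; [ring | rewrite /sg; lia].
have NE3 : N * ((1 - 'X^c) * (1 - 'X^a) * (1 - 'X^b)) =
    (1 - 'X^M) * ('X^(c + a + b) - 'X^d) * (1 - 'X^d).
  by rewrite (_ : (c + a + b = sg)%N) -?NE; [ring | rewrite /sg; lia].
have rw x y : (r %| x)%N -> (x < d)%N -> (r %| d - x)%N = (r %| d)%N.
  by move=> rx xd; rewrite dvdn_subl // ltnW.
have [ra|ra] := boolP (r %| a)%N; have [rb|rb] := boolP (r %| b)%N;
  have [rc|rc] := boolP (r %| c)%N.
- apply: (kappa3 _ NE rM) => //.
  by have := H1 ra; rewrite !dvdn_subl ?orbb // ltnW.
- by apply: (kappa2 _ NE rM) => //; apply: K1.
- by apply: (kappa2 _ NE3 rM) => //; apply: K3.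
- apply: (kappa1 _ _ _ NE rM) => //.
  by have := H1 ra; rewrite (dvdn_subl (ltnW a_lt_d) ra).
- by apply: (kappa2 _ NE2 rM) => //; apply: K2.
- apply: (kappa1 _ _ _ NE2 rM) => //.
  by have := H2 rb; rewrite (dvdn_subl (ltnW b_lt_d) rb).
- apply: (kappa1 _ _ _ NE3 rM) => //.
  by have := H3 rc; rewrite (dvdn_subl (ltnW c_lt_d) rc).
- exists 0; exact: (kappa0 NE rM ra rb rc).
Qed.

(** As [p] is prime to the order of [z], [z ^ p] has the same order and shares the constant given by
    [kappa_exists]. *)
Lemma numerator_pth_power p z : prime p -> ~~ (p %| M)%N -> z ^+ M = 1 ->
  ev (z ^+ p) N * z ^+ d = ev z N * z ^+ (p * d).
Proof.
move=> pr pM zM; have [r zr rM] := prim_order_exists period_gt0 zM.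
have [k kE] := kappa_exists rM.
have zpr : r.-primitive_root (z ^+ p).
  rewrite (prim_root_exp_coprime _ zr) coprime_sym -?prime_coprime //.
  rewrite coprime_sym prime_coprime //; apply: contra pM => pr'.
  exact: dvdn_trans rM.
by rewrite (kE _ zr) (kE _ zpr) -exprM; ring.
Qed.

End Kappa.
End Invariance.

(** * Periodic sequences and the discrete Fourier transform *)

Section PeriodicSums.
Variable M : nat.
Hypothesis M_gt0 : (0 < M)%N.

Lemma periodic_mod (T : Type) (F : nat -> T) : (forall x, F (x + M)%N = F x) ->
  forall x, F (x %% M)%N = F x.
Proof.
move=> FM x; rewrite {2}(divn_eq x M); elim: (x %/ M)%N => [|k IHk]; first by rewrite mul0n.
by rewrite mulSn -addnA addnC FM.
Qed.

Lemma periodic_sum_reindex (T : nmodType) (F : nat -> T) (h : nat -> nat) :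
  (forall x, F (x + M)%N = F x) ->
  (forall x y, (x < M)%N -> (y < M)%N -> h x = h y %[mod M] -> x = y) ->
  \sum_(x < M) F (h x) = \sum_(x < M) F x.
Proof.
move=> FM hinj; pose g (x : 'I_M) := Ordinal (ltn_pmod (h x) M_gt0).
have ginj : injective g.
  by move=> x y /(congr1 val) /= /hinj E; apply/val_inj/E.
rewrite [RHS](reindex_inj ginj); apply: eq_bigr => x _ /=.
by rewrite periodic_mod.
Qed.

Lemma fourier_inj (u v : nat -> algC) (z : algC) : M.-primitive_root z ->
  (forall i, \sum_(x < M) u x * (z ^+ i) ^+ x = \sum_(x < M) v x * (z ^+ i) ^+ x) ->
  forall x, (x < M)%N -> u x = v x.
Proof.
move=> zM E x ltx; pose q : {poly algC} := \poly_(x < M) (u x - v x).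
have q0 : q = 0.
  apply: (@roots_geq_poly_eq0 _ q [seq z ^+ i | i <- iota 0 M]).
  - apply/allP => _ /mapP[i _ ->]; rewrite /root /q horner_poly.
    apply/eqP; rewrite (eq_bigr (fun x : 'I_M => u x * (z ^+ i) ^+ x - v x * (z ^+ i) ^+ x)).
      by rewrite sumrB E subrr.
    by move=> y _; rewrite mulrBl.
  - rewrite map_inj_in_uniq ?iota_uniq // => i j; rewrite !mem_iota !add0n /= => lti ltj.
    by move=> /eqP; rewrite (eq_prim_root_expr zM) !modn_small // => /eqP.
  - by rewrite size_map size_iota; apply: size_poly.
by have := congr1 (fun q : {poly algC} => q`_x) q0; rewrite coef_poly ltx coef0 => /subr0_eq.
Qed.

End PeriodicSums.

(** * The quasi-polynomial of monomial counts and its comparison at p j and j *)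

Section RiemannRoch.
Variables (w : 'I_3 -> nat) (d : nat).
Hypothesis w_gt0 : forall i, (0 < w i)%N.
Hypothesis w_lt_d : forall i, (w i < d)%N.
Local Notation sg := (sgw w).
Hypothesis milnor0 : exists n0 : int, forall n, n0 <= n -> let l := n + sg - d%:Z in
  (e2 w l + pcount w (l - d%:Z - d%:Z) = pcount w n + e1 w (l - d%:Z))%N.

Let P (n : int) : int := pcount w n.
Local Notation a := (w ix).
Local Notation b := (w iy).
Local Notation c := (w iz).
Local Notation B := (wpoly w).
Local Notation M := (period a b c d).

Let s := (a + b + c)%N.
Let sgE : sg = s%:Z. Proof. by rewrite /s !PoszD. Qed.

(** The expansions of [1 / B] at 0 and at infinity have coefficients [P n] and [- P (- n - sg)].
    Their difference [rho] is killed by [B]: it is the quasi-polynomial that agrees with [P] for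
    [n > - sg]. *)
Let rho (n : int) : int := P n + P (- n - sg).

Let act_rho n : act B rho n = 0.
Proof.
have H : act B P n = delta n by apply: act_wpoly.
have H' : act B P (- n) = delta (- n) by apply: act_wpoly.
rewrite act3 in H; rewrite act3 in H'.
have dE : delta (- n) = delta n by rewrite /delta oppr_eq0.
rewrite dE -H in H'; rewrite act3 /rho.
have E0 : - n - sg = - n - a%:Z - b%:Z - c%:Z by rewrite /sgw; ring.
have E1 : - (n - a%:Z) - sg = - n - b%:Z - c%:Z by rewrite /sgw; ring.
have E2 : - (n - b%:Z) - sg = - n - a%:Z - c%:Z by rewrite /sgw; ring.
have E3 : - (n - c%:Z) - sg = - n - a%:Z - b%:Z by rewrite /sgw; ring.
have E4 : - (n - a%:Z - b%:Z) - sg = - n - c%:Z by rewrite /sgw; ring.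
have E5 : - (n - a%:Z - c%:Z) - sg = - n - b%:Z by rewrite /sgw; ring.
have E6 : - (n - b%:Z - c%:Z) - sg = - n - a%:Z by rewrite /sgw; ring.
have E7 : - (n - a%:Z - b%:Z - c%:Z) - sg = - n by rewrite /sgw; ring.
rewrite E0 E1 E2 E3 E4 E5 E6 E7; clear -H'; move: H'.
move: (P n) (P (n - a%:Z)) (P (n - b%:Z)) (P (n - c%:Z)) (P (n - a%:Z - b%:Z))
  (P (n - a%:Z - c%:Z)) (P (n - b%:Z - c%:Z)) (P (n - a%:Z - b%:Z - c%:Z)).
move: (P (- n)) (P (- n - a%:Z)) (P (- n - b%:Z)) (P (- n - c%:Z)) (P (- n - a%:Z - b%:Z))
  (P (- n - a%:Z - c%:Z)) (P (- n - b%:Z - c%:Z)) (P (- n - a%:Z - b%:Z - c%:Z)).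
by clear; move=> *; lia.
Qed.

(** By [NE], [(1 - X ^ M) T = N B], which makes [T rho] periodic. The shifts in [T] are chosen so
    that, for [l > d], the value of [psi] at [l + d] is the part of the dimension formula that
    depends on [l]. *)
Let T : {poly int} := ('X^s - 'X^d) * (1 - 'X^d).

Let actT f n : act T f n = f (n - s%:Z) - f (n - d%:Z) - f (n - s%:Z - d%:Z) + f (n - d%:Z - d%:Z).
Proof.
rewrite /T mulrC actM act1BXn !actB !actXn.
by rewrite [n - d%:Z - s%:Z]addrAC; ring.
Qed.

Let psi := act T rho.
Let theta := act T P.

Section Numerator.
Variables J N : {poly int}.
Hypothesis JE : jacpoly w d = B * J.
Hypothesis NE : N * B = (1 - 'X^M) * ('X^s - 'X^d) * (1 - 'X^d).

Let M_gt0 : (0 < M)%N.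
Proof. by apply: (@period_gt0 a b c d). Qed.

Let psi_period n : psi (n - M%:Z) = psi n.
Proof.
apply/esym/subr0_eq; rewrite -act1BXn -actM /T mulrA -NE actM.
by rewrite (act_eq N act_rho) /act big1 // => i _; rewrite mulr0.
Qed.

Let theta_step n : theta n = theta (n - M%:Z) + cseq N n.
Proof.
apply/eqP; rewrite addrC -subr_eq; apply/eqP; rewrite -act1BXn -actM /T mulrA -NE actM.
by rewrite (act_eq N (act_wpoly w_gt0)) act_delta.
Qed.

Let theta_neg n : n < 0 -> theta n = 0.
Proof. by move=> n0; rewrite /theta actT /P !pcount_neg ?subr0 ?addr0 //; lia. Qed.

Let psi_theta n : (d + d)%N%:Z < n -> psi n = theta n.
Proof.
move=> ltn; rewrite /psi /theta !actT /rho.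
have Z x : x <= d%:Z + d%:Z -> P (- (n - x) - sg) = 0.
  by move=> le_x; rewrite /P pcount_neg // sgE; lia.
have Z' x : x <= d%:Z + d%:Z -> P (- (n - s%:Z - x) - sg) = 0.
  by move=> le_x; rewrite /P pcount_neg // sgE; lia.
have -> : n - d%:Z - d%:Z = n - (d%:Z + d%:Z) by rewrite opprD addrA.
have := Z' 0; rewrite subr0 => ->; last by lia.
rewrite Z ?Z' ?(Z (d%:Z + d%:Z)) ?addr0 //; lia.
Qed.

Let psi_nat (x k : nat) : psi (x + k * M)%N%:Z = psi x%:Z.
Proof.
elim: k => [|k IHk]; first by rewrite addn0.
by rewrite -IHk -[LHS]psi_period; congr psi; rewrite mulSn !PoszD; ring.
Qed.

(** Since [theta n - theta (n - M) = N_n], the values of [theta] far out are sums of the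
    coefficients of [N] over residue classes modulo [M], and there [theta] coincides with [psi]. The
    number [K] of periods is large enough both to exhaust [N] and to pass [2 d]. *)
Let psi_fourier z : z ^+ M = 1 -> \sum_(x < M) (psi x%:Z)%:~R * z ^+ x = ev z N.
Proof.
move=> zM; pose K := (size N + (d + d).+1)%N.
have HK k : \sum_(x < M) (theta (x + k * M)%N%:Z)%:~R * z ^+ x
    = \sum_(i < k * M + M) (N`_i)%:~R * z ^+ i :> algC.
  elim: k => [|k IHk].
    rewrite mul0n add0n; apply: eq_bigr => x _; rewrite addn0 theta_step theta_neg ?add0r //.
    by rewrite subr_lt0 ltz_nat.
  rewrite big_split_ord.
  have -> : \sum_(i < k.+1 * M) (N`_(lshift M i))%:~R * z ^+ lshift M i
     = \sum_(x < M) (theta (x + k * M)%N%:Z)%:~R * z ^+ x by rewrite IHk [in LHS]mulSnr.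
  rewrite /= -big_split /=; apply: eq_bigr => x _ /=.
  rewrite theta_step rmorphD mulrDl; congr (_ * _ + _).
    by congr (theta _)%:~R; rewrite mulSnr !PoszD; ring.
  by rewrite exprD mulnC [in RHS]exprM zM expr1n mul1r addnC.
have -> : ev z N = \sum_(i < K * M + M) (N`_i)%:~R * z ^+ i.
  rewrite /ev (@horner_coef_wide _ (K * M + M)).
    by apply: eq_bigr => i _; rewrite coef_map.
  apply: leq_trans (size_poly _ _) _; apply: (@leq_trans K); first exact: leq_addr.
  by apply: leq_trans (leq_addr _ _); apply: leq_pmulr.
rewrite -HK; apply: eq_bigr => x _; rewrite -(psi_nat x K) psi_theta //.
rewrite ltz_nat; apply: (@leq_trans K); first by rewrite /K; lia.
by apply: leq_trans (leq_addl _ _); apply: leq_pmulr.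
Qed.

(** The transform of [u x = psi (x + d)] at [y] is [N(y) / y ^ d]. Reindexing by [x -> p x] turns
    the transform of [u (p x)] at [z ^ p] into that of [u] at [z], and [numerator_pth_power]
    identifies this with the transform of [u] at [z ^ p]. *)
Lemma psi_invariant p (x : nat) : prime p -> ~~ (p %| M)%N ->
  psi (p * x + d)%N%:Z = psi (x + d)%N%:Z.
Proof.
move=> pr pM; have [om omM] := C_prim_root_exists M_gt0.
have cop : coprime p M by rewrite prime_coprime.
have omp : M.-primitive_root (om ^+ p) by rewrite (prim_root_exp_coprime _ omM).
have psiM y : psi (y + M)%N%:Z = psi y%:Z by have := psi_nat y 1; rewrite mul1n.
pose u (y : nat) : algC := (psi (y + d)%N%:Z)%:~R.
have uM y : u (y + M)%N = u y by rewrite /u addnAC psiM.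
pose v y := u (p * y)%N.
have vM y : v (y + M)%N = v y.
  rewrite /v mulnDr; move: {2}p => k; elim: k => [|k IHk]; first by rewrite mul0n addn0.
  by rewrite mulSnr addnA uM.
suff uv y : (y < M)%N -> v y = u y.
  have := uv (x %% M)%N (ltn_pmod _ M_gt0); rewrite !periodic_mod // /v /u => /eqP.
  by rewrite eqr_int => /eqP.
(* The root [om ^ p] is still primitive, and with it every evaluation point is a [p]-th power. *)
move: y; apply: (fourier_inj omp) => i; pose z := om ^+ i.
have zM : z ^+ M = 1 by rewrite /z exprAC (prim_expr_order omM) expr1n.
have z0 : z != 0 by apply: contra_eq_neq zM => ->; rewrite expr0n gtn_eqF //= eq_sym oner_eq0.
have -> : (om ^+ p) ^+ i = z ^+ p by rewrite /z -!exprM mulnC.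
have S y : y ^+ M = 1 -> y ^+ d * \sum_(x < M) u x * y ^+ x = ev y N.
  move=> yM; rewrite -psi_fourier // mulr_sumr.
  rewrite -(@periodic_sum_reindex M M_gt0 _ (fun x => (psi x%:Z)%:~R * y ^+ x) (fun x => (x + d)%N)).
  - by apply: eq_bigr => k _; rewrite /u exprD; ring.
  - by move=> k; rewrite psiM exprD yM mulr1.
  - by move=> k l lk ll /eqP; rewrite eqn_modDr !modn_small // => /eqP.
have E1 : \sum_(x < M) v x * (z ^+ p) ^+ x = \sum_(x < M) u x * z ^+ x.
  rewrite -(@periodic_sum_reindex M M_gt0 _ (fun x => u x * z ^+ x) (fun x => (p * x)%N)).
  - by apply: eq_bigr => k _; rewrite exprM.
  - by move=> k; rewrite uM exprD zM mulr1.
  - move=> k l; wlog lekl : k l / (k <= l)%N.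
      by case: (leqP k l) => [?|/ltnW ?] W lk ll E; [apply: W | apply/esym/W].
    move=> lk ll /esym/eqP; rewrite eqn_mod_dvd ?leq_mul2l ?lekl ?orbT // -mulnBr.
    rewrite Gauss_dvdr 1?coprime_sym // -eqn_mod_dvd // !modn_small // => /eqP->.
    by [].
rewrite E1; apply: (mulfI (expf_neq0 d (expf_neq0 p z0))).
apply: (mulfI (expf_neq0 d z0)); rewrite [z ^+ d * (_ * _)]mulrC.
rewrite [RHS]mulrC S; last by rewrite exprAC zM expr1n.
rewrite -mulrA [_ * z ^+ d]mulrC S // (numerator_pth_power _ _ _ _ _ _ JE NE) // exprM mulrC.
by [].
Qed.

End Numerator.

(* With [al m = P m - P (m - d)] and [s = sg - d], the claim is that
   [al (l - s) - al l + al (- l - s)] takes the same value at [p j] and at [j]. As a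
   function of [l] this is periodic, with period prime to [p], and its discrete Fourier
   transform at [zeta] is, up to a power of [zeta], a number depending only on the
   order of [zeta]. *)
Theorem riemann_roch : exists p0 : nat, forall p : nat, prime p -> (p0 <= p)%N ->
  forall j : int, 0 < j -> let l := p%:Z * j in
  P (l - sg + d%:Z) - P (l - sg) - P l + P (l - d%:Z) + P j - P (j - d%:Z) =
  P (j - sg + d%:Z) - P (j - sg) + P (- j - sg + d%:Z) - P (- j - sg).
Proof.
have [J JE] := jacpoly_dvd w_gt0 w_lt_d milnor0.
have [|||||||N NE] := @numerator_exists a b c d J => //.
(* [p > M] keeps [p] from dividing the period; [p > d] gives [l > d], so that the reflected terms at
   [l] vanish. *)
exists (M + d + d).+1 => p pr ltp [j|//] j0 l.
have pM : ~~ (p %| M)%N.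
  by rewrite gtnNdvd //; [apply: period_gt0 | lia].
have V x : 0 < x -> psi (x + d%:Z) =
    P (x - sg + d%:Z) - P x - P (- x - sg) - P (x - sg) + P (x - d%:Z) + P (- x - sg + d%:Z).
  move=> x0; rewrite /psi actT /rho -sgE.
  have -> : - (x + d%:Z - sg) - sg = - x - d%:Z by ring.
  have -> : x + d%:Z - d%:Z = x by ring.
  have -> : x + d%:Z - sg - d%:Z = x - sg by ring.
  have -> : - (x - sg) - sg = - x by ring.
  have -> : - (x - d%:Z) - sg = - x - sg + d%:Z by ring.
  have -> : x + d%:Z - sg = x - sg + d%:Z by ring.
  have -> : P (- x - d%:Z) = 0 by rewrite /P pcount_neg //; clear -x0; lia.
  have -> : P (- x) = 0 by rewrite /P pcount_neg //; clear -x0; lia.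
  by ring.
have l0 : 0 < l by rewrite /l mulr_gt0 // ltz_nat prime_gt0.
have : psi (l + d%:Z) = psi (j%:Z + d%:Z).
  by have := psi_invariant JE NE j pr pM; rewrite !PoszD PoszM.
rewrite (V l l0) (V j%:Z j0).
have l_ge : d%:Z < l.
  rewrite /l -PoszM ltz_nat; apply: leq_trans (leq_pmulr _ j0).
  by apply: leq_ltn_trans ltp; apply: leq_addl.
have sg_ge : 0 <= sg by rewrite sgE.
have -> : P (- l - sg) = 0 by rewrite /P pcount_neg //; clear -l_ge sg_ge; lia.
have -> : P (- l - sg + d%:Z) = 0 by rewrite /P pcount_neg //; clear -l_ge sg_ge; lia.
move: (P (l - sg + d%:Z)) (P (l - sg)) (P l) (P (l - d%:Z)) (P (- j%:Z - sg)) (P (- j%:Z - sg + d%:Z)).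
move: (P (j%:Z - sg + d%:Z)) (P (j%:Z - sg)) (P j%:Z) (P (j%:Z - d%:Z)).
by clear; move=> *; lia.
Qed.

End RiemannRoch.

(** * Laurent expansions of rational functions *)

Local Open Scope quotient_scope.
Local Notation "x %:F" := (FracField.tofrac x).
Local Notation ev_frac psi q := ((map_poly rf_const q).[psi]).

HB.instance Definition _ := GRing.RMorphism.copy rf_const
  (@FracField.tofrac {poly rat} \o polyC).

Section Expansion.
Implicit Types (phi psi : ratfun) (L : int -> rat) (p q N D : {poly rat}).

Lemma frac_numden phi : phi = (\n_(repr phi))%:F / (\d_(repr phi))%:F.
Proof.
have d0 : (\d_(repr phi))%:F != 0 :> ratfun by rewrite tofrac_eq0 denom_ratioP.
apply: (mulIf d0); rewrite divfK //.
set x := repr phi; rewrite -[phi]reprK -/x; unlock FracField.tofrac.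
rewrite -[LHS]FracField.pi_mul; apply/eqmodP.
rewrite /= FracField.equivfE /FracField.mulf /= !numden_Ratio ?mulr1 ?oner_neq0 ?denom_ratioP //.
by rewrite mulrC.
Qed.

(* [L] is the Laurent expansion of [phi] at 0 *)
Definition expansion phi L := exists N D, [/\ D != 0, phi = N%:F / D%:F,
  exists n0, forall n, n < n0 -> L n = 0 & forall n, act D L n = cseq N n].

(** [laurent] is read off the chosen representative of a fraction, whereas series are computed from
    any convenient [N / D]; this makes the two agree, the lower bounds on the supports being
    essential. *)
Lemma expansion_uniq phi L L' : expansion phi L -> expansion phi L' -> L =1 L'.
Proof.
move=> [N [D [D0 phiE [n0 Ln0] LE]]] [N' [D' [D'0 phiE' [n1 Ln1] LE']]] n.
have DD : D * D' != 0 by rewrite mulf_neq0.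
have NE : N * D' = N' * D.
  apply/eqP; rewrite -tofrac_eq !rmorphM /=; apply/eqP.
  have := phiE; rewrite phiE' => /eqP.
  by rewrite eqr_div ?tofrac_eq0 // => /eqP ->; rewrite mulrC.
suff H : forall n, (fun k => L k - L' k) n = 0 by apply/subr0_eq/H.
apply: (act_cancel DD).
  by exists (Num.min n0 n1) => k; rewrite lt_min => /andP[/Ln0-> /Ln1->]; rewrite subrr.
move=> k.
have E1 : act (D * D') L k = cseq (N * D') k.
  by rewrite [D * D']mulrC actM (act_eq D' LE) act_cseq [D' * N]mulrC.
have E2 : act (D * D') L' k = cseq (N' * D) k.
  by rewrite actM (act_eq D LE') act_cseq [D * N']mulrC.
transitivity (act (D * D') L k - act (D * D') L' k); last by rewrite E1 E2 NE subrr.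
by rewrite /act -sumrB; apply: eq_bigr => i _; rewrite mulrBr.
Qed.

Lemma expansion_ext phi L L' : L =1 L' -> expansion phi L -> expansion phi L'.
Proof.
move=> LL' [N [D [D0 phiE [n0 Ln0] LE]]]; exists N, D; split=> //.
  by exists n0 => n /Ln0; rewrite LL'.
by move=> n; rewrite -(act_eq D LL').
Qed.

Lemma expansion_laurent phi : expansion phi (laurent phi).
Proof.
exists (\n_(repr phi)), (\d_(repr phi)); split.
- exact: denom_ratioP.
- exact: frac_numden.
- exists (- (den_ord phi)%:Z) => n; rewrite /laurent -subr_lt0 opprK.
  by case: (n + _).
- by move=> n; rewrite /act laurentP.
Qed.

Lemma laurentE phi L : expansion phi L -> laurent phi =1 L.
Proof. by move=> H; apply: expansion_uniq H; apply: expansion_laurent. Qed.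

Lemma act_addf p L L' n : act p (fun k => L k + L' k) n = act p L n + act p L' n.
Proof. by rewrite /act -big_split; apply: eq_bigr => i _; rewrite mulrDr. Qed.

Lemma cseqD p q n : cseq (p + q) n = cseq p n + cseq q n.
Proof. by case: n => n /=; rewrite ?addr0 ?coefD. Qed.

Lemma expansionD phi psi L L' : expansion phi L -> expansion psi L' ->
  expansion (phi + psi) (fun n => L n + L' n).
Proof.
move=> [N [D [D0 phiE [n0 Ln0] LE]]] [N' [D' [D'0 phiE' [n1 Ln1] LE']]].
exists (N * D' + N' * D), (D * D'); split; first by rewrite mulf_neq0.
- by rewrite phiE phiE' addf_div ?tofrac_eq0 // !rmorphD !rmorphM.
- by exists (Num.min n0 n1) => k; rewrite lt_min => /andP[/Ln0-> /Ln1->]; rewrite addr0.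
move=> n; rewrite act_addf cseqD; congr (_ + _).
  by rewrite [D * D']mulrC actM (act_eq D' LE) act_cseq [D' * N]mulrC.
by rewrite actM (act_eq D LE') act_cseq [D * N']mulrC.
Qed.

Lemma expansion_poly p : expansion p%:F (cseq p).
Proof.
exists p, 1; split; rewrite ?oner_neq0 //; first by rewrite rmorph1 divr1.
  by exists 0; case.
by move=> n; rewrite -polyC1 actC mul1r.
Qed.

Lemma act_lbound p L n0 : (forall n, n < n0 -> L n = 0) -> forall n, n < n0 -> act p L n = 0.
Proof.
move=> L0 n lt_n; rewrite /act big1 // => i _; rewrite L0 ?mulr0 //.
by apply: le_lt_trans lt_n; rewrite lerBlDr lerDl.
Qed.

Lemma expansionM p phi L : expansion phi L -> expansion (p%:F * phi) (act p L).
Proof.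
move=> [N [D [D0 phiE [n0 Ln0] LE]]]; exists (p * N), D; split=> //.
- by rewrite phiE mulrA rmorphM.
- by exists n0; apply: act_lbound.
by move=> n; rewrite -actM mulrC actM (act_eq p LE) act_cseq.
Qed.

Lemma expansion_const_mul c phi L : expansion phi L ->
  expansion (rf_const c * phi) (fun n => c * L n).
Proof. by move=> H; apply: expansion_ext (expansionM c%:P H) => n; rewrite actC. Qed.

Lemma expansionN phi L : expansion phi L -> expansion (- phi) (fun n => - L n).
Proof.
move=> /(expansion_const_mul (-1)) H.
have -> : - phi = rf_const (-1) * phi by rewrite /rf_const polyCN rmorphN rmorph1 mulN1r.
by apply: expansion_ext H => n; rewrite mulN1r.
Qed.

Lemma expansion_Xmul k phi L : expansion phi L ->
  expansion (rf_var ^+ k * phi) (fun n => L (n - k%:Z)).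
Proof.
move=> /(expansionM 'X^k); rewrite rmorphXn => H.
by apply: expansion_ext H => n; rewrite actXn.
Qed.

Lemma rf_var_neq0 : rf_var != 0.
Proof. by rewrite tofrac_eq0 polyX_eq0. Qed.

Lemma expansion_Xdiv k phi L : expansion phi L ->
  expansion (rf_var ^- k * phi) (fun n => L (n + k%:Z)).
Proof.
move=> [N [D [D0 phiE [n0 Ln0] LE]]]; exists N, (D * 'X^k); split.
- by rewrite mulf_neq0 // monic_neq0 ?monicXn.
- by rewrite phiE rmorphM rmorphXn /= invfM [LHS]mulrC mulrA.
- by exists (n0 - k%:Z) => n; rewrite ltrBrDr => /Ln0.
move=> n; rewrite -LE actM; apply: act_eq => m.
by rewrite actXn subrK.
Qed.

Lemma expansion_Xint (k : int) phi L : expansion phi L ->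
  expansion (rf_var ^ k * phi) (fun n => L (n - k)).
Proof.
case: k => k H; first by rewrite -exprnP; apply: expansion_Xmul.
rewrite NegzE -exprnN; apply: expansion_ext (expansion_Xdiv k.+1 H) => n.
by rewrite opprK.
Qed.

Lemma expansion_inv D L : D != 0 -> (exists n0, forall n, n < n0 -> L n = 0) ->
  (forall n, act D L n = delta n) -> expansion (D%:F)^-1 L.
Proof.
move=> D0 Lb LE; exists 1, D; split=> //; first by rewrite rmorph1 mul1r.
by move=> n; rewrite LE; case: n => n //=; rewrite coef1.
Qed.

(* Substitution of psi is well defined as soon as psi is not algebraic. *)
Definition transcendental psi := forall q, q != 0 -> ev_frac psi q != 0.

Lemma ev_fracD psi p q : ev_frac psi (p + q) = ev_frac psi p + ev_frac psi q.
Proof. by rewrite rmorphD hornerD. Qed.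
Lemma ev_fracM psi p q : ev_frac psi (p * q) = ev_frac psi p * ev_frac psi q.
Proof. by rewrite rmorphM hornerM. Qed.

(** Likewise for substitution, which is defined through the representative; transcendence of [psi]
    keeps all denominators nonzero. *)
Lemma rf_compE N D psi : transcendental psi -> D != 0 ->
  rf_comp (N%:F / D%:F) psi = ev_frac psi N / ev_frac psi D.
Proof.
move=> psiT D0; rewrite /rf_comp; set phi := N%:F / D%:F.
have d0 : \d_(repr phi) != 0 := denom_ratioP _.
apply/eqP; rewrite eqr_div ?psiT //; apply/eqP; rewrite -!ev_fracM; congr (ev_frac _ _).
apply/eqP; rewrite -tofrac_eq !rmorphM /=; apply/eqP.
have /eqP := frac_numden phi; rewrite {1}/phi eqr_div ?tofrac_eq0 // => /eqP E.
by rewrite -E.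
Qed.

Lemma rf_compD phi phi' psi : transcendental psi ->
  rf_comp (phi + phi') psi = rf_comp phi psi + rf_comp phi' psi.
Proof.
move=> psiT; rewrite [phi]frac_numden [phi']frac_numden.
have d0 x : \d_(repr x) != 0 :> {poly rat} := denom_ratioP _.
rewrite addf_div ?tofrac_eq0 // -!rmorphM -rmorphD !rf_compE ?mulf_neq0 //.
by rewrite addf_div ?psiT // ev_fracD !ev_fracM.
Qed.

Lemma rf_comp_mono c k psi : transcendental psi ->
  rf_comp (rf_const c * rf_var ^- k) psi = rf_const c * psi ^- k.
Proof.
move=> psiT; rewrite /rf_const /rf_var -rmorphXn rf_compE //; last first.
  by rewrite monic_neq0 ?monicXn.
by rewrite map_polyC hornerC map_polyXn hornerXn.
Qed.

Lemma rf_comp0 psi : transcendental psi -> rf_comp 0 psi = 0.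
Proof.
move=> psiT; have E : 0 = (0 : {poly rat})%:F / (1 : {poly rat})%:F by rewrite rmorph0 mul0r.
by rewrite {1}E rf_compE ?oner_neq0 // rmorph0 horner0 mul0r.
Qed.

Lemma ev_frac_Xn k q : ev_frac (rf_var ^+ k) q = (q \Po 'X^k)%:F.
Proof.
elim/poly_ind: q => [|q c IHq]; first by rewrite comp_poly0 !rmorph0 horner0.
rewrite ev_fracD ev_fracM IHq map_polyX map_polyC hornerX hornerC.
by rewrite comp_polyD comp_polyM comp_polyX comp_polyC rmorphD rmorphM rmorphXn.
Qed.

Lemma transcendental_Xn k : (0 < k)%N -> transcendental (rf_var ^+ k).
Proof.
move=> k0 q q0; rewrite ev_frac_Xn tofrac_eq0 comp_poly_eq0 //.
by rewrite size_polyXn ltnS.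
Qed.

Lemma exprVn_sub (K : fieldType) (x : K) i n : x != 0 -> (i <= n)%N ->
  x ^+ n * x^-1 ^+ i = x ^+ (n - i).
Proof.
by move=> x0 le_in; rewrite exprVn -{1}(subnK le_in) exprD mulfK ?expf_neq0.
Qed.

(** Multiplication by [X ^ n] reverses the coefficients, so that the leading coefficient of [q]
    becomes the constant term. *)
Lemma transcendental_Xinv : transcendental rf_var^-1.
Proof.
move=> q q0; have v0 := rf_var_neq0; pose n := (size q).-1.
have E : rf_var ^+ n * ev_frac rf_var^-1 q = (\poly_(j < n.+1) q`_(n - j))%:F.
  have sq : size q = n.+1 by rewrite /n prednK // lt0n size_poly_eq0.
  rewrite (@horner_coef_wide _ n.+1); last by rewrite (leq_trans (size_poly _ _)) ?sq.
  rewrite mulr_sumr poly_def raddf_sum /= (reindex_inj rev_ord_inj) /=.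
  apply: eq_bigr => i _; rewrite subSS coef_map_id0 ?raddf0 //.
  have le_in : (i <= n)%N by rewrite -ltnS.
  rewrite -mul_polyC rmorphM rmorphXn /= mulrCA; congr (_ * _).
  by rewrite (exprVn_sub v0) ?leq_subr // subKn.
apply: contraNneq q0 => e0; move: E; rewrite e0 mulr0 => /esym/eqP.
rewrite tofrac_eq0 => /eqP/(congr1 (fun r : {poly rat} => r`_0)).
by rewrite coef_poly /= subn0 coef0 => /eqP; rewrite lead_coef_eq0.
Qed.

(** The effect of substituting [z ^ k] for [z] on the coefficients. *)
Definition spread k L (n : int) : rat := if (k%:Z %| n)%Z then L (n %/ k%:Z)%Z else 0.

End Expansion.

(** * Expansions of substitutions and of principal parts *)

Section Substitution.
Implicit Types (phi psi : ratfun) (L : int -> rat) (p q N D : {poly rat}).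

Lemma act_shift q L n k : act q (fun x => L (x - k)) n = act q L (n - k).
Proof. by apply: eq_bigr => i _; rewrite addrAC. Qed.

Lemma act_spread k q L n : (0 < k)%N ->
  act (q \Po 'X^k) (spread k L) n = spread k (act q L) n.
Proof.
move=> k0; have kz : k%:Z != 0 by rewrite eqz_nat -lt0n.
elim/poly_ind: q L n => [|q c IHq] L n.
  by rewrite comp_poly0 /spread /act size_poly0 !big_ord0 if_same.
rewrite comp_polyD comp_polyM comp_polyX comp_polyC actD actC actM.
rewrite (act_eq (q \Po 'X^k) (g := spread k (fun x => L (x - 1)))); last first.
  move=> m; rewrite actXn /spread.
  have -> : (k%:Z %| m - k%:Z)%Z = (k%:Z %| m)%Z by rewrite rpredBr ?dvdzz.
  case: ifP => // /dvdzP[e ->]; rewrite mulzK //.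
  have -> : e * k%:Z - k%:Z = (e - 1) * k%:Z by ring.
  by rewrite mulzK.
rewrite IHq /spread; case: ifP => _; last by rewrite mulr0 addr0.
by rewrite actD actC actMX act_shift.
Qed.

Lemma expansion_Xn_comp k phi L : (0 < k)%N -> expansion phi L ->
  expansion (rf_comp phi (rf_var ^+ k)) (spread k L).
Proof.
move=> k0 [N [D [D0 -> [n0 Ln0] LE]]].
have kz : 0 < k%:Z by rewrite ltz_nat.
have kn : k%:Z != 0 by rewrite gt_eqF.
exists (N \Po 'X^k), (D \Po 'X^k); split.
- by rewrite comp_poly_eq0 // size_polyXn ltnS.
- by rewrite (rf_compE _ (transcendental_Xn k0)) // !ev_frac_Xn.
- exists (n0 * k%:Z) => n ltn; rewrite /spread; case: ifP => // /dvdzP[e nE].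
  by apply: Ln0; rewrite nE mulzK // -(ltr_pM2r kz) -nE.
move=> n; rewrite act_spread // -[RHS]act_delta.
have dE : @delta rat =1 spread k delta.
  move=> m; rewrite /spread /delta; case: ifP => [/dvdzP[e ->]|].
    by rewrite mulzK // mulf_eq0 (negPf kn) orbF.
  by have [->|//] := eqVneq m 0; rewrite dvdz0.
rewrite (act_eq _ dE) act_spread // /spread; case: ifP => // _.
by rewrite LE act_delta.
Qed.

Lemma expansion0 : expansion 0 (fun=> 0).
Proof.
have H := expansion_poly 0; rewrite rmorph0 in H.
by apply: expansion_ext H; case=> n //=; rewrite coef0.
Qed.

Lemma expansion_sum m (F : 'I_m -> ratfun) (G : 'I_m -> int -> rat) :
  (forall i, expansion (F i) (G i)) -> expansion (\sum_i F i) (fun n => \sum_i G i n).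
Proof.
elim: m F G => [|m IHm] F G FG.
  by rewrite big_ord0; apply: expansion_ext expansion0 => n; rewrite big_ord0.
rewrite big_ord_recr /=; apply: expansion_ext (expansionD (IHm _ _ _) (FG ord_max)) => [n|i].
  by rewrite big_ord_recr.
exact: FG.
Qed.

Lemma expansion_const c : expansion (rf_const c) (fun n => c * delta n).
Proof. by apply: expansion_ext (expansion_poly c%:P) => n; rewrite -act_delta actC. Qed.

Lemma expansion_mono c k : expansion (rf_const c * rf_var ^- k) (fun n => c * delta (n + k%:Z)).
Proof. by rewrite mulrC; apply: (expansion_Xdiv k (expansion_const c)). Qed.

Lemma expansion_mono_pos c k : expansion (rf_const c * rf_var ^+ k) (fun n => c * delta (n - k%:Z)).
Proof. by rewrite mulrC; apply: (expansion_Xmul k (expansion_const c)). Qed.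

Lemma sum_delta v (c : nat -> rat) n :
  \sum_(k < v) c k * delta (n - k.+1%:Z) = if n is Posz m.+1 then (if (m < v)%N then c m else 0) else 0.
Proof.
case: n => [[|m]|m]; last 2 first.
- case: ltnP => [lt_mv|le_vm].
    rewrite (bigD1 (Ordinal lt_mv)) //= subrr /delta eqxx mulr1 big1 ?addr0 // => k km.
    rewrite subr_eq0 eqz_nat eqSS; case: eqP => [E|]; rewrite ?mulr0 //.
    by case/eqP: km; apply/val_inj.
  rewrite big1 // => k _; rewrite /delta subr_eq0 eqz_nat eqSS gtn_eqF ?mulr0 //.
  exact: leq_trans le_vm.
- rewrite big1 // => k _; rewrite /delta subr_eq0; case: eqP => //; rewrite mulr0 //.
rewrite big1 // => k _; rewrite /delta subr_eq0; case: eqP => //; rewrite mulr0 //.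
Qed.

Lemma laurent_lt phi n : n < - (den_ord phi)%:Z -> laurent phi n = 0.
Proof. by rewrite /laurent -subr_lt0 opprK; case: (n + _). Qed.

Lemma expansion_principal phi :
  expansion (principal_part phi) (fun n => if n < 0 then laurent phi n else 0).
Proof.
apply: expansion_ext (expansion_sum (fun i => expansion_mono _ _)) => n.
transitivity (\sum_(k < den_ord phi) laurent phi (- k.+1%:Z) * delta (- n - k.+1%:Z)).
  apply: eq_bigr => k _; congr (_ * _); rewrite /delta.
  by rewrite -[in RHS]opprD oppr_eq0.
rewrite (sum_delta _ (fun k => laurent phi (- k.+1%:Z))).
case: n => [[|n]|n]; rewrite ?oppr0 //.
rewrite !NegzE opprK; case: ltnP => // le; apply/esym/laurent_lt.
by rewrite ltrN2 ltz_nat ltnS.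
Qed.

Lemma rf_comp_sum m (F : 'I_m -> ratfun) psi : transcendental psi ->
  rf_comp (\sum_i F i) psi = \sum_i rf_comp (F i) psi.
Proof.
move=> psiT; elim: m F => [|m IHm] F; first by rewrite !big_ord0 rf_comp0.
by rewrite !big_ord_recr /= rf_compD // IHm.
Qed.

Lemma expansion_principal_inv phi :
  expansion (rf_comp (principal_part phi) rf_var^-1)
    (fun n => if 0 < n then laurent phi (- n) else 0).
Proof.
rewrite /principal_part (rf_comp_sum _ transcendental_Xinv).
under eq_bigr => k _ do rewrite (rf_comp_mono _ _ transcendental_Xinv) exprVn invrK.
apply: expansion_ext (expansion_sum (fun i => expansion_mono_pos _ _)) => n.
rewrite (sum_delta _ (fun k => laurent phi (- k.+1%:Z))).
case: n => [[|n]|n] //; case: ltnP => // le; apply/esym/laurent_lt.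
by rewrite ltrN2 ltz_nat ltnS.
Qed.

(** The negative part moves by reflection to the positive side and the constant term is dropped. The
    symmetrization produces the terms at [- j] in [riemann_roch]. *)
Lemma expansion_f phi : let f := phi - principal_part phi
    + rf_comp (principal_part phi) rf_var^-1 - rf_const (laurent phi 0) in
  expansion f (fun n => if 0 < n then laurent phi n + laurent phi (- n) else 0).
Proof.
move=> f; apply: expansion_ext (expansionD (expansionD (expansionD (expansion_laurent phi)
  (expansionN (expansion_principal phi))) (expansion_principal_inv phi))
  (expansionN (expansion_const (laurent phi 0)))) => n.
rewrite /delta; case: (ltrgtP n 0) => [n0|n0|->].
- by rewrite subrr mulr0 oppr0 !addr0.
- by rewrite mulr0 oppr0 !addr0.
- by rewrite mulr1 oppr0 !addr0 subrr.
Qed.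

End Substitution.

(** * Coefficients of the claimed Hilbert series *)

Section Target.
Variables (w : 'I_3 -> nat) (d p : nat).
Hypothesis w_gt0 : forall i, (0 < w i)%N.
Hypothesis w_lt_d : forall i, (w i < d)%N.
Hypothesis p_gt0 : (0 < p)%N.
Local Notation a := (w ix).
Local Notation b := (w iy).
Local Notation c := (w iz).
Local Notation sg := (sgw w).

Let P (n : int) : int := pcount w n.
Let PQ (n : int) : rat := (P n)%:~R.
Let B : {poly rat} := (1 - 'X^a) * (1 - 'X^b) * (1 - 'X^c).

Let expB : expansion (B%:F)^-1 PQ.
Proof.
apply: expansion_inv.
- have X1 r : (0 < r)%N -> 1 - 'X^r != 0 :> {poly rat}.
    move=> r0; apply/eqP => /(congr1 (fun q : {poly rat} => q`_0)).
    by rewrite coefB coef1 coefXn coef0 eqxx eq_sym gtn_eqF.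
  by rewrite !mulf_neq0 ?X1.
- by exists 0 => n n0; rewrite /PQ /P pcount_neg.
move=> n; have := act_wpoly w_gt0 n; rewrite !act3 /PQ -/P => /(congr1 (fun z : int => z%:~R : rat)).
by rewrite !(rmorphD, rmorphN) /= => ->; rewrite /delta; case: eqP.
Qed.

Let X1F r : 1 - rf_var ^+ r = (1 - 'X^r)%:F.
Proof. by rewrite rmorphB rmorph1 rmorphXn. Qed.

Lemma laurent_target : let t := rf_var in
  let g : ratfun := t ^ (a%:Z + b%:Z + c%:Z - d%:Z) *
    ((1 - t ^+ d) / ((1 - t ^+ a) * (1 - t ^+ b) * (1 - t ^+ c))) in
  let f := g - principal_part g + rf_comp (principal_part g) t^-1 - rf_const (laurent g 0) in
  let G (j : int) : int := P (j - sg + d%:Z) - P (j - sg) in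
  laurent ((1 - t ^ (d%:Z - a%:Z)) * (1 - t ^ (d%:Z - b%:Z)) * (1 - t ^ (d%:Z - c%:Z))
       / ((1 - t ^+ a) * (1 - t ^+ b) * (1 - t ^+ c))
     + t ^ (d%:Z - a%:Z - b%:Z - c%:Z) * rf_comp f (t ^+ p))
  =1 fun n => (act (jacpoly w d) P n)%:~R +
    spread p (fun j => if 0 < j then (G j + G (- j))%:~R else 0) (n + sg - d%:Z).
Proof.
move=> t g f G; apply: laurentE.
have gE : laurent g =1 fun j => (G j)%:~R.
  apply: laurentE; rewrite /g /t !X1F -!rmorphM -/B.
  apply: expansion_ext (expansion_Xint _ (expansionM (1 - 'X^d) expB)) => n.
  rewrite act1BXn /PQ /G rmorphB; congr ((P _)%:~R - (P _)%:~R); rewrite /sgw; ring.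
apply: expansionD.
  have E i : t ^ (d%:Z - (w i)%:Z) = rf_var ^+ (d - w i) by rewrite subzn // ltnW.
  rewrite !E /t !X1F -!rmorphM -/B.
  apply: expansion_ext (expansionM _ expB) => n.
  by rewrite /jacpoly !act3 /PQ !(rmorphD, rmorphN).
have H := expansion_Xint (d%:Z - a%:Z - b%:Z - c%:Z) (expansion_Xn_comp p_gt0 (expansion_f g)).
apply: expansion_ext H => n; rewrite /spread.
have -> : n - (d%:Z - a%:Z - b%:Z - c%:Z) = n + sg - d%:Z by rewrite /sgw; ring.
case: ifP => // _; case: ifP => // _.
by rewrite !gE -rmorphD.
Qed.

End Target.

(** * A weighted homogeneous isolated singularity has a nilpotent Jacobian ring *)

Section ClassicalField.
Variable R : comNzRingType.
Hypothesis invR : forall x : R, x != 0 -> exists y, y * x = 1.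

Lemma classical_fieldP : exists inv : R -> R, (forall x, x != 0 -> inv x * x = 1) /\ inv 0 = 0.
Proof.
have H (x : R) : exists y, if x == 0 then y = 0 else y * x = 1.
  by case: eqP => [_|/eqP/invR//]; exists 0.
have [inv invE] := choice H; exists inv; split=> [x x0|].
  by have := invE x; rewrite (negPf x0).
by have := invE 0; rewrite eqxx.
Qed.

Definition cfield_inv := projT1 (cid classical_fieldP).
Lemma cfield_mulV x : x != 0 -> cfield_inv x * x = 1.
Proof. exact: (projT2 (cid classical_fieldP)).1. Qed.
Lemma cfield_inv0 : cfield_inv 0 = 0.
Proof. exact: (projT2 (cid classical_fieldP)).2. Qed.

(* The dummy let makes the structures below depend on [invR]. *)
Definition cfield : Type := let _ := invR in R.
HB.instance Definition _ := GRing.ComNzRing.on cfield.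
HB.instance Definition _ := GRing.ComNzRing_isField.Build cfield cfield_mulV cfield_inv0.

End ClassicalField.

Section ClassicalDomain.
Variable R : comNzRingType.
Hypothesis domR : forall x y : R, x * y = 0 -> (x == 0) || (y == 0).

Let unit : pred R := fun x => `[< exists y, y * x = 1 >].

Lemma classical_unitP : exists inv : R -> R, {in unit, left_inverse 1 inv *%R} /\
  {in [predC unit], inv =1 id}.
Proof.
have H (x : R) : exists y, if unit x then y * x = 1 else y = x.
  by case: (boolP (unit x)) => [ux|_]; [apply/asboolP|exists x].
have [inv invE] := choice H; exists inv; split=> x ux; have := invE x; rewrite -topredE /= in ux.
  by rewrite ux.
by rewrite (negPf (ux : ~~ unit x)).
Qed.

Definition cdom_inv := projT1 (cid classical_unitP).
Fact cdom_mulV : {in unit, left_inverse 1 cdom_inv *%R}.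
Proof. exact: (projT2 (cid classical_unitP)).1. Qed.
Fact cdom_unitP (x y : R) : y * x = 1 -> unit x.
Proof. by move=> yx; apply/asboolP; exists y. Qed.
Fact cdom_inv_out : {in [predC unit], cdom_inv =1 id}.
Proof. exact: (projT2 (cid classical_unitP)).2. Qed.

Definition cdom : Type := let _ := domR in R.
HB.instance Definition _ := GRing.ComNzRing.on cdom.
HB.instance Definition _ := GRing.ComNzRing_hasMulInverse.Build cdom
  cdom_mulV cdom_unitP cdom_inv_out.
HB.instance Definition _ := GRing.ComUnitRing_isIntegral.Build cdom domR.

End ClassicalDomain.

Section PrimeQuotient.
Variable P : comNzRingType.
Variable A : P -> Prop.
Hypotheses (A0 : A 0) (AD : forall u v, A u -> A v -> A (u + v))
  (AM : forall r u, A u -> A (r * u)) (A1 : ~ A 1)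
  (Aprime : forall u v, A (u * v) -> A u \/ A v).

Definition pideal : pred P := fun u => `[< A u >].

Fact pideal_zmod : zmod_closed pideal.
Proof.
split; first exact/asboolP.
move=> u v /asboolP Au /asboolP Av; apply/asboolP/AD => //.
by rewrite -mulN1r; apply: AM.
Qed.
HB.instance Definition _ := GRing.isZmodClosed.Build P pideal pideal_zmod.
Fact pideal_proper : 1 \notin pideal /\ forall a, {in pideal, forall u, a * u \in pideal}.
Proof.
split; first exact/asboolPn.
by move=> r u /asboolP Au; apply/asboolP/AM.
Qed.
HB.instance Definition _ := isProperIdeal.Build P pideal pideal_proper.

Lemma prime_quotient_field : exists (K : fieldType) (phi : {rmorphism P -> K}),
  forall u, phi u = 0 <-> A u.
Proof.
pose I : idealr P := Idealr.clone P pideal _.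
pose D := {ideal_quot I}.
have piM (u v : P) : \pi_D u * \pi_D v = \pi_D (u * v) by rewrite pi_mulr.
have pi0 : 0 = \pi_D 0 by rewrite pi_zeror.
have E0 (u : P) : \pi_D u = 0 <-> A u.
  rewrite pi0; split=> [/eqP|Au]; last apply/eqP;
  rewrite -(Quotient.idealrBE I) subr0; last exact/asboolP.
  by move/asboolP.
have domD (x y : D) : x * y = 0 -> (x == 0) || (y == 0).
  elim/quotW: x => u; elim/quotW: y => v; rewrite piM => /E0/Aprime[]/E0->;
  by rewrite eqxx ?orbT.
pose D' : idomainType := @cdom D domD.
pose pi : {rmorphism P -> D'} := \pi_D.
exists {fraction D'}, (@FracField.tofrac D' \o pi) => u; rewrite -E0 /=; split=> [/eqP|->]; last exact: tofrac0.
by rewrite tofrac_eq0 => /eqP.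
Qed.

End PrimeQuotient.

Section PrimeAvoidance.
Variables (P : comNzRingType) (J : P -> Prop) (e : P).
Hypotheses (J0 : J 0) (JD : forall u v, J u -> J v -> J (u + v))
  (JM : forall r u, J u -> J (r * u)) (Je : forall n, ~ J (e ^+ n)).

Let good (A : P -> Prop) :=
  [/\ forall u v, A u -> A v -> A (u + v), forall r u, A u -> A (r * u),
      forall u, J u -> A u & forall n, ~ A (e ^+ n)].

(** This is the form of the Nullstellensatz in use. An ideal maximal among those that contain [J]
    and no power of [e] is prime, and the fraction field of its quotient carries a zero of [J] at
    which [e] does not vanish. As [isolated_singularity] ranges over all extension fields, this
    generic point is admissible. *)
Lemma prime_avoiding : exists (K : fieldType) (phi : {rmorphism P -> K}),
  (forall u, J u -> phi u = 0) /\ phi e != 0.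
Proof.
have goodJ : good J by split.
pose T := {A : P -> Prop | good A}.
pose le (s t : T) := `[< forall x, sval s x -> sval t x >].
have [//|||[A gA] Amax] := @classical_sets.ZL_preorder T (exist _ J goodJ) le.
- by move=> t; apply/asboolP.
- by move=> r s t /asboolP rs /asboolP st; apply/asboolP => x /rs/st.
- move=> C Ctot; have [[c Cc]|Cn] := pselect (exists c, C c); last first.
    exists (exist _ J goodJ) => s Cs; case: Cn; by exists s.
  pose U x := exists2 s : T, C s & sval s x.
  have gU : good U.
    split=> [u v [s Cs su] [t Ct tv]|r u [s Cs su]|u Ju|n [s Cs]].
    - have [] := Ctot _ _ Cs Ct => /asboolP le_st.
        by exists t => //; case: (svalP t) => D _ _ _; apply: D => //; exact: le_st.
      by exists s => //; case: (svalP s) => D _ _ _; apply: D => //; exact: le_st.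
    - by exists s => //; case: (svalP s) => _ M _ _; apply: M.
    - by exists c => //; case: (svalP c) => _ _ ? _; auto.
    - by case: (svalP s) => _ _ _; apply.
  exists (exist _ U gU) => s Cs; apply/asboolP => x sx; by exists s.
have [AD AM AJ Ae] := gA.
(* By maximality the ideal generated by [A] and [u] contains a power of [e]. *)
have step u : ~ A u -> exists n r v, e ^+ n = r * u + v /\ A v.
  move=> nAu; apply: contrapT => nE.
  pose B x := exists r v, x = r * u + v /\ A v.
  have gB : good B.
    split=> [_ _ [r [v [-> Av]]] [r' [v' [-> Av']]]|c _ [r [v [-> Av]]]|x Jx|n [r [v [E Av]]]].
    - by exists (r + r'), (v + v'); split; [rewrite mulrDl addrACA | apply: AD].
    - by exists (c * r), (c * v); split; [rewrite mulrDr mulrA | apply: AM].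
    - by exists 0, x; split; [rewrite mul0r add0r | apply: AJ].
    - by apply: nE; exists n, r, v.
  have /asboolP le_BA : le (exist _ B gB) (exist _ A gA).
    apply: Amax; apply/asboolP => x Ax; exists 0, x; split=> //.
    by rewrite mul0r add0r.
  apply/nAu/le_BA; exists 1, 0; split; first by rewrite mul1r addr0.
  exact: AJ.
have [|||||K [phi phiE]] := @prime_quotient_field P A; first by apply: AJ.
- exact: AD.
- exact: AM.
- by have := Ae 0; rewrite expr0.
- move=> u v Auv; apply: contrapT => /not_orP[/step[n [r [x [En Ax]]]] /step[m [s [y [Em Ay]]]]].
  apply: (Ae (n + m)%N); rewrite exprD En Em mulrDl mulrDr.
  have -> : r * u * (s * v) + r * u * y + x * (s * v + y)
            = r * s * (u * v) + r * u * y + (s * v + y) * x by ring.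
  by apply: (AD); [apply: (AD)|]; apply: (AM).
exists K, phi; split=> [u /AJ/phiE//|].
by apply/eqP => /phiE; have := Ae 1; rewrite expr1.
Qed.

End PrimeAvoidance.

Section MapMpoly.
Variables (R S : nzRingType) (n : nat).

Lemma mderiv_map_mpoly (f : {rmorphism R -> S}) i (P : {mpoly R[n]}) :
  (map_mpoly f P)^`M(i) = map_mpoly f P^`M(i).
Proof.
by apply/mpolyP => k; rewrite mcoeff_map_mpoly !mcoeff_deriv mcoeff_map_mpoly raddfMn.
Qed.

End MapMpoly.

Lemma meval_at0 (R : comNzRingType) n (f : {mpoly R[n]}) : f.@[fun=> 0] = f@_0%MM.
Proof.
elim/mpolyind: f => [|c k f _ _ IH]; first by rewrite meval0 mcoeff0.
rewrite mevalD mcoeffD IH mevalZ mcoeffZ mevalX mcoeffX; congr (_ * _ + _).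
case: eqP => [->|/eqP k0].
  by rewrite big1 // => i _; rewrite mnm0E expr0.
have [i ki] : exists i, k i != 0%N.
  apply/existsP; rewrite -negb_forall; apply: contra k0 => /forallP k0.
  by apply/eqP/mnmP => i; rewrite mnm0E; apply/eqP.
by rewrite (bigD1 i) //= expr0n (negPf ki) mul0r.
Qed.

Section IsolatedSingularity.
Variables (F : fieldType) (w : 'I_3 -> nat) (d : nat) (Q : {mpoly F[3]}).
Hypotheses (w_gt0 : forall i, (0 < w i)%N) (d_neq0 : d%:R != 0 :> F)
  (Qd : whom w d%:Z Q) (Qisol : isolated_singularity Q).
Local Notation P := {mpoly F[3]}.
Local Notation V3 := (P * P * P)%type.
Local Notation q := (grad Q).

Lemma hc_const (f : P) : hc w 0 f = (f@_0%MM)%:MP.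
Proof.
apply/mpolyP => k; rewrite mcoeff_hc mcoeffC.
have [->|k0] := eqVneq k 0%MM; first by rewrite /wdeg big1 ?eqxx ?mulr1 // => i _; rewrite mnm0E muln0.
rewrite (_ : (_ == _) = false) ?mulr0 //.
by apply: contraNF k0 => /eqP[/(wdeg0 w_gt0)->].
Qed.

(** By Euler's formula [Q] vanishes wherever its gradient does, so [X_i h] vanishes at every zero of
    the Jacobian ideal and has a power in it. That ideal is homogeneous, and the component of weight
    [n w_i] of [(X_i h) ^ n] is [h(0) ^ n X_i ^ n], since only constants have weight 0; this gets
    rid of [h]. *)
Lemma jacobian_power i : exists n v, 'X_i ^+ n = dot q v.
Proof.
have [[_ q0] [h h0 hP]] := Qisol.
pose J u := exists v, u = dot q v.
have [n [v Env]] : exists n, J (('X_i * h) ^+ n).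
  apply: contrapT => nJ.
  have JD u1 u2 : J u1 -> J u2 -> J (u1 + u2).
    by move=> [v1 ->] [v2 ->]; exists (v1 + v2); rewrite /dot /=; ring.
  have JM r u : J u -> J (r * u).
    by move=> [v ->]; exists (smul r v); rewrite /dot /=; ring.
  have [|n Jn|K [phi [phiJ phie]]] := @prime_avoiding P J ('X_i * h) _ JD JM.
  - by exists 0; rewrite /dot /= !mulr0 !addr0.
  - by apply: nJ; exists n.
  pose iota : {rmorphism F -> K} := phi \o @mpolyC 3 F.
  pose v j := phi 'X_j.
  have ev f : (map_mpoly iota f).@[v] = phi f.
    elim/mpolyind: f => [|c k f _ _ IH]; first by rewrite !rmorph0.
    rewrite rmorphD /= mevalD IH map_mpolyZ map_mpolyX mevalZ mevalX -mul_mpolyC rmorphD rmorphM /=.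
    by rewrite (mpolyXE_id F k) rmorph_prod; congr (_ * _ + _); apply: eq_bigr => j _; rewrite rmorphXn.
  have qJ j : J Q^`M(j).
    elim/ord3P: j; [exists (1, 0, 0) | exists (0, 1, 0) | exists (0, 0, 1)];
    by rewrite /dot /= !mulr0 !mulr1 ?addr0 ?add0r.
  have QJ : J Q.
    exists (smul (d%:R^-1)%:MP (eulerv F w)).
    have QE : Q = (d%:R^-1)%:MP * ((d%:Z)%:~R * Q).
      by rewrite mulrA -pmulrn -(rmorph_nat (@mpolyC 3 F)) -mpolyCM mulVf // mpolyC1 mul1r.
    by rewrite {1}QE -(euler_grad Qd) /dot /=; ring.
  move: phie; rewrite rmorphM mulf_eq0 negb_or => /andP[/eqP vi hv]; apply: vi.
  apply: (hP K iota v) => //; last by rewrite ev.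
  by split=> [|j]; rewrite ?mderiv_map_mpoly ev; apply: phiJ.
have Xn : whom w ((n * w i)%N%:Z) ('X_i ^+ n : P).
  rewrite mpolyXn; have := @whomX F w (U_(i) *+ n); congr (whom w _%:Z _).
  rewrite /wdeg (bigD1 i) //= big1 ?addn0 => [|j ji]; rewrite mulmnE mnm1E ?eqxx ?mul1n 1?mulnC //.
  by rewrite eq_sym (negPf ji).
pose c := (h ^+ n)@_0%MM.
have c0 : c != 0 by rewrite /c -meval_at0 rmorphXn /= expf_neq0.
have E : c *: ('X_i ^+ n : P) = dot q (hc2 w ((n * w i)%N%:Z + sgw w - d%:Z) v).
  rewrite -(@hc_dot2 F w _ d%:Z q v); last by split; apply: whom_deriv.
  rewrite -Env exprMn_comm; last exact: mulrC.
  rewrite (_ : _ - _ + _ = (n * w i)%N%:Z + 0); last by ring.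
  by rewrite hcM // hc_const -mul_mpolyC mulrC.
exists n, (smul c^-1%:MP (hc2 w ((n * w i)%N%:Z + sgw w - d%:Z) v)).
have -> : dot q (smul c^-1%:MP (hc2 w ((n * w i)%N%:Z + sgw w - d%:Z) v)) =
  c^-1%:MP * dot q (hc2 w ((n * w i)%N%:Z + sgw w - d%:Z) v) by rewrite /dot /=; ring.
by rewrite -E mul_mpolyC scalerA mulVf // scale1r.
Qed.

Lemma jacobian_powers : exists N, forall i, exists v : V3, 'X_i ^+ N = dot q v.
Proof.
have [n1 [v1 E1]] := jacobian_power ix; have [n2 [v2 E2]] := jacobian_power iy.
have [n3 [v3 E3]] := jacobian_power iz; exists (n1 + n2 + n3)%N; elim/ord3P.
- by exists (smul ('X_ix ^+ (n2 + n3)) v1); rewrite -addnA exprD E1 /dot /=; ring.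
- by exists (smul ('X_iy ^+ (n1 + n3)) v2); rewrite [(n1 + _)%N]addnC -addnA exprD E2 /dot /=; ring.
- by exists (smul ('X_iz ^+ (n1 + n2)) v3); rewrite addnC exprD E3 /dot /=; ring.
Qed.

(** [Q_i] has weight [d - w i] and no constant term, so it suffices that it is nonzero. Otherwise
    the [i]-th unit vector would be orthogonal to [q], hence of the form [q x v], and would vanish
    at the origin. *)
Lemma weight_lt_degree i : (w i < d)%N.
Proof.
have [N XN] := jacobian_powers; have [[_ q0] _] := Qisol.
have q00 j : (Q^`M(j))@_0%MM = 0 by rewrite -meval_at0 q0.
have qi : Q^`M(i) != 0.
  apply/eqP => qi.
  have [v ev] : exists v, ((i == ix)%:R, (i == iy)%:R, (i == iz)%:R) = cross q v.
    apply: (exact2_forms XN); move: qi; clear; elim/ord3P: i; rewrite /dot /= => ->;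
    by rewrite ?mulr0 ?mul0r ?addr0.
  have cr0 j (u1 u2 : P) : (Q^`M(j) * u1 - Q^`M(j) * u2)@_0%MM = 0.
    by rewrite -mulrBr -!meval_at0 rmorphM /= q0 mul0r.
  have z (f : P) j : (Q^`M(j) * f)@_0%MM = 0 by rewrite -!meval_at0 rmorphM /= q0 mul0r.
  suff: (1 : P)@_0%MM = 0 by rewrite mcoeff1 eqxx => /eqP; rewrite oner_eq0.
  move: ev => /(congr1 (fun v : V3 => (v.1.1@_0%MM, v.1.2@_0%MM, v.2@_0%MM))).
  rewrite /cross /= !mcoeffB !z subrr; clear -F; elim/ord3P: i => -[] //.
have [k k0] : exists k, (Q^`M(i))@_k != 0.
  apply: contrapT => nk; move/eqP: qi; apply; apply/mpolyP => k; rewrite mcoeff0.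
  by apply/eqP; apply/negPn/negP => kk; apply: nk; exists k.
have := @whom_deriv F w _ i _ Qd _ k0; have [k00|] := eqVneq k 0%MM.
  by move: k0; rewrite k00 q00 eqxx.
move=> kn; have : (0 < wdeg w k)%N by rewrite lt0n; apply: contra kn => /eqP/(wdeg0 w_gt0)->.
by lia.
Qed.

End IsolatedSingularity.

(** * Reduction modulo p *)

Section Denominators.
Variables (F : fieldExtType rat) (R : subringClosed F).
Hypothesis R_gen : generates_field R.

(* The elements of [F] having a multiple in [R] form a subfield. *)
Lemma denominator (x : F) : exists2 n, (0 < n)%N & n%:R * x \in R.
Proof.
pose L x := exists2 n, (0 < n)%N & n%:R * x \in R.
have LR y : y \in R -> L y by exists 1%N => //; rewrite mul1r.
have LD y z : L y -> L z -> L (y + z).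
  move=> [m m0 my] [n n0 nz]; exists (m * n)%N; first by rewrite muln_gt0 m0.
  rewrite natrM mulrDr {1}[m%:R * _]mulrC -!mulrA.
  by apply: rpredD; apply: rpredM => //; exact: rpred_nat.
have LM y z : L y -> L z -> L (y * z).
  move=> [m m0 my] [n n0 nz]; exists (m * n)%N; first by rewrite muln_gt0 m0.
  by rewrite natrM mulrACA rpredM.
have LZ (c : rat) y : L y -> L (c *: y).
  rewrite -mulr_algl => Ly; apply: LM => //; exists `|denq c|%N; first by rewrite absz_gt0 denq_neq0.
  rewrite mulr_algr -[X in _ *: X]/(1 *+ `|denq c| : F) -scalerMnr scalerMnl.
  have -> : c *+ `|denq c| = (numq c)%:~R.
    by rewrite -mulr_natl pmulrn absz_denq mulrC numqE.
  by rewrite scaler_int rpred_int.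
(* [L] is only a predicate; the vector space it describes is recovered as a rational subspace of
   maximal dimension inside it. Being closed under products, it is a subfield. *)
have [U UL Umax] : exists2 U : {vspace F}, (forall x, x \in U -> L x) &
    forall V : {vspace F}, (forall x, x \in V -> L x) -> (\dim V <= \dim U)%N.
  pose T n := `[< exists2 U : {vspace F}, (forall x, x \in U -> L x) & \dim U = n >].
  have T0 : exists n, T n.
    exists 0%N; apply/asboolP; exists 0%VS; last by rewrite dimv0.
    by move=> y; rewrite memv0 => /eqP->; apply/LR/rpred0.
  have Tle n : T n -> (n <= \dim {:F})%N by move=> /asboolP[U _ <-]; rewrite dimvS ?subvf.
  have [_ /asboolP[U UL <-] max] := ex_maxnP T0 Tle.
  by exists U => // V VL; apply: max; apply/asboolP; exists V.
have LU y : L y -> y \in U.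
  move=> Ly; have VL z : z \in (U + <[y]>)%VS -> L z.
    by move=> /memv_addP[u /UL Lu [v /vlineP[c ->] ->]]; apply/LD/LZ.
  have /eqP-> : U == (U + <[y]>)%VS by rewrite eqEdim addvSl Umax.
  by rewrite memvE addvSr.
have Ua : is_aspace U.
  rewrite /is_aspace has_algid1 ?LU //; last exact/LR/rpred1.
  by apply/prodvP => y z /UL Ly /UL Lz; apply/LU/LM.
by apply: UL; apply: (R_gen (K := ASpace Ua)) => y /LR/LU.
Qed.

Lemma common_denominator (s : seq F) :
  exists2 n, (0 < n)%N & forall x, x \in s -> n%:R * x \in R.
Proof.
elim: s => [|x s [n n0 ns]]; first by exists 1%N.
have [m m0 mx] := denominator x; exists (m * n)%N; first by rewrite muln_gt0 m0.
move=> y; rewrite inE natrM => /orP[/eqP->|/ns ys]; last by rewrite -mulrA rpredM // rpred_nat.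
by rewrite [m%:R * _]mulrC -mulrA rpredM // rpred_nat.
Qed.

End Denominators.

(** * Residues of polynomials with coefficients integral at the prime *)

Section Specialization.
Variables (F K : fieldType) (R : subringClosed F) (p : nat).
Hypothesis charK : p \in [pchar K].
Variable pi : {rmorphism subring R -> K}.
Local Notation P := {mpoly F[3]}.
Local Notation PK := {mpoly K[3]}.

(* [x] is integral at the prime ker pi, with residue [y] *)
Definition reduces (x : F) (y : K) := exists n (r : subring R),
  [/\ ~~ (p %| n)%N, n%:R * x = val r & n%:R * y = pi r].

Let p_pr : prime p := pcharf_prime charK.

Lemma reduces_val r : reduces (val r) (pi r).
Proof.
by exists 1%N, r; rewrite !mul1r; split=> //; rewrite -(natK_eq0 charK) oner_eq0.
Qed.

Lemma reduces0 : reduces 0 0.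
Proof. by have := reduces_val 0; rewrite !rmorph0. Qed.

Lemma reducesD x y x' y' : reduces x y -> reduces x' y' ->
  reduces (x + x') (y + y').
Proof.
move=> [n [r [pn E1 E2]]] [n' [r' [pn' E1' E2']]].
exists (n * n')%N, (n'%:R * r + n%:R * r'); rewrite Euclid_dvdM // negb_or pn pn'.
by rewrite !rmorphD !rmorphM !rmorph_nat /= -E1 -E1' -E2 -E2' ?natrM; split=> //; ring.
Qed.

Lemma reducesM x y x' y' : reduces x y -> reduces x' y' ->
  reduces (x * x') (y * y').
Proof.
move=> [n [r [pn E1 E2]]] [n' [r' [pn' E1' E2']]].
exists (n * n')%N, (r * r'); rewrite Euclid_dvdM // negb_or pn pn'.
by rewrite !rmorphM /= -E1 -E1' -E2 -E2' ?natrM; split=> //; ring.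
Qed.

Lemma reducesN x y : reduces x y -> reduces (- x) (- y).
Proof.
by move=> [n [r [pn E1 E2]]]; exists n, (- r); rewrite !rmorphN /= -E1 -E2 !mulrN.
Qed.

Lemma reduces_nat n : reduces n%:R n%:R.
Proof. by have := reduces_val n%:R; rewrite !rmorph_nat. Qed.

Lemma reduces_sum (I : Type) (s : seq I) (T : pred I) (f : I -> F) (g : I -> K) :
  (forall i, T i -> reduces (f i) (g i)) ->
  reduces (\sum_(i <- s | T i) f i) (\sum_(i <- s | T i) g i).
Proof.
move=> fg; apply: (big_ind2 reduces) => //; first exact: reduces0.
by move=> *; apply: reducesD.
Qed.

Lemma reduces_inj x y y' : reduces x y -> reduces x y' -> y = y'.
Proof.
move=> [n [r [pn E1 E2]]] [n' [r' [pn' E1' E2']]].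
have n0 : (n * n')%:R != 0 :> K by rewrite (natK_eq0 charK) Euclid_dvdM // negb_or pn.
have E : n'%:R * r = n%:R * r'.
  by apply: val_inj; rewrite !rmorphM !rmorph_nat /= -E1 -E1'; ring.
apply: (mulfI n0); rewrite natrM mulrAC E2 -mulrA E2'.
by have := congr1 pi E; rewrite !rmorphM !rmorph_nat mulrC => ->.
Qed.

Lemma reduces_ex x n : n%:R * x \in R -> ~~ (p %| n)%N -> exists y, reduces x y.
Proof.
move=> xR pn; exists (n%:R^-1 * pi (Sub (n%:R * x) xR)), n, (Sub (n%:R * x) xR); split=> //.
by rewrite mulrA divff ?mul1r // (natK_eq0 charK).
Qed.

Definition mreduces (f : P) (g : PK) := forall k, reduces f@_k g@_k.

Lemma mreduces0 : mreduces 0 0.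
Proof. by move=> k; rewrite !mcoeff0; apply: reduces0. Qed.

Lemma mreducesD f g f' g' : mreduces f g -> mreduces f' g' ->
  mreduces (f + f') (g + g').
Proof. by move=> fg fg' k; rewrite !mcoeffD; apply: reducesD. Qed.

Lemma mreducesN f g : mreduces f g -> mreduces (- f) (- g).
Proof. by move=> fg k; rewrite !mcoeffN; apply: reducesN. Qed.

Lemma mreducesB f g f' g' : mreduces f g -> mreduces f' g' ->
  mreduces (f - f') (g - g').
Proof. by move=> fg /mreducesN; apply: (mreducesD fg). Qed.

Lemma mreducesZ x y f g : reduces x y -> mreduces f g ->
  mreduces (x *: f) (y *: g).
Proof. by move=> xy fg k; rewrite !mcoeffZ; apply: reducesM. Qed.

Lemma mreducesX k : mreduces 'X_[k] 'X_[k].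
Proof. by move=> l; rewrite !mcoeffX; apply: reduces_nat. Qed.

Lemma mreduces_sum (I : Type) (s : seq I) (T : pred I) (f : I -> P) (g : I -> PK) :
  (forall i, T i -> mreduces (f i) (g i)) ->
  mreduces (\sum_(i <- s | T i) f i) (\sum_(i <- s | T i) g i).
Proof. by move=> fg k; rewrite !raddf_sum; apply: reduces_sum => i Ti; apply: fg. Qed.

Lemma mreducesM f g f' g' : mreduces f g -> mreduces f' g' ->
  mreduces (f * f') (g * g').
Proof.
move=> fg fg' k; rewrite !mcoeffM.
by apply: reduces_sum => l _; apply: reducesM.
Qed.

Lemma mreduces_deriv i f g : mreduces f g -> mreduces f^`M(i) g^`M(i).
Proof.
move=> fg k; rewrite !mcoeff_deriv -[X in reduces X _]mulr_natl -[X in reduces _ X]mulr_natl.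
by apply: reducesM => //; apply: reduces_nat.
Qed.

Lemma mreduces_hc w m f g : mreduces f g -> mreduces (hc w m f) (hc w m g).
Proof. by move=> fg k; rewrite !mcoeff_hc; case: ifP => _ //; apply: reduces0. Qed.

Lemma mreduces_inj f g g' : mreduces f g -> mreduces f g' -> g = g'.
Proof. by move=> fg fg'; apply/mpolyP => k; apply: reduces_inj (fg k) (fg' k). Qed.

Lemma mreduces_ex f : (forall k, exists y, reduces f@_k y) ->
  exists g, mreduces f g.
Proof.
move=> /choice[y fy]; exists (\sum_(k <- msupp f) y k *: 'X_[k]).
rewrite {1}[f]mpolyE; apply: mreduces_sum => k _.
by apply: mreducesZ; [apply: fy | apply: mreducesX].
Qed.

Lemma mreduces_common f g : mreduces f g -> exists2 n, ~~ (p %| n)%N &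
  exists r : 'X_{1..3} -> subring R, forall k, n%:R * f@_k = val (r k) /\ n%:R * g@_k = pi (r k).
Proof.
move=> fg; have [n pn nP] : exists2 n, ~~ (p %| n)%N & forall k, k \in msupp f ++ msupp g ->
    exists r : subring R, n%:R * f@_k = val r /\ n%:R * g@_k = pi r.
  elim: (msupp f ++ msupp g) => [|k s [n pn nP]].
    by exists 1%N => //; rewrite -(natK_eq0 charK) oner_eq0.
  have [m [r [pm E1 E2]]] := fg k; exists (m * n)%N => [|l].
    by rewrite Euclid_dvdM // negb_or pm.
  rewrite inE !natrM => /orP[/eqP->|/nP[t [Et1 Et2]]].
    exists (n%:R * r); rewrite !rmorphM !rmorph_nat /= -E1 -E2; split; ring.
  by exists (m%:R * t); rewrite !rmorphM !rmorph_nat /= -Et1 -Et2 !mulrA.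
suff H k : exists r : subring R, n%:R * f@_k = val r /\ n%:R * g@_k = pi r.
  by have [r rP] := choice H; exists n => //; exists r.
have [/nP//|] := boolP (k \in msupp f ++ msupp g).
rewrite mem_cat negb_or => /andP[/memN_msupp_eq0-> /memN_msupp_eq0->].
by exists 0; rewrite !mulr0 !rmorph0.
Qed.

(** A form of Gauss's lemma: the leading coefficient of [Q] has the inverse [x], which is integral,
    so the quotient [h] is found to be integral one leading term after another. *)
Lemma mreduces_divisor (Q : P) Qb x c : mreduces Q Qb -> reduces x c -> x * mleadc Q = 1 ->
  forall h : P, (forall k, exists y, reduces (h * Q)@_k y) ->
  exists g, mreduces h g.
Proof.
move=> QQb xc xQ h hQ; apply: mreduces_ex; move: h hQ; apply: mleadrect => h IH hQ k.
have [Q0|Q0] := eqVneq Q 0; first by move: xQ; rewrite Q0 mcoeff0 mulr0 => /eqP; rewrite eq_sym oner_eq0.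
have [->|h0] := eqVneq h 0; first by exists 0; rewrite mcoeff0; apply: reduces0.
have [y hy] : exists y, reduces (mleadc h) y.
  have [y yP] := hQ (mlead h + mlead Q)%MM; exists (y * c).
  have -> : mleadc h = (h * Q)@_(mlead h + mlead Q) * x.
    by rewrite mleadcM -mulrA [_ * x]mulrC xQ mulr1.
  exact: reducesM.
pose t := mleadc h *: 'X_[mlead h]; pose h' := h - t.
have [tb tP] : exists tb, mreduces t tb.
  by exists (y *: 'X_[mlead h]); apply: mreducesZ => //; apply: mreducesX.
have [z hz] : exists z, reduces h'@_k z.
  have [->|h'0] := eqVneq h' 0; first by exists 0; rewrite mcoeff0; apply: reduces0.
  apply: IH; first exact: ltm_mleadD.
  move=> l; have [z E] := hQ l; exists (z - (tb * Qb)@_l); rewrite mulrBl mcoeffB.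
  by apply/reducesD/reducesN/mreducesM.
exists (z + tb@_k); rewrite -[h](subrK t) mcoeffD; exact: reducesD.
Qed.

End Specialization.

(** * The reduction of the Poisson algebra in terms of polynomials over the residue field *)

Section PoissonReduction.
Variables (F K : fieldType) (R : subringClosed F) (p : nat).
Hypothesis charK : p \in [pchar K].
Variable pi : {rmorphism subring R -> K}.
Hypothesis pi_surj : forall y, exists r, pi r = y.
Local Notation P := {mpoly F[3]}.
Local Notation PK := {mpoly K[3]}.
Variables (Q : P) (Qb : PK) (x0 : F) (c0 : K).
Hypotheses (Qs : mreduces p pi Q Qb) (xc : reduces p pi x0 c0)
  (xQ : x0 * mleadc Q = 1).
Variable AR : poissonSubalg Q R.
Local Notation A := (coordring Q).
Local Notation psa := (psa AR).
Local Notation "\piA f" := (\pi_A f) (at level 10, f at level 8).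

(** A relation and not a map, because an element of [A] determines [f] only up to multiples of [Q];
    [represents_uniq] shows that [fb] is then determined up to multiples of [Qb]. *)
Definition represents (u : A) (f : P) (fb : PK) := u = \piA f /\ mreduces p pi f fb.

Variable gens : seq A.
Hypothesis AR_fg : forall S : pred A, GRing.subring_closed S ->
    (forall a u, a \in R -> u \in S -> a *: u \in S) ->
    {subset gens <= S} -> {subset psa_pred AR <= S}.
Hypothesis gens_rep : forall u, u \in gens -> exists f fb, represents u f fb.
Variable n1 : nat.
Hypotheses (pn1 : ~~ (p %| n1)%N) (n1X : forall i, \piA (n1%:R *: 'X_i) \in psa_pred AR).

Let p_pr : prime p := pcharf_prime charK.

Lemma represents0 : represents 0 0 0.
Proof. by split; [rewrite piE | apply: mreduces0]. Qed.

Lemma representsD u f fb v g gb : represents u f fb -> represents v g gb ->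
  represents (u + v) (f + g) (fb + gb).
Proof.
by move=> [-> fs] [-> gs]; split; [rewrite coordring_piD | apply: mreducesD].
Qed.

Lemma representsN u f fb : represents u f fb -> represents (- u) (- f) (- fb).
Proof. by move=> [-> fs]; split; [rewrite coordring_piN | apply: mreducesN]. Qed.

Lemma representsB u f fb v g gb : represents u f fb -> represents v g gb ->
  represents (u - v) (f - g) (fb - gb).
Proof. by move=> uf /representsN; apply: representsD. Qed.

Lemma representsM u f fb v g gb : represents u f fb -> represents v g gb ->
  represents (u * v) (f * g) (fb * gb).
Proof.
move=> [-> fs] [-> gs]; split; last exact: mreducesM.
exact: coordring_piM.
Qed.

Lemma representsZ a c u f fb : reduces p pi a c -> represents u f fb ->
  represents (a *: u) (a *: f) (c *: fb).
Proof.
move=> ac [-> fs]; split; last exact: mreducesZ.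
exact: coordring_piZ.
Qed.

Lemma represents_sum (I : Type) (s : seq I) (T : pred I) u f fb :
  (forall i, T i -> represents (u i) (f i) (fb i)) ->
  represents (\sum_(i <- s | T i) u i) (\sum_(i <- s | T i) f i) (\sum_(i <- s | T i) fb i).
Proof.
move=> uf; elim/big_ind3: _ => //; first exact: represents0.
by move=> *; apply: representsD.
Qed.

Lemma represents_bracket u f fb v g gb : represents u f fb -> represents v g gb ->
  represents (bracket u v) (pbracket Q f g) (pbracket Qb fb gb).
Proof.
move=> [-> fs] [-> gs]; split; first exact: pbracket_pi.
by rewrite /pbracket; do ![apply: (mreducesD charK) | apply: (mreducesN)
  | apply: (mreducesM charK) | apply: (mreduces_deriv charK)].
Qed.

Lemma coordring_pi_sum (I : Type) (s : seq I) (T : pred I) (f : I -> P) :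
  \piA (\sum_(i <- s | T i) f i) = \sum_(i <- s | T i) \piA (f i).
Proof. by apply: (big_morph (fun f => \piA f)) => [f1 f2|]; rewrite ?coordring_piD ?piE. Qed.

Lemma represents_ex u : u \in psa_pred AR -> exists f fb, represents u f fb.
Proof.
pose T : pred A := fun u => `[< exists f fb, represents u f fb >].
move=> uA; suff /asboolP : u \in T by [].
move: u uA; apply: AR_fg => [|a u aR|u /gens_rep ug]; last exact/asboolP.
  split.
  - by apply/asboolP; exists 1, 1; split=> //;
      rewrite -[1 : P]mpolyX0 -[1 : PK]mpolyX0; apply: (mreducesX charK).
  - move=> u v /asboolP[f [fb fP]] /asboolP[g [gb gP]]; apply/asboolP.
    by exists (f - g), (fb - gb); apply: representsB.
  - move=> u v /asboolP[f [fb fP]] /asboolP[g [gb gP]]; apply/asboolP.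
    by exists (f * g), (fb * gb); apply: representsM.
move=> /asboolP[f [fb fP]]; apply/asboolP.
exists (a *: f), (pi (Sub a aR) *: fb); apply: representsZ => //.
by have := reduces_val charK pi (Sub a aR); rewrite SubK.
Qed.

Lemma scaled_monomial k : \piA ((n1 ^ mdeg k)%:R *: 'X_[k]) \in psa_pred AR.
Proof.
have [A1 AB AM] := psa_subring_closed AR.
have -> : (n1 ^ mdeg k)%:R *: 'X_[k] = \prod_i (n1%:R *: 'X_i : P) ^+ k i.
  rewrite (mpolyXE_id F k) mdegE natrX -prodrXr -scaler_prod.
  by apply: eq_bigr => i _; rewrite exprZn.
have M f g : \piA f \in psa_pred AR -> \piA g \in psa_pred AR -> \piA (f * g) \in psa_pred AR.
  by move=> fA gA; rewrite -coordring_piM; apply: AM.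
elim/big_ind: _ => [|f g|i _]; [exact: A1 | exact: M | ].
elim: (k i) => [|n IH]; first by rewrite expr0.
by rewrite exprS; apply: M.
Qed.

(** The variables may be missing from [A_R], but [n1 X_i] belongs to it. The resulting powers of
    [n1] are compensated by powers of [n1 ^ (p - 2)], an integer inverse to [n1] modulo [p] by
    Fermat. *)
Lemma represents_lift (fb : PK) : exists (u : psa) f, represents (val u) f fb /\
  forall w m, whom w m fb -> whom w m f.
Proof.
have [r rP] := choice pi_surj.
have n10 : n1%:R != 0 :> K by rewrite (natK_eq0 charK).
have mP : (n1 ^ p.-2 * n1)%:R = 1 :> K.
  apply: (mulfI n10); rewrite -natrM -expnSr -expnS mulr1 -[in RHS](pFrobenius_aut_nat charK).
  by rewrite pFrobenius_autE natrX; congr (_ ^+ _); case: p p_pr => [|[]].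
have [A1 AB AM] := psa_subring_closed AR.
pose c k := val (r fb@_k) * ((n1 ^ p.-2) ^ mdeg k)%:R.
pose f := \sum_(k <- msupp fb) (c k * (n1 ^ mdeg k)%:R) *: ('X_[k] : P).
have fA : \piA f \in psa_pred AR.
  rewrite /f; elim/big_ind: _ => [|g h gA hA|k _].
  - by rewrite (_ : \pi_A 0 = 1 - 1) ?AB // subrr piE.
  - have -> : \piA (g + h) = \piA g - (0 - \piA h) by rewrite coordring_piD sub0r opprK.
    by rewrite !AB // -(subrr 1) AB.
  - rewrite -scalerA -coordring_piZ.
    apply: (@psa_scale_closed _ _ _ AR (c k)); last exact: scaled_monomial.
    by rewrite rpredM // ?rpred_nat //; exact: valP.
exists (Sub (\piA f) fA), f; split; last first.
  move=> w m fbm; rewrite /f big_seq; apply: big_ind => [|g h|k kf]; [exact: whom0|exact: whomD|].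
  by apply: whomZ; rewrite -(fbm k) ?mcoeff_neq0 -?mcoeff_msupp //; apply: whomX.
rewrite SubK; split=> //; rewrite [fb in mreduces _ _ _ fb]mpolyE.
apply: (mreduces_sum charK) => k _; apply: (mreducesZ charK); last exact: mreducesX.
have -> : fb@_k = pi (r fb@_k) * ((n1 ^ p.-2) ^ mdeg k)%:R * (n1 ^ mdeg k)%:R.
  by rewrite -mulrA -natrM -expnMn natrX mP expr1n mulr1 rP.
by do 2?apply: (reducesM charK); first [apply: (reduces_val charK) | apply: (reduces_nat charK)].
Qed.

Variable I : idealr (subring R).
Hypothesis kerpi : forall r, pi r = 0 <-> r \in I.

Lemma psa_val_sum (J : Type) (s : seq J) (T : pred J) (u : J -> psa) :
  val (\sum_(i <- s | T i) u i) = \sum_(i <- s | T i) val (u i) :> A.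
Proof. exact: raddf_sum. Qed.

(** A multiple of [u] by an integer prime to [p] is a combination of scaled monomials with
    coefficients in [I]. Since [p] lies in [I], [p u] lies in [I A_R] too, and Bezout's identity
    concludes. *)
Lemma represents_zero (u : psa) f : represents (val u) f 0 -> u \in @ideal_mod _ I psa.
Proof.
move=> [uf f0]; have [n pn [r rP]] := mreduces_common charK f0.
pose M := (\max_(k <- msupp f) mdeg k)%N.
have uI : u *+ (n1 ^ M * n) \in @ideal_mod _ I psa.
  pose t k : psa := Sub (\piA ((n1 ^ mdeg k)%:R *: 'X_[k])) (scaled_monomial k).
  have vn m : sval (m%:R : subring R) = m%:R :> F by exact: (rmorph_nat (val : {rmorphism subring R -> F})).
  have -> : u *+ (n1 ^ M * n) = \sum_(k <- msupp f) ((n1 ^ (M - mdeg k))%:R * r k) *: t k.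
    apply: val_inj; rewrite psa_val_sum raddfMn /= uf.
    rewrite -scaler_nat [LHS](coordring_piZ Q) {1}[f]mpolyE scaler_sumr coordring_pi_sum.
    rewrite !big_seq; apply: eq_bigr => k kf; rewrite /= [RHS](coordring_piZ Q).
    congr (\piA _); rewrite !scalerA vn -[sval (r k)]/(val (r k)) -(rP k).1.
    have kM : (mdeg k <= M)%N by rewrite /M; apply: leq_bigmax_seq.
    congr (_ *: _); rewrite -{1}(subnK kM) expnD !natrM -!mulrA; congr (_ * _).
    by rewrite mulrC -mulrA.
  rewrite big_seq; apply: rpred_sum => k kf; apply: ideal_modZ.
  by rewrite idealMr //; apply/kerpi; have [_ <-] := rP k; rewrite mcoeff0 mulr0.
have pI : u *+ p \in @ideal_mod _ I psa.
  rewrite -scaler_nat; apply: ideal_modZ; apply/kerpi.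
  by rewrite rmorph_nat; apply/eqP; rewrite (natK_eq0 charK).
have co : coprime p (n1 ^ M * n).
  by rewrite coprimeMr coprimeXr ?prime_coprime.
have [a b E _] := egcdnP (n1 ^ M * n) (prime_gt0 p_pr).
have -> : u = u *+ (a * p) - u *+ (b * (n1 ^ M * n)).
  by rewrite -mulrnBr E ?leq_addr // (eqP co) addKn.
by rewrite mulnC mulrnA [(b * _)%N]mulnC mulrnA rpredB // rpredMn.
Qed.

Lemma represents_uniq u f fb g gb : represents u f fb -> represents u g gb ->
  exists h, fb - gb = Qb * h.
Proof.
move=> [-> fs] [/coordring_eq/asboolP[h E] gs].
have [|hb hP] := @mreduces_divisor _ _ _ _ charK pi Q Qb x0 c0 Qs xc xQ h.
  by move=> k; exists (fb - gb)@_k; rewrite -E; apply: mreducesB.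
exists hb; rewrite mulrC; apply: (mreduces_inj charK (mreducesB charK fs gs)).
by rewrite E; apply: mreducesM.
Qed.

Lemma brack0D f g : brack0 Qb f -> brack0 Qb g -> brack0 Qb (f + g).
Proof.
move=> [h [eta ->]] [h' [eta' ->]]; exists (h + h'), (eta + eta').
by rewrite /dot /= !mderivD; ring.
Qed.

Lemma brack0Z c f : brack0 Qb f -> brack0 Qb (c *: f).
Proof.
move=> [h [eta ->]]; exists (c *: h), (c *: eta).
by rewrite /dot /= !mderivZ -!mul_mpolyC; ring.
Qed.

Lemma brack0_mul h : brack0 Qb (Qb * h).
Proof. by exists h, 0; rewrite /dot /= !mderiv0 !subr0 !mulr0 !addr0. Qed.

Lemma brack0_pbracket f g : brack0 Qb (pbracket Qb f g).
Proof.
exists 0, (smul f (grad g)); rewrite /dot /pbracket /= !mderivM.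
by rewrite (mderiv_comm iy ix) (mderiv_comm iz ix) (mderiv_comm iz iy); ring.
Qed.

Local Notation redalg := (redalg AR I).
Local Notation HP0 := (HP0 AR I).

Lemma HP0_eq0 (u : redalg) : \pi_HP0 u = 0 <->
  u \in lspan (fun u : redalg => exists v1 v2, u = redalg_bracket v1 v2).
Proof.
have -> : 0 = \pi_HP0 0 :> HP0 by rewrite piE.
by rewrite -[u in u \in _]subr0; exact: modquot_eq.
Qed.

Lemma brack0_represents u f fb g gb : represents u f fb -> represents u g gb ->
  brack0 Qb fb -> brack0 Qb gb.
Proof.
move=> uf ug; have [h /eqP] := represents_uniq ug uf.
by rewrite subr_eq => /eqP-> fbr; apply: brack0D => //; apply: brack0_mul.
Qed.

(** The elements of [A_R] with a representative in [brack0] form a submodule [T] that contains all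
    brackets and [I A_R]. *)
Lemma brack0_of_HP0 (u : psa) f fb : represents (val u) f fb ->
  \pi_HP0 (\pi_redalg u) = 0 -> brack0 Qb fb.
Proof.
pose T (v : psa) := exists g gb, represents (val v) g gb /\ brack0 Qb gb.
have T0 : T 0.
  by exists 0, 0; split; [apply: represents0 | rewrite -(mulr0 Qb); apply: brack0_mul].
have TD u1 u2 : T u1 -> T u2 -> T (u1 + u2).
  move=> [f1 [g1 [r1 b1]]] [f2 [g2 [r2 b2]]]; exists (f1 + f2), (g1 + g2).
  by split; [apply: representsD | apply: brack0D].
have TZ (r : subring R) v : T v -> T (r *: v).
  move=> [f1 [g1 [r1 b1]]]; exists (val r *: f1), (pi r *: g1).
  by split; [apply: representsZ => //; apply: (reduces_val charK) | apply: brack0Z].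
have TI (r : subring R) v : r \in I -> T (r *: v).
  move=> /kerpi r0; have [f1 [g1 r1]] := represents_ex (valP v).
  exists (val r *: f1), (pi r *: g1); split; last by rewrite r0 scale0r -(mulr0 Qb); apply: brack0_mul.
  by apply: representsZ => //; apply: (reduces_val charK).
have TB v1 v2 : T (psa_bracket v1 v2).
  have [f1 [g1 r1]] := represents_ex (valP v1).
  have [f2 [g2 r2]] := represents_ex (valP v2).
  by exists (pbracket Q f1 f2), (pbracket Qb g1 g2); split; [apply: represents_bracket | apply: brack0_pbracket].
move=> uf /HP0_eq0/asboolP[s [sB us]].
suff [g [gb [ug gB]]] : T u by apply: (brack0_represents ug uf).
have [v [Tv vs]] : exists v, T v /\ \sum_(x <- s) x.1 *: x.2 = \pi_redalg v.
  elim: s sB {us} => [|[c x] s IH] sB; first by exists 0; rewrite big_nil piE.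
  have [v [Tv vs]] : exists v, T v /\ \sum_(x <- s) x.1 *: x.2 = \pi_redalg v.
    by apply: IH => y ys; apply: sB; rewrite inE ys orbT.
  have /= [v1 [v2 ->]] := sB (c, x) (mem_head _ _).
  exists (repr c *: psa_bracket (repr v1) (repr v2) + v); split; first exact/TD/Tv/TZ/TB.
  rewrite big_cons vs reduction_piD -reduction_piZ reprK /=; congr (_ *: _ + _).
have : \pi_redalg u = \pi_redalg v by rewrite us vs.
move/reduction_eq/asboolP => [t [tI ut]].
rewrite -[u](subrK v) ut; apply: (TD _ _ _ Tv).
elim: t tI {ut} => [|[r x] t IH] tI; first by rewrite big_nil.
rewrite big_cons; apply: (TD); first by apply: (TI); apply: (tI (r, x)); exact: mem_head.
by apply: IH => y yt; apply: tI; rewrite inE yt orbT.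
Qed.

(** The components of [eta] and the variables are lifted to [A_R], and the sum [b] of their brackets
    lifts [grad Qb . curl eta]. After correction by a multiple of [Q] lifting [h Qb], the element
    [u - b] is represented with residue zero. *)
Lemma HP0_of_brack0 (u : psa) f fb : represents (val u) f fb -> brack0 Qb fb ->
  \pi_HP0 (\pi_redalg u) = 0.
Proof.
move=> uf [h [eta E]].
have [_ [h' [[_ hh] _]]] := represents_lift h.
have [v1 [g1 [r1 _]]] := represents_lift eta.1.1.
have [v2 [g2 [r2 _]]] := represents_lift eta.1.2.
have [v3 [g3 [r3 _]]] := represents_lift eta.2.
have [x1 [l1 [s1 _]]] := represents_lift 'X_ix.
have [x2 [l2 [s2 _]]] := represents_lift 'X_iy.
have [x3 [l3 [s3 _]]] := represents_lift 'X_iz.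
pose b := psa_bracket v1 x1 + psa_bracket v2 x2 + psa_bracket v3 x3.
have bP : represents (val b) (pbracket Q g1 l1 + pbracket Q g2 l2 + pbracket Q g3 l3)
    (dot (grad Qb) (curl eta)).
  have -> : dot (grad Qb) (curl eta) = pbracket Qb eta.1.1 'X_ix + pbracket Qb eta.1.2 'X_iy
      + pbracket Qb eta.2 'X_iz.
    by rewrite /pbracket /dot /= !mderivXX /=; ring.
  by apply: representsD; [apply: representsD|]; apply: represents_bracket.
have ub : represents (val (u - b)) (f - h' * Q - (pbracket Q g1 l1 + pbracket Q g2 l2 + pbracket Q g3 l3)) 0.
  have -> : 0 = fb - h * Qb - dot (grad Qb) (curl eta) by rewrite E; ring.
  have uh : represents (val u) (f - h' * Q) (fb - h * Qb).
    case: uf => uE fs; split.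
      by apply: (etrans uE); apply/coordring_eq/asboolP; exists h'; ring.
    by apply: (mreducesB charK) => //; apply: (mreducesM charK).
  exact: (representsB uh bP).
apply/HP0_eq0; have -> : \pi_redalg u = \pi_redalg b.
  by apply/reduction_eq; apply: represents_zero ub.
rewrite /b !reduction_piD; have B w1 w2 : \pi_redalg (psa_bracket w1 w2) \in
    lspan (fun u : redalg => exists v1 v2, u = redalg_bracket v1 v2).
  apply/asboolP; exists [:: (1, \pi_redalg (psa_bracket w1 w2))]; split=> [x|].
    by rewrite inE => /eqP-> /=; exists (\pi w1), (\pi w2); rewrite redalg_bracket_pi.
  by rewrite big_seq1 scale1r.
by rewrite !rpredD.
Qed.

Local Notation k := {ideal_quot I}.
Local Notation HPclass u := (\pi_HP0 (\pi_redalg u)).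

(** The residue field occurs as the quotient ring [k] that acts on [HP0] and as the field [K] of the
    dimension counts; [res] identifies the two. *)
Let res (c : k) : K := pi (repr c).

Lemma res_inj : injective res.
Proof.
move=> c c' E; rewrite -[c]reprK -[c']reprK; apply/eqP.
by rewrite -(Quotient.idealrBE I); apply/kerpi; rewrite rmorphB; apply/eqP; rewrite subr_eq0; apply/eqP.
Qed.

Lemma res_pi r : res (\pi_k r) = pi r.
Proof.
apply/eqP; rewrite -subr_eq0 -rmorphB; apply/eqP/kerpi.
by rewrite (Quotient.idealrBE I) reprK.
Qed.

Lemma HPclassB u v : HPclass (u - v) = HPclass u - HPclass v.
Proof.
have rN (x : psa) : \pi_redalg (- x) = - \pi_redalg x by rewrite piE.
have hN (x : redalg) : \pi_HP0 (- x) = - \pi_HP0 x by rewrite piE.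
by rewrite reduction_piD modquot_piD rN hN.
Qed.

Lemma HPclass_sum n (c : 'I_n -> k) (u : 'I_n -> psa) :
  HPclass (\sum_i repr (c i) *: u i) = \sum_i c i *: HPclass (u i).
Proof.
rewrite (big_morph (fun x => HPclass x) (id1 := 0) (op1 := +%R)); first last.
- have r0 : \pi_redalg 0 = 0 :> redalg by symmetry; rewrite piE.
  have h0 : \pi_HP0 0 = 0 :> HP0 by symmetry; rewrite piE.
  by rewrite r0 h0.
- by move=> x y; rewrite reduction_piD modquot_piD.
apply: eq_bigr => i _; rewrite -[X in _ = X *: _]reprK.
by rewrite -[RHS]/(modquot_scale _ _) modquot_piZ -[X in _ = \pi_HP0 X]/(reduction_scale _ _) reduction_piZ.
Qed.

Variables (w : 'I_3 -> nat) (d : nat).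
Hypothesis Qd : whom w d%:Z Q.

Lemma quasihomogeneousP m (f : P) : quasihomogeneous w m f <-> whom w m%:Z f.
Proof.
split=> [fm l|fm l]; first by rewrite -mcoeff_msupp => /fm->.
by rewrite mcoeff_msupp => /fm[].
Qed.

Lemma represents_hc u f fb m : u \in coordring_homog w m -> represents u f fb ->
  represents u (hc w m%:Z f) (hc w m%:Z fb).
Proof.
move=> /asboolP[f' [/quasihomogeneousP f'm ->]] [/coordring_eq/asboolP[h E] fs].
split; last exact: mreduces_hc.
apply/coordring_eq/asboolP; exists (hc w (m%:Z - d%:Z) h).
rewrite -{1}(hc_id f'm) -raddfB E mulrC [RHS]mulrC.
by rewrite -(hcM _ _ Qd); congr (hc _ _ _); ring.
Qed.

Lemma HP0_dim (m n : nat) (e : 'I_n -> PK) : (forall i, whom w m%:Z (e i)) ->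
  (forall f, whom w m%:Z f -> exists! c : {ffun 'I_n -> K}, brack0 Qb (f - \sum_i c i *: e i)) ->
  has_dim (HP0_homog (AR := AR) (I := I) w m) n.
Proof.
move=> em eP.
have [u uP] := choice (fun i => represents_lift (e i)).
have [f fP] := choice uP.
have [r rP] := choice pi_surj.
exists (fun i => HPclass (u i)); split=> [i|_ [_ [[v [vm ->]] ->]]].
  exists (\pi_redalg (u i)); split=> //; exists (u i); split=> //.
  have [[uf _] fm] := fP i; apply/asboolP; exists (f i); split=> //.
  by apply/quasihomogeneousP/fm/em.
have [g0 [gb0 vg0]] := represents_ex (valP v).
have vg := represents_hc vm vg0.
set gb := hc w m gb0 in vg.
have key (c : {ffun 'I_n -> k}) :
    HPclass v = \sum_i c i *: HPclass (u i) <-> brack0 Qb (gb - \sum_i res (c i) *: e i).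
  pose v' := v - \sum_i repr (c i) *: u i.
  have v'P : represents (val v') (hc w m g0 - \sum_i val (repr (c i)) *: f i)
      (gb - \sum_i res (c i) *: e i).
    have -> : val v' = val v - \sum_i val (repr (c i)) *: val (u i).
      by apply: (etrans (raddfB val v _)); congr (_ - _); exact: psa_val_sum.
    apply: representsB vg _; apply: represents_sum => i _.
    apply: representsZ; first exact: (reduces_val charK).
    by have [] := fP i.
  rewrite -HPclass_sum; split=> E.
    by apply: (brack0_of_HP0 v'P); rewrite HPclassB E subrr.
  by apply/eqP; rewrite -subr_eq0 -HPclassB (HP0_of_brack0 v'P).
have [c [cP cU]] := eP gb (@hc_hom _ _ _ _).
have rc : \sum_i res ([ffun i => \pi_k (r (c i))] i) *: e i = \sum_i c i *: e i.
  by apply: eq_bigr => i _; rewrite ffunE res_pi rP.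
exists [ffun i => \pi_k (r (c i))]; split; first by apply/key; rewrite rc.
move=> c' /key c'P; apply/ffunP => i; rewrite ffunE; apply: res_inj; rewrite res_pi rP.
have -> : c = [ffun i => res (c' i)].
  apply: cU; rewrite (_ : \sum_i _ = \sum_i res (c' i) *: e i) //.
  by apply: eq_bigr => j _; rewrite ffunE.
by rewrite ffunE.
Qed.

End PoissonReduction.

Lemma frobenius_onto (K : fieldType) p (e : seq K) : p \in [pchar K] ->
  (forall x, x \in e) -> forall c : K, exists x, x ^+ p == c.
Proof.
move=> charK eP c; pose f x : K := x ^+ p.
have f_inj : injective f.
  by move=> x y; rewrite /f -!(pFrobenius_autE charK); apply: fmorph_inj.
have fe_uniq : uniq (map f (undup e)) by rewrite map_inj_uniq ?undup_uniq.
have [||_ fE] := @uniq_min_size _ _ (undup e) fe_uniq.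
- by move=> x _; rewrite mem_undup.
- by rewrite size_map.
have : c \in map f (undup e) by rewrite fE mem_undup.
by move=> /mapP[x _ ->]; exists x.
Qed.

Lemma residue_field (F : fieldType) (R : subringClosed F) p (I : prime_idealr (subring R)) :
  in_Spec p I -> exists (K : fieldType) (pi : {rmorphism subring R -> K}),
  [/\ p \in [pchar K], forall c : K, exists x, x ^+ p == c, forall y, exists r, pi r = y
    & forall r, pi r = 0 <-> r \in I].
Proof.
move=> [[e eP] invI charI].
pose D := {ideal_quot I}.
pose K : fieldType := @cfield D invI.
pose pi : {rmorphism subring R -> K} := \pi_D.
exists K, pi; split=> [|c|y|r] /=.
- exact: charI.
- exact: (@frobenius_onto K p e charI eP).
- by exists (repr (y : D)); apply: reprK.
- suff E : \pi_D r = 0 <-> r \in I by exact: E.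
  have -> : 0 = \pi_D 0 by rewrite pi_zeror.
  by rewrite -{2}[r]subr0 (Quotient.idealrBE I); split=> /eqP.
Qed.

Lemma intr_pchar (K : fieldType) p (l : int) : p \in [pchar K] ->
  (l%:~R == 0 :> K) = (p%:Z %| l)%Z.
Proof.
move=> charK; rewrite {1}[l]intEsign rmorphM rmorph_sign mulf_eq0 signr_eq0 /=.
by rewrite -pmulrn (natK_eq0 charK).
Qed.

(** * The Hilbert function for large primes *)

Section HilbertFunction.
Variables (w : 'I_3 -> nat) (d : nat).
Hypothesis w_gt0 : forall i, (0 < w i)%N.
Hypothesis w_lt_d : forall i, (w i < d)%N.
Local Notation sg := (sgw w).
Local Notation pcount := (pcount w).
Variable n0 : nat.
Hypothesis milnor0 : forall n, n0%:Z <= n -> let l := n + sg - d%:Z in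
  (e2 w l + pcount (l - d%:Z - d%:Z) = pcount n + e1 w (l - d%:Z))%N.

(** At most one summand is nonzero in each degree. If [l = p j > 0], then [n >= p - sg + d], which
    the bound on [p] puts beyond the Jacobian ring, and [riemann_roch] gives the dimension. In all
    other degrees [spread] is zero and the Koszul count remains. *)
Lemma hilbert_function : exists p0, forall p, prime p -> (p0 <= p)%N ->
  forall h : nat -> nat,
  (forall m : nat, let l := m%:Z + sg - d%:Z in
   (~~ (p%:Z %| l)%Z || (l <= 0) ->
     (h m + e2 w l + pcount (l - d%:Z - d%:Z) = pcount m%:Z + e1 w (l - d%:Z))%N) /\
   (forall j, l = p%:Z * j -> 0 < l ->
     (h m + pcount (l - sg) + pcount l + pcount (j - d%:Z) =
      pcount m%:Z + pcount j + pcount (l - d%:Z))%N)) ->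
  let P (n : int) : int := pcount n in
  let G (j : int) : int := P (j - sg + d%:Z) - P (j - sg) in
  forall n : int, (act (jacpoly w d) P n)%:~R +
    spread p (fun j => if 0 < j then (G j + G (- j))%:~R else 0) (n + sg - d%:Z)
    = (if n is Posz m then (h m)%:R else 0) :> rat.
Proof.
have M0 : exists n0 : int, forall n, n0 <= n -> let l := n + sg - d%:Z in
  (e2 w l + pcount (l - d%:Z - d%:Z) = pcount n + e1 w (l - d%:Z))%N by exists n0%:Z.
have [p1 RR] := riemann_roch w_gt0 w_lt_d M0.
exists (p1 + n0 + w ix + w iy + w iz)%N => p pr p_ge h hP P G n.
have p_gt0 := prime_gt0 pr.
have jacE := act_jacpoly w_lt_d n; rewrite -/P in jacE.
set l := n + sg - d%:Z in jacE *.
have nE : n = l - sg + d%:Z by rewrite /l; ring.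
have sgE : sg = (w ix)%:Z + (w iy)%:Z + (w iz)%:Z by [].
rewrite /spread; case: ifP => pl; last first.
  rewrite addr0; case: n @l jacE pl nE => [m|m] l jacE pl nE; last by rewrite jac_neg.
  have [/(_ _)H _] := hP m; rewrite -/l pl in H; have {}H := H isT.
  rewrite jacE; apply/eqP; rewrite [(h m)%:R]pmulrn eqr_int; apply/eqP.
  by rewrite /P; lia.
set j := (l %/ p%:Z)%Z; have lE : l = p%:Z * j by rewrite mulrC /j divzK.
case: ifP => j_gt0; last first.
  have l_le0 : l <= 0 by rewrite lE pmulr_rle0 // leNgt j_gt0.
  rewrite addr0; case: n @l jacE pl nE @j lE j_gt0 l_le0 => [m|m] l jacE pl nE j lE j_gt0 l_le0; last by rewrite jac_neg.
  have [/(_ _)H _] := hP m; rewrite -/l l_le0 orbT in H; have {}H := H isT.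
  rewrite jacE; apply/eqP; rewrite [(h m)%:R]pmulrn eqr_int; apply/eqP.
  by rewrite /P; lia.
have l_ge : p%:Z <= l by rewrite lE -{1}[p%:Z]mulr1 ler_pM2l //; lia.
have n_ge : n0%:Z <= n by rewrite nE sgE; lia.
have jac0 : act (jacpoly w d) P n = 0.
  rewrite jacE; have := milnor0 n_ge; rewrite -/l /P; lia.
have := RR p pr _ j j_gt0; rewrite -lE => /(_ _)/=; rewrite -/P => RRj.
rewrite jac0 add0r; case: n @l jacE pl nE @j lE j_gt0 l_ge n_ge jac0 RRj => [m|m]; last by [].
move=> l jacE pl nE j lE j_gt0 l_ge n_ge jac0 RRj.
have [_ H] := hP m; have {}H := H j lE.
have l_gt0 : 0 < l by rewrite (lt_le_trans _ l_ge) //; lia.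
have {}H := H l_gt0; rewrite -/l in H.
rewrite [(h m)%:R]pmulrn; congr (_%:~R).
rewrite /G addrA; apply: (etrans (esym (RRj _))); first by lia.
rewrite -nE /P; move: H; clear; clearbody j; clearbody l.
move: (pcount m%:Z) (pcount (l - sg)) (pcount l) (pcount (l - d%:Z)) (pcount j) (pcount (j - d%:Z)).
lia.
Qed.

End HilbertFunction.

Lemma span_denominator (F : fieldExtType rat) (Q : {mpoly F[3]}) (R : subringClosed F)
    (AR : poissonSubalg Q R) : generates_field R -> spanning_subalg AR ->
  forall s : seq (coordring Q),
  exists2 n, (0 < n)%N & forall u, u \in s -> n%:R *: u \in psa_pred AR.
Proof.
move=> R_gen AR_span; have [A1 AB AM] := psa_subring_closed AR.
have A0 : 0 \in psa_pred AR by rewrite -(subrr 1) AB.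
have AD u v : u \in psa_pred AR -> v \in psa_pred AR -> u + v \in psa_pred AR.
  by move=> uA vA; rewrite -[v]opprK AB // -[- v]sub0r AB.
elim=> [|u s [n n0 ns]]; first by exists 1%N.
have [m m0 mu] : exists2 m, (0 < m)%N & m%:R *: u \in psa_pred AR.
  have /asboolP[t [tA ->]] := AR_span u.
  have [m m0 mt] := common_denominator R_gen [seq x.1 | x <- t].
  exists m => //; rewrite scaler_sumr big_seq; apply: (big_ind (fun u => u \in psa_pred AR)) => // x xt.
  rewrite scalerA; apply: (@psa_scale_closed _ _ _ AR (m%:R * x.1)); last exact: tA.
  by apply: mt; apply: map_f.
exists (m * n)%N => [|v]; first by rewrite muln_gt0 m0.
rewrite inE natrM => /orP[/eqP->|vs].
  by rewrite [m%:R * _]mulrC -scalerA; apply: (@psa_scale_closed _ _ _ AR n%:R); rewrite ?rpred_nat.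
by rewrite -scalerA; apply: (@psa_scale_closed _ _ _ AR m%:R); rewrite ?rpred_nat ?ns.
Qed.

Theorem theorem3p3 (F : fieldExtType rat) (a b c d : nat) (Q : {mpoly F[3]})
    (R : subringClosed F) (AR : poissonSubalg Q R)
    (a_gt0 : (0 < a)%N) (b_gt0 : (0 < b)%N) (c_gt0 : (0 < c)%N)
    (d_gt0 : (0 < d)%N)
    (Qhom : quasihomogeneous (wt a b c) d Q)
    (Qisol : isolated_singularity Q)
    (R_fg : fg_subring R)
    (R_gen : generates_field R)
    (AR_fg : fg_subalg AR)
    (AR_graded : graded_subalg AR (wt a b c))
    (AR_span : spanning_subalg AR) :
  exists p0 : nat, forall p : nat, prime p -> (p0 <= p)%N ->
  forall pp : prime_idealr (subring R), in_Spec p pp ->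
  let t : ratfun := rf_var in
  let z : ratfun := rf_var in
  let g : ratfun :=
    z ^ (a%:Z + b%:Z + c%:Z - d%:Z) *
    ((1 - z ^+ d) / ((1 - z ^+ a) * (1 - z ^+ b) * (1 - z ^+ c))) in
  let f : ratfun :=
    g - principal_part g + rf_comp (principal_part g) z^-1
      - rf_const (laurent g 0) in
  hilbert_series_is (HP0_homog (AR := AR) (I := pp) (wt a b c))
    ((1 - t ^ (d%:Z - a%:Z)) * (1 - t ^ (d%:Z - b%:Z)) * (1 - t ^ (d%:Z - c%:Z))
       / ((1 - t ^+ a) * (1 - t ^+ b) * (1 - t ^+ c))
     + t ^ (d%:Z - a%:Z - b%:Z - c%:Z) * rf_comp f (t ^+ p)).
Proof.
pose w := wt a b c.
have w_gt0 i : (0 < w i)%N by elim/ord3P: i.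
have Qd : whom w d%:Z Q by apply/quasihomogeneousP.
have natF n : (n%:R == 0 :> F) = (n == 0)%N.
  by rewrite -scaler_nat scaler_eq0 oner_eq0 orbF pnatr_eq0.
have dF : d%:R != 0 :> F by rewrite natF -lt0n.
have [N XN] := jacobian_powers w_gt0 dF Qd Qisol.
have w_lt_d := weight_lt_degree w_gt0 dF Qd Qisol.
have milnor0 := milnor_vanish w_gt0 Qd XN.
have [p1 HF] := hilbert_function w_gt0 w_lt_d milnor0.
have [gens [_ gens_fg]] := AR_fg.
have [v vP] := choice XN.
(* The polynomials that must survive reduction: [Q], the witnesses that [X_i ^ N] lies in the
   Jacobian ideal, and representatives of the generators of [A_R]. The inverse leading coefficient
   [x0] is added for [mreduces_divisor]. *)
pose polys := Q :: [seq (v i).1.1 | i <- enum 'I_3] ++ [seq (v i).1.2 | i <- enum 'I_3] ++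
  [seq (v i).2 | i <- enum 'I_3] ++ [seq repr u | u <- gens].
pose x0 := (mleadc Q)^-1.
have [n0 n0_gt0 n0P] := common_denominator R_gen
  (x0 :: flatten [seq [seq f@_k | k <- msupp f] | f <- polys]).
have [n1 n1_gt0 n1P] := span_denominator R_gen AR_span [seq \pi_(coordring Q) 'X_i | i <- enum 'I_3].
(* Beyond the bound [p1], [p] exceeds both denominators, the weights and the degree, so these are
   invertible in the residue field. *)
exists (p1 + n0 + n1 + a + b + c + d).+1 => p pr p_ge pp ppS t z g f.
have [K [pi [charK perfK pi_surj kerpi]]] := residue_field ppS.
have ndvd n : (0 < n)%N -> (n < p)%N -> ~~ (p %| n)%N by move=> n_gt0 n_lt; rewrite gtnNdvd.
have natK n : (0 < n)%N -> (n < p)%N -> n%:R != 0 :> K.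
  by move=> n_gt0 n_lt; rewrite (natK_eq0 charK) ndvd.
have integral h : h \in polys -> exists hb, mreduces p pi h hb.
  move=> hp; apply: (mreduces_ex charK) => k.
  have [kh|/memN_msupp_eq0->] := boolP (k \in msupp h); last by exists 0; apply: reduces0.
  apply: (@reduces_ex _ _ _ _ charK pi _ n0); last by apply: ndvd => //; lia.
  apply: n0P; rewrite inE; apply/orP; right; apply/flatten_mapP.
  by exists h => //; apply: map_f.
have [Qb Qs] : exists Qb, mreduces p pi Q Qb by apply: integral; rewrite inE eqxx.
have [c0 xc] : exists c0, reduces p pi x0 c0.
  apply: (@reduces_ex _ _ _ _ charK pi _ n0); last by apply: ndvd => //; lia.
  by apply: n0P; rewrite inE eqxx.
have Q0 : Q != 0.
  have := forms_neq0 XN; apply: contra => /eqP->; apply/eqP.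
  by rewrite /grad !mderiv0.
have xQ : x0 * mleadc Q = 1 by rewrite mulVf // mleadc_eq0.
have Qbd : whom w d%:Z Qb.
  have H : mreduces p pi (hc w d%:Z Q) (hc w d%:Z Qb) by exact: mreduces_hc.
  rewrite (mreduces_inj charK Qs (g' := hc w d%:Z Qb)); first exact: hc_hom.
  by rewrite -[in X in mreduces _ _ X _](hc_id Qd).
have Xqb i : exists vb, 'X_i ^+ N = dot (grad Qb) vb.
  have iE : i \in enum 'I_3 by rewrite mem_enum.
  have [v1 h1] : exists vb, mreduces p pi (v i).1.1 vb.
    by apply: integral; rewrite inE !mem_cat (map_f (fun i => (v i).1.1) iE) ?orbT.
  have [v2 h2] : exists vb, mreduces p pi (v i).1.2 vb.
    by apply: integral; rewrite inE !mem_cat (map_f (fun i => (v i).1.2) iE) ?orbT.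
  have [v3 h3] : exists vb, mreduces p pi (v i).2 vb.
    by apply: integral; rewrite inE !mem_cat (map_f (fun i => (v i).2) iE) ?orbT.
  exists (v1, v2, v3).
  apply: (mreduces_inj charK (f := dot (grad Q) (v i))).
    by rewrite -vP !mpolyXn; apply: (mreducesX charK).
  by apply: (mreducesD charK); [apply: (mreducesD charK)|]; apply: (mreducesM charK) => //;
    apply: (mreduces_deriv charK).
have w_lt_p i : (w i < p)%N.
  by elim/ord3P: i; [change (a < p)%N | change (b < p)%N | change (c < p)%N]; lia.
have wK i : (w i)%:R != 0 :> K by apply: natK.
have dK : d%:R != 0 :> K by apply: natK => //; lia.
have [h hP] := choice (fun m : nat => brack0_basis charK perfK w_gt0 wK dK Qbd Xqb m%:Z).
exists h; split=> [m|n].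
  have [e [em eP _]] := hP m.
  have gens_rep u : u \in gens -> exists f fb, represents p pi u f fb.
    move=> ug; have [fb fbP] : exists fb, mreduces p pi (repr u) fb.
      by apply: integral; rewrite inE !mem_cat [repr u \in map _ gens]map_f ?orbT.
    by exists (repr u), fb; split; rewrite ?reprK.
  have n1X i : \pi_(coordring Q) (n1%:R *: 'X_i) \in psa_pred AR.
    by rewrite -coordring_piZ; apply: n1P; apply: (map_f (fun i => \pi_(coordring Q) 'X_i)); rewrite mem_enum.
  have pn1 : ~~ (p %| n1)%N by apply: ndvd => //; lia.
  exact: (HP0_dim charK pi_surj Qs xc xQ gens_fg gens_rep pn1 n1X kerpi Qd em eP).
apply: (etrans (laurent_target w_gt0 w_lt_d (prime_gt0 pr) n)).
apply: (HF p pr _ h) => [|m l]; first by lia.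
have [e [_ _ [H1 H2]]] := hP m; split=> //.
by rewrite -(intr_pchar _ charK); apply: H1.
Qed.
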